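(* For every positive integer $n$, the QAST partition function at $u_{n+1}=p$, $Z^{\uparrow}_n(u_1,\ldots,u_n;p)_{\mathrm{QAST}}$, is equal to $$\frac{\prod_{i=1}^n\sigma(q^2 p u_i)\,\sigma(q^2 \bar p \bar u_i)\, \prod_{i,j=1}^n\sigma(q^2u_iu_j)\,\sigma(q^2 \bar u_i \bar u_j)} {\sigma(q^2)^{2n}\,\sigma(q^4)^{n^2}\,\prod_{1\le i<j\le n}\sigma(u_i \bar u_j)^2}\; \det_{1\le i,j\le n}\left( \frac{1}{\sigma(q^2u_iu_j)}+ \frac{1}{\sigma(q^2 \bar u_i \bar u_j)} \right).$$
   Context: Here $p,q,u_1,\dots,u_{n+1}$ are indeterminates; write $\bar x=x^{-1}$ and $\sigma(x)=x-\bar x$. Graph. Let $\mathcal T_n$ be the graph with vertices $(0,j)$, $1\le j\le 2n+1$, and $(i,j)$, $1\le i\le n+1$, $i\le j\le 2n+2-i$ (matrix coordinates: $i$ increases downwards, $j$ increases to the right). Vertical edges join $(i-1,j)$ and $(i,j)$ whenever both are vertices; horizontal edges join $(i,j)$ and $(i,j+1)$ whenever both are vertices and $i\ge1$. Bulk vertices: $(i,j)$ with $1\le i\le n$, $i<j<2n+2-i$ (degree 4). Left boundary vertices: $(i,i)$, $1\le i\le n$ (one edge going up, one going right). Right boundary vertices: $(i,2n+2-i)$, $1\le i\le n$ (one edge going up, one going left). The remaining vertices have degree 1; among them $(n+1,n+1)$ is the bottom vertex, and its unique edge is the bottom vertical edge. A configuration is an orientation of $\mathcal T_n$ such that each bulk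 vertex has two incoming and two outgoing edges and each top edge is directed upwards (from $(1,j)$ to $(0,j)$). The label of the bulk vertex $(i,j)$ is $u_iu_{\min(j,2n+2-j)}$, and the label of the boundary vertices $(i,i)$ and $(i,2n+2-i)$ is $u_i$. The weight of a configuration is the product of all vertex weights; degree 1 vertices have weight 1, and the other vertices, with label $u$, have the following weights. Bulk: weight $1$ if both vertical edges are outgoing or both are incoming; $\sigma(q^2u)/\sigma(q^4)$ if both vertical edges point up and both horizontal edges point right, or both vertical edges point down and both horizontal edges point left; $\sigma(q^2\bar u)/\sigma(q^4)$ if both vertical edges point down and both horizontal edges point right, or both vertical edges point up and both horizontal edges point left. Left boundary (QAST specialization): vertical edge outgoing and horizontal edge incoming: $\sigma(pq^2u)/\sigma(q^2)$; vertical edge incoming and horizontal edge outgoing: $\sigma(p\bar u)/\sigma(q^2)$; both incoming: $0$; both outgoing: $\sigma(q^2u^2)/\sigma(q^2)$. Right boundary (QAST specialization): vertical edge outgoing and horizontal edge incoming: $\sigma(\bar pq^2\bar u)/\sigma(q^2)$; vertical edge incoming and horizontal edge outgoing: $\sigma(\bar pu)/\sigma(q^2)$; both incoming: $0$; both outgoing: $\sigma(q^2\bar u^2)/\sigma(q^2)$. $Z^{\uparrow}_n(u_1,\dots,u_n;u_{n+1})_{\mathrm{QAST}}$ is the sum of the weights of all configurations in which the bottom vertical edge points up (from $(n+1,n+1)$ to $(n,n+1)$). *)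

(* Defs.v *)
From HB Require Import structures.
From mathcomp Require Import all_boot all_order all_algebra.
From mathcomp Require Import mpoly.

Set Implicit Arguments.
Unset Strict Implicit.
Unset Printing Implicit Defensive.

Import GRing.Theory.

Local Open Scope ring_scope.

(* The matrix coordinates (i, j) of the text are kept as they are, so i ranges
   over 0..n+1 and j over 1..2n+1; column 0 and the part of the grid outside the
   triangle carry no vertex. *)
Definition node (n : nat) : finType := ('I_n.+2 * 'I_(2 * n).+2)%type.

(* [inord] is only ever applied to coordinates within range. *)
Definition pt (n i j : nat) : node n := (inord i, inord j).

Definition is_vertex (n : nat) (x : node n) : bool :=
  [|| (x.1 == 0%N :> nat) && (1 <= x.2 <= 2 * n + 1)%N
    | (1 <= x.1 <= n + 1)%N && (x.1 <= x.2 <= 2 * n + 2 - x.1)%N].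

Definition vedge (n : nat) (x y : node n) : bool :=
  [&& is_vertex x, is_vertex y, y.1 == x.1.+1 :> nat & x.2 == y.2].

Definition hedge (n : nat) (x y : node n) : bool :=
  [&& is_vertex x, is_vertex y, x.1 == y.1, (1 <= x.1)%N
    & y.2 == x.2.+1 :> nat].

Definition adj (n : nat) (x y : node n) : bool :=
  [|| vedge x y, vedge y x, hedge x y | hedge y x].

Definition is_bulk (n : nat) (x : node n) : bool :=
  (1 <= x.1 <= n)%N && (x.1 < x.2 < 2 * n + 2 - x.1)%N.

(* An orientation is the set A of its arcs: (x, y) \in A means that the edge
   between x and y is directed from x to y. *)
Definition is_orientation (n : nat) (A : {set node n * node n}) : bool :=
  [forall x, forall y,
     if adj x y then ((x, y) \in A) (+) ((y, x) \in A) else (x, y) \notin A].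

Definition is_configuration (n : nat) (A : {set node n * node n}) : bool :=
  [&& is_orientation A,
      [forall x, is_bulk x ==>
         (#|[set y | (y, x) \in A]| == 2%N) && (#|[set y | (x, y) \in A]| == 2%N)]
    & [forall x, forall y,
         vedge x y && (x.1 == 0%N :> nat) ==> ((y, x) \in A)]].

Section Weights.

Variable F : fieldType.

Definition sigma (x : F) : F := x - x^-1.

(* In the three weight functions below, the boolean arguments tell, for each
   edge at the vertex, whether it is outgoing. *)

(* The default case is not reached in a configuration. *)
Definition bulk_weight (q x : F) (up down left right : bool) : F :=
  match up, down, left, right with
  | true, true, false, false | false, false, true, true => 1
  | true, false, false, true | false, true, true, false =>
      sigma (q ^+ 2 * x) / sigma (q ^+ 4)
  | false, true, false, true | true, false, true, false =>
      sigma (q ^+ 2 * x^-1) / sigma (q ^+ 4)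
  | _, _, _, _ => 0
  end.

Definition left_weight (p q x : F) (vert hor : bool) : F :=
  match vert, hor with
  | true, false => sigma (p * q ^+ 2 * x) / sigma (q ^+ 2)
  | false, true => sigma (p * x^-1) / sigma (q ^+ 2)
  | false, false => 0
  | true, true => sigma (q ^+ 2 * x ^+ 2) / sigma (q ^+ 2)
  end.

Definition right_weight (p q x : F) (vert hor : bool) : F :=
  match vert, hor with
  | true, false => sigma (p^-1 * q ^+ 2 * x^-1) / sigma (q ^+ 2)
  | false, true => sigma (p^-1 * x) / sigma (q ^+ 2)
  | false, false => 0
  | true, true => sigma (q ^+ 2 * (x^-1) ^+ 2) / sigma (q ^+ 2)
  end.

(* The parameter u_k, 1 <= k <= n+1, where u_1, ..., u_n are the values of
   u : 'I_n -> F (indexed from 0) and u_{n+1} = w. *)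
Definition param (n : nat) (u : 'I_n -> F) (w : F) (k : nat) : F :=
  if insub k.-1 is Some i then u i else w.

Definition config_weight (n : nat) (p q : F) (u : 'I_n -> F) (w : F)
    (A : {set node n * node n}) : F :=
  let U := param u w in
  let out i j i' j' := (pt n i j, pt n i' j') \in A in
  (\prod_(1 <= i < n.+1) \prod_(i.+1 <= j < 2 * n + 2 - i)
     bulk_weight q (U i * U (minn j (2 * n + 2 - j)))
       (out i j i.-1 j) (out i j i.+1 j) (out i j i j.-1) (out i j i j.+1))
  * (\prod_(1 <= i < n.+1)
       left_weight p q (U i) (out i i i.-1 i) (out i i i i.+1))
  * (\prod_(1 <= i < n.+1)
       let j := (2 * n + 2 - i)%N in
       right_weight p q (U i) (out i j i.-1 j) (out i j i j.-1)).

(* Z^up_n(u_1, ..., u_n; w)_QAST *)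
Definition Z_up_QAST (n : nat) (p q : F) (u : 'I_n -> F) (w : F) : F :=
  \sum_(A : {set node n * node n} |
        is_configuration A && ((pt n n.+1 n.+1, pt n n n.+1) \in A))
     config_weight p q u w A.

End Weights.

(* Rational functions over K in m indeterminates. *)
Definition ratfun (K : fieldType) (m : nat) : fieldType :=
  {fraction {mpoly K[m]}}.

Definition ratX (K : fieldType) (m : nat) (i : 'I_m) : ratfun K m :=
  @FracField.tofrac {mpoly K[m]} 'X_i.

(* Main.v *)
Require Import Defs.
From HB Require Import structures.
From mathcomp Require Import all_boot all_order all_algebra all_field.
From mathcomp Require Import ring zify.
From mathcomp Require Import mpoly.

(** Multiplying every bulk weight by sigma(q^4) and every boundary weight by
    sigma(q^2) turns the partition function into a sum [Zup] without
    denominators, and the formula into [det_formula]: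
      Zup(u) * prod_(i<j) sigma(u_i/u_j)^2
        = prod_i pole_den(p u_i) * prod_(i,j) pole_den(u_i u_j) * det kern(u_i u_j),
    where, with Q = q^2,
      pole_den(x) = sigma(Q x) sigma(Q/x),  kern(x) = 1/sigma(Q x) + 1/sigma(Q/x).
    The formula is proved by strong induction on the number of parameters: all
    of them but the first one, X, are fixed, and both sides are compared as
    Laurent polynomials in X.

    The left side.  Only the first row of the triangle depends on X, which
    bounds the degree of Zup in X ([laurent_Zup]).  At special values of X the
    configurations freeze:
    - if sigma(Q X^2) = 0, the left boundary vertex of the first row cannot emit
      both its edges, every horizontal edge of that row points left, and the
      row can be removed ([Zup_freeze1]);
    - if sigma(Q X v) = 0 where v is the second parameter, the first two rows
      can be removed, after a cancellation between the two states of the left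
      boundary vertex of the second row ([Zup_freeze2]);
    - if sigma(Q X p) = 0 and X is the last parameter, the last row has weight 0
      in every state ([Zup_last0]); this is where u_(n+1) = p enters.
    Reflecting the triangle in its vertical axis inverts p and all the
    parameters ([Zup_mirror]), which gives the same evaluations at the inverse
    points.  They reach every pair (X, u_j), and X in last position, because Zup
    is symmetric in its parameters ([Zup_swap]): an additional crossing of two
    neighbouring vertical lines at the upper left is moved along these two lines
    by the Yang-Baxter and reflection equations, and leaves at the upper right.

    The right side.  Expanding the determinant along its first row and column
    and clearing the poles gives [border_num].  It is a bilinear expression in
    two copies of X which vanishes when either copy is u_j or -u_j, so that it
    has double zeros at these points, like prod_j sigma(X/u_j)^2 on the left.

    Counting.  With m parameters besides X, the difference of the two sides,
    times X^(4m+5), is a polynomial of degree at most 8m + 10 in X.  It has the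
    4m roots q^(+-2)/u_j and their opposites, the 8 fourth roots of Q^2 and
    Q^(-2), the 4 points q^(+-2)/p and their opposites, and the 2m double roots
    u_j and -u_j: 8m + 12 roots with multiplicity.  So it is zero.  Some of the
    roots need a square root of -1; when the field has none, one is adjoined
    ([det_formula_generic]).  That these roots are distinct for indeterminates
    follows by giving the indeterminates powers of 2 as values
    ([generic_node_squares_uniq]).

    Finally a configuration is encoded by the set of its edges that point up or
    to the right, and summing over these edges one at a time, row by row, gives
    the recursive definition of Zup ([Z_up_QASTE]). *)

Set Implicit Arguments.
Unset Strict Implicit.
Unset Printing Implicit Defensive.

Import GRing.Theory.
Local Open Scope ring_scope.

(** * Local relations of the six-vertex model *)

Section Local.
Variables (F : fieldType) (Q : F).
Hypothesis Q0 : Q != 0.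

(** These weights are those of the text times sigma(q^4) in the bulk and
    sigma(q^2) on the boundary, with Q = q^2.  States of edges: [true] is up for
    a vertical edge and right for a horizontal one; [t], [b], [h], [g] are the
    edges above, below, to the left and to the right of the vertex. *)
Definition bulk_wt (x : F) (t b h g : bool) : F :=
  match t, b, h, g with
  | true, false, true, false | false, true, false, true => sigma (Q ^+ 2)
  | true, true, true, true | false, false, false, false => sigma (Q * x)
  | false, false, true, true | true, true, false, false => sigma (Q * x^-1)
  | _, _, _, _ => 0
  end.

Definition left_wt (p x : F) (t h : bool) : F :=
  match t, h with
  | true, false => sigma (p * Q * x)
  | false, true => sigma (p * x^-1)
  | false, false => 0
  | true, true => sigma (Q * x ^+ 2)
  end.

(** The reflection in the vertical axis reverses the horizontal edge and
    inverts both parameters. *)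
Definition right_wt (p x : F) (t h : bool) : F := left_wt p^-1 x^-1 t (~~ h).

(** The R-matrix: the weights of an additional vertex where two neighbouring
    parallel lines cross, from [t1], [t2] to [s1], [s2].  The same weights serve
    for vertical and for horizontal lines. *)
Definition cross_wt (x : F) (t1 t2 s1 s2 : bool) : F :=
  match t1, t2, s1, s2 with
  | true, true, true, true | false, false, false, false => sigma (Q ^+ 2 * x^-1)
  | true, false, true, false | false, true, false, true => sigma (Q ^+ 2)
  | true, false, false, true | false, true, true, false => sigma x
  | _, _, _, _ => 0
  end.

(** A crossing of the vertical lines a and b moves down through the
    horizontal line c.  For fixed outer edges this is an identity between
    Laurent polynomials. *)
Lemma yang_baxter_vertical (a b c : F) (t1 t2 b1 b2 h g : bool) :
  a != 0 -> b != 0 -> c != 0 ->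
  \sum_(s1 : bool) \sum_(s2 : bool) cross_wt (a / b) t1 t2 s1 s2 *
    \sum_(m : bool) bulk_wt (c * a) s1 b1 h m * bulk_wt (c * b) s2 b2 m g
  = \sum_(s1 : bool) \sum_(s2 : bool)
    (\sum_(m : bool) bulk_wt (c * b) t1 s1 h m * bulk_wt (c * a) t2 s2 m g)
    * cross_wt (a / b) s1 s2 b1 b2.
Proof.
move=> a0 b0 c0; rewrite !big_bool.
case: t1 t2 b1 b2 h g => [] [] [] [] [] []; rewrite /= /sigma ?(mulr0, mul0r, addr0, add0r) //;
  by field; rewrite ?Q0 ?a0 ?b0 ?c0.
Qed.

(** A crossing of the horizontal lines a and b moves to the right through
    the vertical line c. *)
Lemma yang_baxter_horizontal (a b c : F) (h1 h2 g1 g2 t d : bool) :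
  a != 0 -> b != 0 -> c != 0 ->
  \sum_(m1 : bool) \sum_(m2 : bool) cross_wt (a / b) h1 h2 m1 m2 *
    \sum_(v : bool) bulk_wt (a * c) t v m1 g1 * bulk_wt (b * c) v d m2 g2
  = \sum_(m1 : bool) \sum_(m2 : bool)
    (\sum_(v : bool) bulk_wt (b * c) t v h1 m1 * bulk_wt (a * c) v d h2 m2)
    * cross_wt (a / b) m1 m2 g1 g2.
Proof.
move=> a0 b0 c0; rewrite !big_bool.
case: t d h1 h2 g1 g2 => [] [] [] [] [] []; rewrite /= /sigma ?(mulr0, mul0r, addr0, add0r) //;
  by field; rewrite ?Q0 ?a0 ?b0 ?c0.
Qed.

(** A crossing of two vertical lines goes into the corner formed by the left
    ends of two successive rows, and comes out of it between the two rows. *)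
Lemma reflection_left (p a b : F) (t1 t2 g1 g2 : bool) :
  p != 0 -> a != 0 -> b != 0 ->
  \sum_(s1 : bool) \sum_(s2 : bool) cross_wt (a / b) t1 t2 s1 s2 *
    \sum_(h : bool) \sum_(v : bool)
       left_wt p a s1 h * bulk_wt (a * b) s2 v h g1 * left_wt p b v g2
  = \sum_(m1 : bool) \sum_(m2 : bool)
    (\sum_(h : bool) \sum_(v : bool)
       left_wt p b t1 h * bulk_wt (a * b) t2 v h m1 * left_wt p a v m2)
    * cross_wt (a / b) m1 m2 g1 g2.
Proof.
move=> p0 a0 b0; rewrite !big_bool.
case: t1 t2 g1 g2 => [] [] [] []; rewrite /= /sigma ?(mulr0, mul0r, addr0, add0r) //; by field;
  rewrite ?Q0 ?a0 ?b0 ?p0.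
Qed.

(** The crossing between two rows climbs back to the vertical lines at the
    right ends of the rows. *)
Lemma reflection_right (p a b : F) (t1 t2 h1 h2 : bool) :
  p != 0 -> a != 0 -> b != 0 ->
  \sum_(m1 : bool) \sum_(m2 : bool) cross_wt (a / b) h1 h2 m1 m2 *
    \sum_(g : bool) \sum_(v : bool)
       bulk_wt (a * b) t1 v m1 g * right_wt p a t2 g * right_wt p b v m2
  = \sum_(s1 : bool) \sum_(s2 : bool)
    (\sum_(g : bool) \sum_(v : bool)
       bulk_wt (a * b) s1 v h1 g * right_wt p b s2 g * right_wt p a v h2)
    * cross_wt (a / b) t1 t2 s1 s2.
Proof.
move=> p0 a0 b0; rewrite !big_bool.
case: t1 t2 h1 h2 => [] [] [] []; rewrite /right_wt /= /sigma ?(mulr0, mul0r, addr0, add0r) //;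
  rewrite ?(invfM, invrK, exprVn); by field; rewrite ?Q0 ?a0 ?b0 ?p0.
Qed.
End Local.

(** * Symmetry of the triangular partition function *)

Section Rows.
Variables (F : fieldType) (Q : F).
Local Notation vw := (bulk_wt Q).
Local Notation cw := (cross_wt Q).

(** The sum over all states of a row with parameter [u] across the columns
    [cols], with left edge [h] and upper edges [ts].  The continuation [k] takes
    the lower edges and the right edge, so that successive rows are nested
    calls; upper edges in excess of the columns are ignored. *)
Fixpoint row_sum (u : F) (cols : seq F) (h : bool) (ts : seq bool)
    (k : seq bool -> bool -> F) : F :=
  if cols is c :: cols' then
    \sum_(b : bool) \sum_(g : bool) vw (u * c) (head true ts) b h g *
       row_sum u cols' g (behead ts) (fun bs => k (b :: bs))
  else k [::] h.

Lemma eq_row_sum u cols h ts k1 k2 :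
    (forall bs g, size bs = size cols -> k1 bs g = k2 bs g) ->
  row_sum u cols h ts k1 = row_sum u cols h ts k2.
Proof.
elim: cols h ts k1 k2 => [|c cols IH] h ts k1 k2 eqk /=; first exact: eqk.
apply: eq_bigr => b _; apply: eq_bigr => g _; congr (_ * _).
by apply: IH => bs g' sz; apply: eqk; rewrite /= sz.
Qed.

Lemma row_sum_linear (I : finType) u cols h ts (c : I -> F) k :
  row_sum u cols h ts (fun bs g => \sum_i c i * k i bs g)
  = \sum_i c i * row_sum u cols h ts (k i).
Proof.
elim: cols h ts k => [|d cols IH] h ts k //=.
under eq_bigr do under eq_bigr do rewrite IH mulr_sumr.
under eq_bigr do rewrite exchange_big /=.
rewrite exchange_big /=; apply: eq_bigr => i _; rewrite mulr_sumr.
apply: eq_bigr => b _; rewrite mulr_sumr; apply: eq_bigr => g _.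
by rewrite mulrCA.
Qed.

Lemma row_sumZ u cols h ts c k :
  row_sum u cols h ts (fun bs g => c * k bs g) = c * row_sum u cols h ts k.
Proof.
have := row_sum_linear u cols h ts (fun _ : unit => c) (fun _ => k).
rewrite big_const /= card_unit /= addr0 => <-.
by apply: eq_row_sum => bs g _; rewrite big_const card_unit /= addr0.
Qed.

Lemma row_sum_bool u cols h ts k :
  row_sum u cols h ts (fun bs g => \sum_(i : bool) k i bs g)
  = \sum_(i : bool) row_sum u cols h ts (k i).
Proof.
have := row_sum_linear u cols h ts (fun _ : bool => 1) k.
under [RHS]eq_bigr do rewrite mul1r.
move=> <-; apply: eq_row_sum => bs g _.
by under [RHS]eq_bigr do rewrite mul1r.
Qed.

Lemma row_sum_cat u c1 c2 h t1 t2 k : size t1 = size c1 ->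
  row_sum u (c1 ++ c2) h (t1 ++ t2) k
  = row_sum u c1 h t1 (fun b1 g =>
      row_sum u c2 g t2 (fun b2 => k (b1 ++ b2))).
Proof.
elim: c1 h t1 k => [|c c1 IH] h [|t t1] k //= [sz].
by apply: eq_bigr => b _; apply: eq_bigr => g _; rewrite IH.
Qed.

(** A crossing of the vertical lines number i and i+1, placed on top of the
    function [f] of the upper edges. *)
Definition cross_at (x : F) (i : nat) (f : seq bool -> F) (ts : seq bool) : F :=
  \sum_(s1 : bool) \sum_(s2 : bool)
    cw x (nth true ts i) (nth true ts i.+1) s1 s2
    * f (take i ts ++ s1 :: s2 :: drop i.+2 ts).

Lemma cross_at_cons x i f t ts :
  cross_at x i.+1 f (t :: ts) = cross_at x i (fun ts => f (t :: ts)) ts.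
Proof. by []. Qed.

Lemma cross_at_cat x f t1 t2 :
  cross_at x (size t1) f (t1 ++ t2) = cross_at x 0 (fun ts => f (t1 ++ ts)) t2.
Proof. by elim: t1 f => [|t t1 IH] f //=; rewrite cross_at_cons IH. Qed.

Lemma eq_cross_at x i f1 f2 ts :
    (i.+1 < size ts)%N ->
    (forall s, size s = size ts -> f1 s = f2 s) ->
  cross_at x i f1 ts = cross_at x i f2 ts.
Proof.
move=> lti eqf; apply: eq_bigr => s1 _; apply: eq_bigr => s2 _; congr (_ * _).
by apply: eqf; rewrite size_cat /= size_take size_drop; case: ifP; lia.
Qed.

Lemma cross_at_last x i t (G : bool -> seq bool -> F) ts : (i.+2 < size ts)%N ->
  cross_at x i (fun s => G (last t s) s) ts
  = cross_at x i (fun s => G (last t ts) s) ts.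
Proof.
move=> lti; apply: eq_bigr => s1 _; apply: eq_bigr => s2 _; congr (_ * G _ _).
have -> : last t ts = last (last t (take i.+2 ts)) (drop i.+2 ts).
  by rewrite -last_cat cat_take_drop.
have : size (drop i.+2 ts) != 0%N by rewrite size_drop; lia.
by rewrite last_cat; case: (drop _ _).
Qed.

Lemma cross_atZ x i c f ts :
  cross_at x i (fun s => c * f s) ts = c * cross_at x i f ts.
Proof.
rewrite /cross_at mulr_sumr; apply: eq_bigr => s1 _; rewrite mulr_sumr.
by apply: eq_bigr => s2 _; rewrite mulrCA.
Qed.

Lemma cross_at_sum x i (f : bool -> seq bool -> F) ts :
  cross_at x i (fun s => \sum_(j : bool) f j s) ts = \sum_(j : bool) cross_at x i (f j) ts.
Proof. rewrite /cross_at !big_bool /=; ring. Qed.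

Lemma cross_at_row_sum x i f u cols h ts :
  cross_at x i (fun s => row_sum u cols h ts (fun bs g => f s bs g)) =1
  fun s => row_sum u cols h ts (fun bs g => cross_at x i (fun s' => f s' bs g) s).
Proof.
move=> s; rewrite /cross_at row_sum_bool; apply: eq_bigr => s1 _.
rewrite row_sum_bool; apply: eq_bigr => s2 _.
by rewrite row_sumZ.
Qed.

Hypothesis Q0 : Q != 0.

Lemma cross_at0 x f t1 t2 ts :
  cross_at x 0 f [:: t1, t2 & ts] =
  \sum_(s1 : bool) \sum_(s2 : bool) cw x t1 t2 s1 s2 * f [:: s1, s2 & ts].
Proof. by rewrite /cross_at /= drop0. Qed.

Lemma row_sum_cross0 x f u cols h ts t1 t2 :
  row_sum u cols h ts (fun bs g => cross_at x 0 (fun s => f s g) [:: t1, t2 & bs])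
  = \sum_(s1 : bool) \sum_(s2 : bool) cw x t1 t2 s1 s2
      * row_sum u cols h ts (fun bs g => f [:: s1, s2 & bs] g).
Proof.
under eq_row_sum do rewrite cross_at0.
rewrite row_sum_bool; apply: eq_bigr => s1 _.
by rewrite row_sum_bool; apply: eq_bigr => s2 _; rewrite row_sumZ.
Qed.

Lemma row_sum_cross_head (a b c : F) Y h ts k :
    a != 0 -> b != 0 -> c != 0 -> (1 < size ts)%N ->
  cross_at (a / b) 0 (fun s => row_sum c (a :: b :: Y) h s k) ts
  = row_sum c (b :: a :: Y) h ts (fun bs g => cross_at (a / b) 0 (k^~ g) bs).
Proof.
move=> a0 b0 c0; case: ts => [|t1 [|t2 ts]] // _.
rewrite cross_at0 /=.
transitivity (\sum_(b1 : bool) \sum_(b2 : bool) \sum_(g : bool)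
  (\sum_(s1 : bool) \sum_(s2 : bool) cw (a / b) t1 t2 s1 s2 *
    \sum_(m : bool) vw (c * a) s1 b1 h m * vw (c * b) s2 b2 m g) *
   row_sum c Y g ts (fun bs => k [:: b1, b2 & bs])).
  rewrite !big_bool /=; ring.
transitivity (\sum_(b1 : bool) \sum_(b2 : bool) \sum_(g : bool)
  (\sum_(s1 : bool) \sum_(s2 : bool)
    (\sum_(m : bool) vw (c * b) t1 s1 h m * vw (c * a) t2 s2 m g)
      * cw (a / b) s1 s2 b1 b2) *
   row_sum c Y g ts (fun bs => k [:: b1, b2 & bs])).
  do 3![apply: eq_bigr => ? _]; congr (_ * _); exact: yang_baxter_vertical.
under [RHS]eq_bigr => b1 _ do under eq_bigr => g _ do
 under eq_bigr => b2 _ do under eq_bigr => g' _ do rewrite row_sum_cross0.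
rewrite !big_bool /=; ring.
Qed.

(** The crossing passes through the row and comes out below it, with the two
    columns exchanged. *)
Lemma row_sum_cross (X : seq F) (a b c : F) (Y : seq F) h ts k :
    a != 0 -> b != 0 -> c != 0 -> (size X + 1 < size ts)%N ->
  cross_at (a / b) (size X) (fun s => row_sum c (X ++ a :: b :: Y) h s k) ts
  = row_sum c (X ++ b :: a :: Y) h ts
      (fun bs g => cross_at (a / b) (size X) (k^~ g) bs).
Proof.
move=> a0 b0 c0 lt_ts.
have sz1 : size (take (size X) ts) = size X by rewrite size_take; case: ifP; lia.
rewrite -(cat_take_drop (size X) ts) -{1}sz1 cross_at_cat.
rewrite (eq_cross_at _ (f2 := fun s => row_sum c X h (take (size X) ts)
   (fun b1 g => row_sum c (a :: b :: Y) g s (fun b2 => k (b1 ++ b2))))); first last.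
- by move=> s _; rewrite row_sum_cat.
- by rewrite size_drop; lia.
rewrite cross_at_row_sum row_sum_cat //.
apply: eq_row_sum => b1 g szb; rewrite row_sum_cross_head //; last by rewrite size_drop; lia.
by apply: eq_row_sum => b2 g2 _; rewrite -szb cross_at_cat.
Qed.

Section Triangle.
Variables (p w : F).
Local Notation lw := (left_wt Q p).
Local Notation rw := (right_wt Q p).

(** The row of [u] turns up at both ends; between them it crosses the lines
    of the later rows, the middle line [w], and the same lines again on their way
    up.  Hence the columns [us' ++ w :: rev us'].  The value for no row selects
    the upward orientation of the bottom edge. *)
Fixpoint partition_fun (us : seq F) (ts : seq bool) : F :=
  if us is u :: us' then
    \sum_(h : bool) lw u (head true ts) h *
      row_sum u (us' ++ w :: rev us') h (behead ts)
        (fun bs g => rw u (last true ts) g * partition_fun us' bs)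
  else (head true ts)%:R.

(** Two successive rows without their ends. *)
Definition two_rows (a b : F) (Y : seq F) (g1 g2 : bool) (ts : seq bool)
    (k : seq bool -> bool -> bool -> F) : F :=
  row_sum a Y g1 ts (fun bs h1 => row_sum b Y g2 bs (fun ds h2 => k ds h1 h2)).

Lemma two_rows_cons a b c Y g1 g2 t ts k :
  two_rows a b (c :: Y) g1 g2 (t :: ts) k =
  \sum_(d : bool) \sum_(m1 : bool) \sum_(m2 : bool)
    (\sum_(v : bool) vw (a * c) t v g1 m1 * vw (b * c) v d g2 m2) *
    two_rows a b Y m1 m2 ts (fun ds => k (d :: ds)).
Proof.
rewrite /two_rows /=.
under eq_bigr => v _ do under eq_bigr => m1 _ do
  (rewrite row_sum_bool; under eq_bigr => d _ do
    (rewrite row_sum_bool; under eq_bigr => m2 _ do rewrite row_sumZ)).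
rewrite !big_bool /=; ring.
Qed.

Lemma two_rows_linear a b Y g1 g2 ts (c : bool -> bool -> F) k :
  two_rows a b Y g1 g2 ts
    (fun ds h1 h2 => \sum_(n1 : bool) \sum_(n2 : bool) c n1 n2 * k n1 n2 ds h1 h2)
  = \sum_(n1 : bool) \sum_(n2 : bool) c n1 n2 * two_rows a b Y g1 g2 ts (k n1 n2).
Proof.
rewrite /two_rows.
transitivity (row_sum a Y g1 ts (fun bs h1 =>
  \sum_(n1 : bool) \sum_(n2 : bool) c n1 n2 * row_sum b Y g2 bs (fun ds h2 => k n1 n2 ds h1 h2))).
  apply: eq_row_sum => bs h1 _; rewrite row_sum_bool; apply: eq_bigr => n1 _.
  by rewrite row_sum_bool; apply: eq_bigr => n2 _; rewrite row_sumZ.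
rewrite row_sum_bool; apply: eq_bigr => n1 _.
by rewrite row_sum_bool; apply: eq_bigr => n2 _; rewrite row_sumZ.
Qed.

Lemma eq_two_rows a b Y g1 g2 ts k1 k2 :
    (forall ds h1 h2, k1 ds h1 h2 = k2 ds h1 h2) ->
  two_rows a b Y g1 g2 ts k1 = two_rows a b Y g1 g2 ts k2.
Proof. by move=> eqk; apply: eq_row_sum => bs h1 _; apply: eq_row_sum => ds h2 _. Qed.

(** The crossing between the two rows moves through all the columns, by one
    Yang-Baxter relation for each. *)
Lemma two_rows_cross (a b : F) (Y : seq F) g1 g2 ts k :
    a != 0 -> b != 0 -> all (predC1 0) Y -> size ts = size Y ->
  \sum_(m1 : bool) \sum_(m2 : bool) cw (a / b) g1 g2 m1 m2 *
    two_rows a b Y m1 m2 ts k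
  = two_rows b a Y g1 g2 ts (fun ds h1 h2 =>
      \sum_(m1 : bool) \sum_(m2 : bool) cw (a / b) h1 h2 m1 m2 * k ds m1 m2).
Proof.
move=> a0 b0; elim: Y g1 g2 ts k => [|c Y IH] g1 g2 [|t ts] k //= /andP[/= c0 Y0] [sz].
under eq_bigr => m1 _ do under eq_bigr => m2 _ do rewrite two_rows_cons.
transitivity (\sum_(d : bool) \sum_(l1 : bool) \sum_(l2 : bool)
  (\sum_(m1 : bool) \sum_(m2 : bool) cw (a / b) g1 g2 m1 m2 *
    \sum_(v : bool) vw (a * c) t v m1 l1 * vw (b * c) v d m2 l2) *
   two_rows a b Y l1 l2 ts (fun ds => k (d :: ds))).
  rewrite !big_bool /=; ring.
transitivity (\sum_(d : bool) \sum_(l1 : bool) \sum_(l2 : bool)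
  (\sum_(m1 : bool) \sum_(m2 : bool)
    (\sum_(v : bool) vw (b * c) t v g1 m1 * vw (a * c) v d g2 m2)
     * cw (a / b) m1 m2 l1 l2) *
   two_rows a b Y l1 l2 ts (fun ds => k (d :: ds))).
  by do 3![apply: eq_bigr => ? _]; rewrite yang_baxter_horizontal.
rewrite two_rows_cons.
under [RHS]eq_bigr => d _ do under eq_bigr => m1 _ do under eq_bigr => m2 _ do
  rewrite -(IH _ _ _ (fun ds => k (d :: ds)) Y0 sz).
rewrite !big_bool /=; ring.
Qed.

(** The vertices of two successive rows near their left ends: the ends
    themselves and the vertex where the second line crosses the first row. *)
Definition left_corner (a b : F) (t1 t2 g1 g2 : bool) : F :=
  \sum_(h : bool) \sum_(v : bool) lw a t1 h * vw (a * b) t2 v h g1 * lw b v g2.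
Definition right_corner (a b : F) (t1 t2 h1 h2 : bool) : F :=
  \sum_(g : bool) \sum_(v : bool) vw (a * b) t1 v h1 g * rw a t2 g * rw b v h2.

Lemma partition_fun_two_rows a b us t1 t2 t3 t4 ts :
    size ts = (size us).*2.+1 ->
  partition_fun (a :: b :: us) (t1 :: t2 :: ts ++ [:: t3; t4]) =
  \sum_(g1 : bool) \sum_(g2 : bool) left_corner a b t1 t2 g1 g2 *
    two_rows a b (us ++ w :: rev us) g1 g2 ts (fun ds h1 h2 =>
      right_corner a b t3 t4 h1 h2 * partition_fun us ds).
Proof.
move=> szts; rewrite /= rev_cons -cats1 -cat_cons catA.
set Y := us ++ w :: rev us.
have szY : size ts = size Y by rewrite /Y size_cat /= size_rev szts; lia.
have -> : last t2 (ts ++ [:: t3; t4]) = t4 by rewrite last_cat.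
transitivity (\sum_(h : bool) lw a t1 h * \sum_(v : bool) \sum_(g1 : bool)
  vw (a * b) t2 v h g1 * row_sum a Y g1 ts (fun bs g =>
    \sum_(v' : bool) \sum_(g' : bool) (vw (a * b) t3 v' g g' * rw a t4 g') *
     \sum_(g2 : bool) lw b v g2 * row_sum b Y g2 bs (fun ds h2 =>
       rw b v' h2 * partition_fun us ds))).
  apply: eq_bigr => h _; congr (_ * _); apply: eq_bigr => v _; apply: eq_bigr => g1 _.
  congr (_ * _); rewrite row_sum_cat //; apply: eq_row_sum => bs g szbs /=.
  rewrite mulrC; apply: eq_bigr => v' _; apply: eq_bigr => g' _.
  rewrite -mulrA; congr (_ * (_ * _)); apply: eq_bigr => g2 _; congr (_ * _).
  rewrite -{1}[Y]cats0 row_sum_cat //; apply: eq_row_sum => ds h2 _ /=.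
  by rewrite last_cat cats0.
have E v g1 : row_sum a Y g1 ts (fun bs g =>
    \sum_(v' : bool) \sum_(g' : bool) (vw (a * b) t3 v' g g' * rw a t4 g') *
     \sum_(g2 : bool) lw b v g2 * row_sum b Y g2 bs (fun ds h2 =>
       rw b v' h2 * partition_fun us ds)) =
   \sum_(g2 : bool) lw b v g2 * two_rows a b Y g1 g2 ts (fun ds h1 h2 =>
      right_corner a b t3 t4 h1 h2 * partition_fun us ds).
  transitivity (row_sum a Y g1 ts (fun bs g => \sum_(g2 : bool) lw b v g2 *
    row_sum b Y g2 bs (fun ds h2 => right_corner a b t3 t4 g h2 * partition_fun us ds))).
    apply: eq_row_sum => bs g _.
    transitivity (\sum_(g2 : bool) lw b v g2 * row_sum b Y g2 bs (fun ds h2 =>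
       \sum_(v' : bool) \sum_(g' : bool) (vw (a * b) t3 v' g g' * rw a t4 g') *
         (rw b v' h2 * partition_fun us ds))).
      under [RHS]eq_bigr => g2 _ do
        (rewrite row_sum_bool; under eq_bigr => v' _ do
          (rewrite row_sum_bool; under eq_bigr => g' _ do rewrite row_sumZ)).
      rewrite !big_bool /=; ring.
    apply: eq_bigr => g2 _; congr (_ * _); apply: eq_row_sum => ds h2 _.
    rewrite /right_corner !big_bool /=; ring.
  by rewrite row_sum_bool; apply: eq_bigr => g2 _; rewrite row_sumZ.
rewrite !big_bool !E /left_corner !big_bool /=; ring.
Qed.

Hypotheses (p0 : p != 0) (w0 : w != 0).

(** The path of the crossing for the two outermost lines: into the left
    corner, along the two rows, out of the right corner. *)
Lemma partition_fun_cross0 (a b : F) (us : seq F) ts :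
    a != 0 -> b != 0 -> all (predC1 0) us -> size ts = ((size us).*2 + 5)%N ->
  cross_at (a / b) 0 (partition_fun (a :: b :: us)) ts
  = cross_at (a / b) ((size us).*2 + 3) (partition_fun (b :: a :: us)) ts.
Proof.
move=> a0 b0 us0; case: ts => [|t1 [|t2 ts]] sz; try by move: sz => /=; lia.
have szts : size ts = ((size us).*2 + 3)%N by move: sz => /=; lia.
set T := take (size us).*2.+1 ts.
have szT : size T = (size us).*2.+1 by rewrite size_take; case: ifP; lia.
have [t3 [t4 ->]] : exists t3 t4, ts = T ++ [:: t3; t4].
  have : size (drop (size us).*2.+1 ts) = 2 by rewrite size_drop; lia.
  rewrite -{2}(cat_take_drop (size us).*2.+1 ts) -/T.
  by case: (drop _ _) => [|x [|y []]] // _; exists x, y.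
set Y := us ++ w :: rev us.
have szY : size T = size Y by rewrite /Y size_cat /= size_rev szT; lia.
have Y0 : all (predC1 0) Y by rewrite all_cat /= w0 all_rev us0.
rewrite cross_at0 addnS addnS addn1 !cross_at_cons -szT cross_at_cat cross_at0.
under eq_bigr => s1 _ do under eq_bigr => s2 _ do rewrite partition_fun_two_rows // -/Y.
under [RHS]eq_bigr => s1 _ do under eq_bigr => s2 _ do rewrite partition_fun_two_rows // -/Y.
transitivity (\sum_(g1 : bool) \sum_(g2 : bool)
  (\sum_(s1 : bool) \sum_(s2 : bool) cw (a / b) t1 t2 s1 s2 * left_corner a b s1 s2 g1 g2)
   * two_rows a b Y g1 g2 T (fun ds h1 h2 =>
      right_corner a b t3 t4 h1 h2 * partition_fun us ds)).
  rewrite !big_bool /=; ring.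
transitivity (\sum_(g1 : bool) \sum_(g2 : bool)
  (\sum_(m1 : bool) \sum_(m2 : bool) left_corner b a t1 t2 m1 m2 * cw (a / b) m1 m2 g1 g2)
   * two_rows a b Y g1 g2 T (fun ds h1 h2 =>
      right_corner a b t3 t4 h1 h2 * partition_fun us ds)).
  do 2![apply: eq_bigr => ? _]; congr (_ * _).
  by rewrite /left_corner reflection_left // mulrC.
transitivity (\sum_(m1 : bool) \sum_(m2 : bool) left_corner b a t1 t2 m1 m2 *
  \sum_(g1 : bool) \sum_(g2 : bool) cw (a / b) m1 m2 g1 g2
   * two_rows a b Y g1 g2 T (fun ds h1 h2 =>
      right_corner a b t3 t4 h1 h2 * partition_fun us ds)).
  rewrite !big_bool /=; ring.
transitivity (\sum_(m1 : bool) \sum_(m2 : bool) left_corner b a t1 t2 m1 m2 *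
  \sum_(s1 : bool) \sum_(s2 : bool) cw (a / b) t3 t4 s1 s2 *
   two_rows b a Y m1 m2 T (fun ds h1 h2 =>
      right_corner b a s1 s2 h1 h2 * partition_fun us ds)); last first.
  rewrite !big_bool /=; ring.
do 2![apply: eq_bigr => ? _]; congr (_ * _).
rewrite two_rows_cross // -two_rows_linear; apply: eq_two_rows => ds h1 h2.
transitivity ((\sum_(m1 : bool) \sum_(m2 : bool) cw (a / b) h1 h2 m1 m2
   * right_corner a b t3 t4 m1 m2) * partition_fun us ds).
  rewrite !big_bool /=; ring.
transitivity ((\sum_(s1 : bool) \sum_(s2 : bool)
   right_corner b a s1 s2 h1 h2 * cw (a / b) t3 t4 s1 s2) * partition_fun us ds).
  by congr (_ * _); rewrite /right_corner reflection_right // (mulrC b).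
rewrite !big_bool /=; ring.
Qed.

(** For inner lines the crossing first goes down through the rows above, and
    at the end climbs through the same rows on the right. *)
Lemma partition_fun_cross (s1 : seq F) (a b : F) (s2 : seq F) ts :
    a != 0 -> b != 0 -> all (predC1 0) s1 -> all (predC1 0) s2 ->
    size ts = ((size s1).*2 + (size s2).*2 + 5)%N ->
  cross_at (a / b) (size s1) (partition_fun (s1 ++ a :: b :: s2)) ts
  = cross_at (a / b) (size s1 + (size s2).*2 + 3) (partition_fun (s1 ++ b :: a :: s2)) ts.
Proof.
move=> a0 b0 + s20; elim: s1 ts => [|c s1 IH] ts; first by move=> _; exact: partition_fun_cross0.
case: ts => [|t ts] /andP[c0 s10] sz; first by move: sz => /=; lia.
have szts : size ts = ((size s1).*2 + (size s2).*2 + 6)%N by move: sz => /=; lia.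
rewrite /= !addSn !cross_at_cons /=.
have szX : (size s1 + (size s2).*2 + 3)%N = size (s1 ++ b :: a :: s2 ++ w :: rev s2).
  by rewrite !size_cat /= !size_cat /= size_rev; lia.
rewrite !cross_at_sum; apply: eq_bigr => h _; rewrite !cross_atZ; congr (_ * _).
set Z1 := partition_fun (s1 ++ a :: b :: s2); set Z2 := partition_fun (s1 ++ b :: a :: s2).
set X := s1 ++ b :: a :: s2 ++ w :: rev s2 in szX *.
rewrite (cross_at_last _ _ (fun l s => row_sum c _ h s (fun bs g => rw c l g * Z1 bs)));
  last by lia.
rewrite (cross_at_last _ _ (fun l s => row_sum c _ h s (fun bs g => rw c l g * Z2 bs)));
  last by lia.
have -> : (s1 ++ a :: b :: s2) ++ w :: rev (s1 ++ a :: b :: s2)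
  = s1 ++ a :: b :: s2 ++ w :: rev s2 ++ b :: a :: rev s1.
  by rewrite rev_cat !rev_cons -!cats1 -!catA.
have -> : (s1 ++ b :: a :: s2) ++ w :: rev (s1 ++ b :: a :: s2)
  = X ++ a :: b :: rev s1.
  by rewrite rev_cat !rev_cons -!cats1 /X -!catA /= -!catA.
rewrite szX !row_sum_cross //; try by lia.
have -> : X ++ b :: a :: rev s1 = s1 ++ b :: a :: s2 ++ w :: rev s2 ++ b :: a :: rev s1.
  by rewrite /X -!catA /= -!catA.
apply: eq_row_sum => bs g szbs; rewrite !cross_atZ -szX IH //.
by move: szbs; rewrite !size_cat /= size_cat /= size_cat /= !size_rev; lia.
Qed.

(** Two parallel upward edges cross with a single outcome. *)
Lemma cross_at_up x i f n : (i.+1 < n)%N ->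
  cross_at x i f (nseq n true) = sigma (Q ^+ 2 / x) * f (nseq n true).
Proof.
move=> lti; rewrite /cross_at drop_nseq take_nseq ?(ltnW (ltnW lti)) // !nth_nseq lti (ltnW lti).
rewrite !big_bool /= !mul0r !addr0; congr (_ * f _).
by rewrite -[true :: true :: _]/(nseq 2 true ++ _) -!nseqD; congr nseq; lia.
Qed.

Definition Zup us := partition_fun us (nseq (size us).*2.+1 true).

(** Both crossings act on upward edges, hence contribute the same factor. *)
Lemma Zup_swap (s1 : seq F) (a b : F) (s2 : seq F) : Q ^+ 8 != 1 ->
    a != 0 -> b != 0 -> all (predC1 0) s1 -> all (predC1 0) s2 ->
  Zup (s1 ++ a :: b :: s2) = Zup (s1 ++ b :: a :: s2).
Proof.
move=> Q8.
(* One of the crossings a/b and b/a acts invertibly on upward edges: both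
   sigma(Q^2 x) and sigma(Q^2/x) vanish only if Q^8 = 1. *)
wlog nz : a b / sigma (Q ^+ 2 / (a / b)) != 0.
  move=> H a0 b0 s10 s20.
  have [z|nz] := eqVneq (sigma (Q ^+ 2 / (a / b))) 0; last exact: H.
  apply/esym/H => //; apply: contra Q8 => /eqP; move: z; rewrite /sigma.
  have [] : a / b != 0 /\ b / a != 0 by rewrite !mulf_neq0 ?invr_neq0.
  rewrite -[b / a]invf_div; set x := a / b => x0 _ /eqP.
  rewrite subr_eq0 => /eqP e1 /eqP; rewrite subr_eq0 => /eqP e2.
  have f1 : Q ^+ 4 = x ^+ 2.
    transitivity ((Q ^+ 2 / x) * (Q ^+ 2 * x)); first by field.
    by rewrite e1; field; rewrite x0 Q0.
  have f2 : Q ^+ 4 * x ^+ 2 = 1.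
    transitivity ((Q ^+ 2 * x) * (Q ^+ 2 * x)); first by ring.
    by rewrite invrK in e2; rewrite {1}e2; field; rewrite x0 Q0.
  by apply/eqP; rewrite -f2 -f1; ring.
move=> a0 b0 s10 s20.
have := partition_fun_cross (ts := nseq ((size s1).*2 + (size s2).*2 + 5) true) a0 b0 s10 s20.
rewrite size_nseq => /(_ erefl); rewrite !cross_at_up; try by lia.
move=> /(mulfI nz) e.
have sz c d : (size (s1 ++ c :: d :: s2)).*2.+1 = ((size s1).*2 + (size s2).*2 + 5)%N.
  by rewrite size_cat /=; lia.
by rewrite /Zup !sz.
Qed.
End Triangle.
End Rows.

(** * Mirror image and frozen rows *)

Section Evaluations.
Variables (F : fieldType) (Q : F).
Local Notation vw := (bulk_wt Q).
Local Notation row_sum := (row_sum Q).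

Lemma sum_negb (f : bool -> F) : \sum_(h : bool) f (~~ h) = \sum_(h : bool) f h.
Proof. by rewrite !big_bool /= addrC. Qed.

Lemma bulk_wt_mirror x t b h g : vw x^-1 t b (~~ g) (~~ h) = vw x t b h g.
Proof. by case: t b h g => [] [] [] [] //=; rewrite invrK. Qed.

(** Reading the row from right to left exchanges the roles of its two
    end edges; [H] is the weight attached to the left one. *)
Lemma row_sum_mirror u (cols : seq F) ts (H : bool -> F) k :
    size ts = size cols ->
  \sum_(h : bool) H h * row_sum u cols h ts k
  = \sum_(g : bool) row_sum u^-1 (rev (map GRing.inv cols)) (~~ g) (rev ts)
      (fun bs h => H (~~ h) * k (rev bs) g).
Proof.
elim: cols ts H k => [|c cols IH] [|t ts] H k //= sz.
  by apply: eq_bigr => h _; rewrite negbK.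
case: sz => sz.
pose Hb b g := \sum_(h : bool) H h * vw (u * c) t b h g.
transitivity (\sum_(b : bool) \sum_(g : bool) Hb b g * row_sum u cols g ts (fun bs => k (b :: bs))).
  rewrite /Hb !big_bool /=; ring.
transitivity (\sum_(b : bool) \sum_(g : bool) row_sum u^-1
    (rev (map GRing.inv cols)) (~~ g) (rev ts)
    (fun bs h => Hb b (~~ h) * k (b :: rev bs) g)).
  by apply: eq_bigr => b _; exact: (IH ts (Hb b) (fun bs => k (b :: bs)) sz).
rewrite exchange_big /=; apply: eq_bigr => g _.
rewrite -row_sum_bool !rev_cons -!cats1 row_sum_cat ?size_rev ?size_map //.
apply: eq_row_sum => bs g1 _ /=; apply: eq_bigr => b _.
rewrite cats1 rev_rcons /Hb mulr_suml -sum_negb; apply: eq_bigr => h _.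
by rewrite -invfM -(negbK g1) -(negbK h) bulk_wt_mirror !negbK; ring.
Qed.

Lemma row_sum_excess u (cols : seq F) h ts ts' k : size ts = size cols ->
  row_sum u cols h (ts ++ ts') k = row_sum u cols h ts k.
Proof.
move=> sz; rewrite -{1}(cats0 cols) row_sum_cat //.
by apply: eq_row_sum => bs g _ /=; rewrite cats0.
Qed.

Lemma partition_fun_mirror p w (us : seq F) ts : size ts = (size us).*2.+1 ->
  partition_fun Q p w us ts
  = partition_fun Q p^-1 w^-1 (map GRing.inv us) (rev ts).
Proof.
elim: us ts => [|u us IH] ts sz; first by case: ts sz => [|t []].
case: ts sz => // t0 ts; case/lastP: ts => [//|ts tl] sz.
have {}sz : size ts = (size us).*2.+1.
  by apply/eqP; move: sz; rewrite [size _]/= size_rcons doubleS => -[->].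
rewrite rev_cons rev_rcons /= !last_rcons -!cats1.
set cols := us ++ w :: rev us.
have szc : size ts = size cols by rewrite sz /cols size_cat /= size_rev; lia.
have -> : map GRing.inv us ++ w^-1 :: rev (map GRing.inv us) = rev (map GRing.inv cols).
  by rewrite /cols map_cat /= map_rev rev_cat rev_cons revK cat_rcons.
under eq_bigr => h _ do rewrite row_sum_excess //.
rewrite row_sum_mirror // -sum_negb; apply: eq_bigr => g _.
rewrite row_sum_excess ?size_rev ?size_map // -row_sumZ negbK.
apply: eq_row_sum => bs h; rewrite size_rev size_map => szb.
rewrite IH ?size_rev ?szb -?szc ?sz // revK /right_wt !invrK.
by rewrite negbK mulrCA.
Qed.

Lemma Zup_mirror p w (us : seq F) :
  Zup Q p w us = Zup Q p^-1 w^-1 (map GRing.inv us).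
Proof.
rewrite /Zup partition_fun_mirror ?size_nseq // size_map.
by rewrite rev_nseq.
Qed.

(** Below upward edges a leftward edge propagates: a vertex whose upper edge
    points up and whose left edge points left has a single admissible state. *)
Lemma row_sum_leftward u (cols : seq F) n k : (size cols <= n)%N ->
  row_sum u cols false (nseq n true) k
  = (\prod_(c <- cols) sigma (Q / (u * c))) * k (nseq (size cols) true) false.
Proof.
elim: cols n k => [|c cols IH] [|n] k //= le_n; first by rewrite big_nil mul1r.
  by rewrite big_nil mul1r.
by rewrite !big_bool /= !mul0r !addr0 !add0r IH // big_cons mulrA.
Qed.

Lemma last_up n : last true (nseq n true) = true.
Proof. by elim: n. Qed.

Lemma last_nseq_true n b : last b (nseq n.+1 true) = true.
Proof. exact: last_up. Qed.

Lemma row_sum_leftward_full u us w n k : (size us).*2.+1 = n ->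
  row_sum u (us ++ w :: rev us) false (nseq n.+1 true) k
  = (\prod_(c <- us) sigma (Q / (u * c)) ^+ 2) * sigma (Q / (u * w))
     * k (nseq n true) false.
Proof.
move=> <-; rewrite row_sum_leftward; last by rewrite size_cat /= size_rev; lia.
rewrite size_cat /= size_rev addnS addnn; congr (_ * _).
by rewrite big_cat big_cons /= big_rev /= prodrXl; ring.
Qed.

(** If the left end of the first row cannot have both edges outgoing, its
    horizontal edge points left, and so does the rest of the row. *)
Lemma Zup_freeze1 p w (X : F) us : sigma (Q * X ^+ 2) = 0 ->
  Zup Q p w (X :: us) =
    sigma (p * Q * X) * sigma (Q * X ^- 2) * sigma (Q / (X * w))
    * (\prod_(c <- us) sigma (Q / (X * c)) ^+ 2) * Zup Q p w us.
Proof.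
move=> z; rewrite /Zup [size _]/= [LHS]/= big_bool /= z mul0r add0r.
rewrite last_up (row_sum_leftward_full _ _ (n := (size us).*2.+1)) //.
by rewrite /right_wt /= -exprVn; ring.
Qed.

(** The first row has two possible states left: all horizontal edges point
    left, or the first one points right and the edge below the second column points
    down.  When the second row starts to the right the two contributions cancel;
    otherwise it points left throughout. *)
Lemma Zup_freeze2 p w (X v : F) us : Q != 0 -> X != 0 -> v != 0 ->
  sigma (Q * (X * v)) = 0 ->
  Zup Q p w (X :: v :: us) = sigma (Q ^+ 2) ^+ 2 *
    (sigma (p * Q * X) * sigma (Q * X ^- 2) * sigma (Q / (X * w))) *
    (sigma (p * Q * v) * sigma (Q * v ^- 2) * sigma (Q / (v * w))) *
    (\prod_(c <- us) (sigma (Q / (X * c)) * sigma (Q / (v * c))) ^+ 2)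
    * Zup Q p w us.
Proof.
move=> Q0 X0 v0 z.
have [e e2 Qe] : exists2 e, e ^+ 2 = 1 & v = e / (Q * X).
  exists (Q * (X * v)); last by field; rewrite Q0 X0.
  move: z; rewrite /sigma => /eqP; rewrite subr_eq0 => /eqP zz.
  by rewrite expr2 {2}zz mulfV // !mulf_neq0.
have e0 : e != 0 by apply: contra_eq_neq e2 => ->; rewrite expr0n eq_sym oner_eq0.
have eV : e^-1 = e by apply: (mulfI e0); rewrite mulfV // -expr2 e2.
have sge x : sigma (e * x) = e * sigma x by rewrite /sigma invfM eV; ring.
have vXv : sigma (Q / (X * v)) = e * sigma (Q ^+ 2).
  rewrite -sge; congr sigma; rewrite Qe -{2}eV; field.
  by rewrite Q0 X0 e0.
set n := (size us).*2.+1.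
pose B := (\prod_(c <- us) sigma (Q / (X * c)) ^+ 2) * sigma (Q / (X * w))
   * (e * sigma (Q ^+ 2)) * sigma (Q * X ^- 2).
pose G h := row_sum v (us ++ w :: rev us) h (nseq n.+1 true)
  (fun bs g => right_wt Q p v true g * partition_fun Q p w us bs).
have Zv b : partition_fun Q p w (v :: us) (b :: nseq n.+1 true)
    = left_wt Q p v b true * G true + left_wt Q p v b false * G false.
  rewrite -[LHS]/(\sum_(h : bool) left_wt Q p v b h *
      row_sum v (us ++ w :: rev us) h (nseq n.+1 true)
       (fun bs g => right_wt Q p v (last b (nseq n.+1 true)) g * partition_fun Q p w us bs)).
  by rewrite last_nseq_true big_bool.
have row1 b : row_sum X (us ++ w :: rev (v :: us)) false (nseq n.+2 true)
    (fun bs g => right_wt Q p X true g * partition_fun Q p w (v :: us) (b :: bs))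
   = B * (left_wt Q p v b true * G true + left_wt Q p v b false * G false).
  rewrite row_sum_leftward; last by rewrite size_cat /= size_rev /= /n; lia.
  have -> : size (us ++ w :: rev (v :: us)) = n.+1.
    by rewrite size_cat /= size_rev /= /n; lia.
  rewrite Zv big_cat big_cons big_rev big_cons vXv /right_wt [left_wt _ _ _ _ _]/= exprVn.
  rewrite /B prodrXl /=; ring.
have G0 : G false = (\prod_(c <- us) sigma (Q / (v * c)) ^+ 2) * sigma (Q / (v * w))
     * (sigma (Q * v ^- 2) * Zup Q p w us).
  by rewrite /G (row_sum_leftward_full _ _ (n := n)) // /right_wt /= exprVn.
pose R b g := row_sum X (us ++ w :: rev (v :: us)) g (nseq n.+2 true)
  (fun bs g => right_wt Q p X true g * partition_fun Q p w (v :: us) (b :: bs)).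
have -> : Zup Q p w [:: X, v & us] = \sum_(h : bool) left_wt Q p X true h *
   \sum_(b : bool) \sum_(g : bool) vw (X * v) true b h g * R b g.
  rewrite -[LHS]/(\sum_(h : bool) left_wt Q p X true h *
   \sum_(b : bool) \sum_(g : bool) vw (X * v) true b h g *
     row_sum X (us ++ w :: rev (v :: us)) g (nseq n.+2 true)
    (fun bs g => right_wt Q p X (last true (nseq n.+3 true)) g * partition_fun Q p w (v :: us) (b
      :: bs))).
  by rewrite last_nseq_true.
(* The two contributions in which the second row starts to the right. *)
have cancel : e * sigma (p * Q * X) * left_wt Q p v true true
    + sigma (Q * X ^+ 2) * left_wt Q p v false true = 0.
  rewrite /= (_ : p / v = e * (p * Q * X)); last first.
    by rewrite Qe -{2}eV; field; rewrite Q0 X0 e0.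
  rewrite (_ : Q * v ^+ 2 = (Q * X ^+ 2)^-1); last first.
    by rewrite Qe !exprMn e2; field; rewrite Q0 X0.
  by rewrite sge /sigma invrK; ring.
rewrite !big_bool /= z !(mul0r, mulr0, add0r, addr0) vXv.
rewrite /R !row1.
rewrite [left_wt _ _ _ false false]/= mul0r addr0 G0 [left_wt _ _ _ true false]/=.
rewrite /B !prodrXl big_split /=.
set L1 := left_wt _ _ _ true true in cancel *.
set L2 := left_wt _ _ _ false true in cancel *.
have {}cancel : sigma (Q * X ^+ 2) * L2 = - (e * sigma (p * Q * X) * L1).
  by apply/eqP; rewrite -addr_eq0 addrC cancel.
set P1 := \prod_(c <- us) _; set P2 := \prod_(c <- us) _.
set B' := _ * sigma (Q * X ^- 2).
rewrite (_ : _ * (_ * (B' * (L2 * G true))) = (sigma (Q * X ^+ 2) * L2) * (sigma (Q ^+ 2) * B' *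
  G true)); last by ring.
rewrite cancel /B' -[RHS]mul1r -e2 /L1 /=; ring.
Qed.

(** In the lowest row the vertex on the middle line has label X p, and its
    lower edge is forced upwards.  A leftward edge from it meets the weight
    sigma(p Q X) or 0 at the left end, a rightward passage has weight
    sigma(Q X p), and all of these vanish. *)
Lemma partition_fun_last0 p (X : F) us ts :
  sigma (Q * (X * p)) = 0 -> partition_fun Q p p (rcons us X) ts = 0.
Proof.
move=> z; elim: us ts => [|u us IH] ts.
  have z' : sigma (p * Q * X) = 0 by rewrite -z; congr sigma; ring.
  rewrite /= !big_bool; case: (head true ts) (head true (behead ts)) => [] [];
    by rewrite /= ?z ?z' !(mul0r, mulr0, add0r, addr0).
rewrite [LHS]/=; apply: big1 => h _.
set cols := _ ++ _; rewrite -(mulr0 (left_wt Q p u (head true ts) h)); congr (_ * _).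
rewrite -[RHS](mul0r (row_sum u cols h (behead ts) (fun _ _ => 0))) -row_sumZ.
by apply: eq_row_sum => bs g _; rewrite IH !mulr0.
Qed.

Lemma Zup_last0 p (X : F) us :
  sigma (Q * (X * p)) = 0 -> Zup Q p p (rcons us X) = 0.
Proof. exact: partition_fun_last0. Qed.

End Evaluations.

(** * Laurent polynomials and multiple roots *)

Section Laurent.
Variables (F : fieldType).

(** On nonzero arguments [f] agrees with a Laurent polynomial whose exponents
    lie between -d and d. *)
Definition laurent (d : nat) (f : F -> F) : Prop :=
  exists2 P : {poly F}, (size P <= d.*2.+1)%N &
    forall x, x != 0 -> P.[x] = x ^+ d * f x.

Lemma eq_laurent d f g : (forall x, x != 0 -> f x = g x) -> laurent d f -> laurent d g.
Proof. by move=> e [P sP Pf]; exists P => // x x0; rewrite Pf // e. Qed.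

Lemma laurent_widen d e f : (d <= e)%N -> laurent d f -> laurent e f.
Proof.
move=> le [P sP Pf]; exists ('X^(e - d) * P) => [|x x0].
  apply: leq_trans (size_polyMleq _ _) _; rewrite size_polyXn; lia.
by rewrite hornerM hornerXn Pf // mulrA -exprD subnK.
Qed.

Lemma laurentD d f g : laurent d f -> laurent d g -> laurent d (fun x => f x + g x).
Proof.
move=> [P sP Pf] [R sR Rg]; exists (P + R) => [|x x0].
  by apply: leq_trans (size_polyD _ _) _; rewrite geq_max sP.
by rewrite hornerD Pf // Rg // mulrDr.
Qed.

Lemma laurentM d e f g :
  laurent d f -> laurent e g -> laurent (d + e) (fun x => f x * g x).
Proof.
move=> [P sP Pf] [R sR Rg]; exists (P * R) => [|x x0].
  apply: leq_trans (size_polyMleq _ _) _; lia.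
by rewrite hornerM Pf // Rg // exprD mulrACA.
Qed.

Lemma laurentC c : laurent 0 (fun=> c).
Proof.
exists c%:P => [|x _]; first by rewrite size_polyC; case: (c != 0).
by rewrite hornerC mul1r.
Qed.

Lemma laurentX a b : laurent 1 (fun x => a * x + b * x^-1).
Proof.
exists (a *: 'X^2 + b%:P) => [|x x0].
  apply: leq_trans (size_polyD _ _) _; rewrite geq_max.
  rewrite (leq_trans (size_scale_leq _ _)) ?size_polyXn //=.
  by rewrite size_polyC; case: (b != 0).
by rewrite hornerD hornerZ hornerXn hornerC; field.
Qed.

Lemma laurentXX a b c : laurent 2 (fun x => a * x ^+ 2 + b + c * x ^- 2).
Proof.
exists (a *: 'X^4 + b *: 'X^2 + c%:P) => [|x x0].
  apply: leq_trans (size_polyD _ _) _; rewrite geq_max.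
  apply/andP; split; last by rewrite size_polyC; case: (c != 0).
  apply: leq_trans (size_polyD _ _) _; rewrite geq_max.
  by rewrite !(leq_trans (size_scale_leq _ _)) ?size_polyXn.
by rewrite !hornerD !hornerZ !hornerXn hornerC; field.
Qed.

Lemma laurent_sum (I : finType) (A : pred I) d (f : I -> F -> F) :
  (forall i, A i -> laurent d (f i)) -> laurent d (fun x => \sum_(i | A i) f i x).
Proof.
move=> H; elim: (index_enum I) => [|i s IH].
  apply: (eq_laurent (f := fun=> 0)) => [x _|]; first by rewrite big_nil.
  exact: laurent_widen (laurentC 0).
have [Ai|nAi] := boolP (A i).
  apply: (eq_laurent (f := fun x => f i x + \sum_(j <- s | A j) f j x)).
    by move=> x _; rewrite big_cons Ai.
  exact: laurentD (H _ Ai) IH.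
by apply: eq_laurent IH => x _; rewrite big_cons (negPf nAi).
Qed.

Lemma laurent_prod (I : Type) (s : seq I) (A : pred I) d (f : I -> F -> F) :
    (forall i, A i -> laurent d (f i)) ->
  laurent (count A s * d) (fun x => \prod_(i <- s | A i) f i x).
Proof.
move=> H; elim: s => [|i s IH].
  apply: (eq_laurent (f := fun=> 1)) => [x _|]; first by rewrite big_nil.
  exact: laurentC.
rewrite /=; have [Ai|nAi] := boolP (A i).
  apply: (eq_laurent (f := fun x => f i x * \prod_(j <- s | A j) f j x)).
    by move=> x _; rewrite big_cons Ai.
  by rewrite mulnDl mul1n; apply: laurentM (H _ Ai) IH.
by apply: eq_laurent IH => x _; rewrite big_cons (negPf nAi).
Qed.

Definition bilaurent (B : F -> F -> F) : Prop :=
  exists e, exists P : {poly {poly F}},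
    forall x y, x != 0 -> y != 0 -> P.[y%:P].[x] = x ^+ e * y ^+ e * B x y.

Lemma eq_bilaurent A B : (forall x y, x != 0 -> y != 0 -> A x y = B x y) ->
  bilaurent A -> bilaurent B.
Proof. by move=> e [d [P PA]]; exists d, P => x y x0 y0; rewrite PA // e. Qed.

Lemma bilaurent_l d f : laurent d f -> bilaurent (fun x y => f x).
Proof.
move=> [P _ Pf]; exists d, (P%:P * 'X^d) => x y x0 y0.
by rewrite hornerM hornerC hornerXn -polyC_exp hornerM hornerC Pf // mulrAC.
Qed.

Lemma bilaurent_r d f : laurent d f -> bilaurent (fun x y => f y).
Proof.
move=> [P _ Pf]; exists d, (map_poly polyC P * ('X^d)%:P) => x y x0 y0.
by rewrite hornerM horner_map !hornerC hornerM hornerXn hornerC Pf // mulrC mulrA.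
Qed.

Lemma bilaurentD A B : bilaurent A -> bilaurent B -> bilaurent (fun x y => A x y + B x y).
Proof.
move=> [d [P PA]] [e [R RB]].
exists (d + e)%N, (P * (('X^e)%:P * 'X^e) + R * (('X^d)%:P * 'X^d)) => x y x0 y0.
rewrite !(hornerD, hornerM, hornerC, hornerXn, =^~ polyC_exp) PA // RB // !exprD; ring.
Qed.

Lemma bilaurentM A B : bilaurent A -> bilaurent B -> bilaurent (fun x y => A x y * B x y).
Proof.
move=> [d [P PA]] [e [R RB]]; exists (d + e)%N, (P * R) => x y x0 y0.
by rewrite !hornerM PA // RB // !exprD; ring.
Qed.

Lemma bilaurent_sum (I : finType) (A : pred I) (f : I -> F -> F -> F) :
  (forall i, A i -> bilaurent (f i)) -> bilaurent (fun x y => \sum_(i | A i) f i x y).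
Proof.
move=> H; elim: (index_enum I) => [|i s IH].
  apply: (eq_bilaurent (A := fun _ _ => 0)) => [x y _ _|]; first by rewrite big_nil.
  exact: bilaurent_l (laurentC 0).
have [Ai|nAi] := boolP (A i).
  apply: (eq_bilaurent (A := fun x y => f i x y + \sum_(j <- s | A j) f j x y)).
    by move=> x y _ _; rewrite big_cons Ai.
  exact: bilaurentD (H _ Ai) IH.
by apply: eq_bilaurent IH => x y _ _; rewrite big_cons (negPf nAi).
Qed.

Hypothesis charF : [pchar F] =i pred0.

Lemma poly_eq0_units (P : {poly F}) : (forall x, x != 0 -> P.[x] = 0) -> P = 0.
Proof.
move=> P0; apply: contraTeq isT => nz.
have inj : injective (fun i : nat => i.+1%:R : F).
  move=> i j /eqP; wlog le : i j / (i <= j)%N => [H|].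
    by case/orP: (leq_total i j) => le /eqP e; [|apply/esym]; apply: H => //; apply/eqP.
  rewrite -subr_eq0 -opprB oppr_eq0 -natrB ?ltnS // subSS (pcharf0P _).1 //.
  by rewrite subn_eq0 => le'; apply/eqP; rewrite eqn_leq le.
pose rs := [seq (i.+1%:R : F) | i <- iota 0 (size P)].
have := max_poly_roots (rs := rs) nz; rewrite size_map size_iota ltnn; apply.
  apply/allP => _ /mapP[i _ ->]; apply/rootP/P0.
  by rewrite (pcharf0P _).1.
by rewrite map_inj_uniq ?iota_uniq.
Qed.

(** As a polynomial in x and y, B is divisible by y - c because it vanishes
    for y = c, and the quotient still vanishes for x = c; on the diagonal each of
    the two facts gives a factor x - c. *)
Lemma double_root (B : F -> F -> F) c d (S : {poly F}) :
    c != 0 -> bilaurent B ->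
    (forall y, y != 0 -> B c y = 0) -> (forall x, x != 0 -> B x c = 0) ->
    (forall x, x != 0 -> S.[x] = x ^+ d * B x x) ->
  ('X - c%:P) ^+ 2 %| S.
Proof.
move=> c0 [e [P PB]] Bcy Bxc SB.
have evE (x : F) (R : {poly {poly F}}) (y : {poly F}) :
    R.[y].[x] = (map_poly (horner_eval x) R).[y.[x]].
  by rewrite -[y.[x]]/(horner_eval x y) horner_map.
have /factor_theorem[R PR] : root P c%:P.
  apply/rootP/poly_eq0_units => x x0.
  by rewrite PB // Bxc // mulr0.
have evc0 : map_poly (horner_eval c) P = 0.
  apply: poly_eq0_units => y y0.
  have -> : (map_poly (horner_eval c) P).[y] = P.[y%:P].[c] by rewrite evE hornerC.
  by rewrite PB // Bcy // mulr0.
have /factor_theorem[T RT] : root R.['X] c.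
  apply/rootP; rewrite evE hornerX.
  suff -> : map_poly (horner_eval c) R = 0 by rewrite horner0.
  have : 'X - c%:P != 0 :> {poly F} by rewrite polyXsubC_eq0.
  move: evc0; rewrite PR rmorphM rmorphB /= map_polyX map_polyC /= /horner_eval hornerC.
  by move=> /eqP; rewrite mulf_eq0 => /orP[/eqP //|/eqP ->]; rewrite eqxx.
have PX : P.['X] = T * ('X - c%:P) ^+ 2.
  by rewrite PR hornerM RT hornerD hornerN hornerX hornerC expr2 mulrA.
have eqS : 'X^d * P.['X] = 'X^(e + e) * S.
  apply/eqP; rewrite -subr_eq0; apply/eqP/poly_eq0_units => x x0.
  have PXx : P.['X].[x] = P.[x%:P].[x] by rewrite !evE hornerX hornerC.
  by rewrite hornerD hornerN !hornerM !hornerXn PXx PB // SB // exprD; ring.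
have cop : coprimep (('X - c%:P) ^+ 2) ('X^(e + e) : {poly F}).
  rewrite coprimep_expl // coprimep_sym coprimep_XsubC rootE hornerXn.
  by rewrite expf_neq0.
by rewrite -(Gauss_dvdpr _ cop) -eqS PX mulrA dvdp_mulIr.
Qed.

Lemma dvdp_prod_XsubC_exp (P : {poly F}) (fs : seq (F * nat)) :
    uniq (map fst fs) -> {in fs, forall f, ('X - f.1%:P) ^+ f.2 %| P} ->
  \prod_(f <- fs) ('X - f.1%:P) ^+ f.2 %| P.
Proof.
elim: fs => [|f fs IH] /=; first by rewrite big_nil dvd1p.
move=> /andP[nf u] H; rewrite big_cons Gauss_dvdp.
  by rewrite H ?mem_head // IH // => g gfs; apply: H; rewrite inE gfs orbT.
apply/coprimep_expl; rewrite coprimep_sym coprimep_XsubC rootE horner_prod.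
rewrite prodf_seq_neq0; apply/allP => g gfs /=.
rewrite horner_exp hornerXsubC expf_neq0 // subr_eq0.
by apply: contra nf => /eqP ->; apply: map_f.
Qed.

Lemma size_prod_XsubC_exp (fs : seq (F * nat)) :
  size (\prod_(f <- fs) ('X - f.1%:P) ^+ f.2 : {poly F}) = (sumn (map snd fs)).+1.
Proof.
elim: fs => [|f fs IH] /=; first by rewrite big_nil size_poly1.
rewrite big_cons size_monicM ?monic_exp ?monicXsubC // -?size_poly_gt0 ?IH //.
by rewrite size_exp_XsubC addSn addnS.
Qed.

Lemma poly_eq0_roots (P : {poly F}) (fs : seq (F * nat)) :
    uniq (map fst fs) -> {in fs, forall f, ('X - f.1%:P) ^+ f.2 %| P} ->
    (size P <= sumn (map snd fs))%N ->
  P = 0.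
Proof.
move=> u H le; apply: contraTeq le => nz; rewrite -ltnNge.
by rewrite -size_prod_XsubC_exp; apply: dvdp_leq => //; apply: dvdp_prod_XsubC_exp.
Qed.
End Laurent.

(** * The bordered determinant *)

Lemma det_border_reg (R : idomainType) n (a : R) (r : 'rV_n) (c : 'cV_n) (M : 'M[R]_n) :
  \det M != 0 ->
  \det (block_mx a%:M r c M) = a * \det M - (r *m \adj M *m c) 0 0.
Proof.
move=> nz; apply: (mulIf nz).
transitivity (\det (block_mx a%:M r c M *m block_mx (\det M)%:M 0 (- (\adj M *m c)) 1%:M)).
  by rewrite det_mulmx det_lblock det1 mulr1 det_scalar1.
rewrite mulmx_block !mulmx0 !mulmx1 !add0r !mulmxN !mulmxA mul_mx_adj.
rewrite (scalar_mxC (\det M) c) subrr.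
rewrite det_ublock -scalar_mxM det_mx11; congr (_ * _).
by rewrite mxE [X in X + _ = _]mxE [X in _ + X = _]mxE eqxx mulr1n.
Qed.

(** For an invertible block this is the Schur complement; the general case
    follows by replacing M by M + t, whose determinant is a monic polynomial in
    t, and putting t = 0. *)
Lemma det_border (F : fieldType) n (a : F) (r : 'rV_n) (c : 'cV_n) (M : 'M[F]_n) :
  \det (block_mx a%:M r c M) = a * \det M - (r *m \adj M *m c) 0 0.
Proof.
pose M' := char_poly_mx (- M).
have nz : \det M' != 0 by exact/monic_neq0/char_poly_monic.
have := det_border_reg a%:P (map_mx polyC r) (map_mx polyC c) nz.
move=> /(congr1 (horner_eval 0)).
have M'0 : map_mx (horner_eval 0) M' = M.
  apply/matrixP => i j; rewrite !mxE /horner_eval hornerD hornerN hornerC hornerMn hornerX.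
  by rewrite mul0rn sub0r opprK.
have C0 m1 m2 (N : 'M[F]_(m1, m2)) : map_mx (horner_eval 0) (map_mx polyC N) = N.
  by apply/matrixP => i j; rewrite !mxE /horner_eval hornerC.
rewrite -det_map_mx map_block_mx map_scalar_mx /= !C0 M'0 /horner_eval !hornerC => ->.
rewrite hornerD hornerN hornerM hornerC.
have -> : (\det M').[0] = \det M by rewrite -[LHS]/(horner_eval 0 (\det M')) -det_map_mx M'0.
congr (_ - _).
rewrite -[LHS]/(horner_eval 0 _) -[RHS]/(fun_of_matrix _ 0 0).
have <- : map_mx (horner_eval 0) (map_mx polyC r *m \adj M' *m map_mx polyC c) = r *m \adj M *m c.
  by rewrite !map_mxM map_mx_adj M'0 !C0.
by rewrite [RHS]mxE.
Qed.

Section Kernel.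
Variables (F : fieldType) (Q : F).
Hypothesis Q0 : Q != 0.

(** [kern] is the entry of the determinant, a function of the product of two
    parameters; [pole_den] clears its poles and leaves [kern_num]. *)
Definition pole_den (x : F) := sigma (Q * x) * sigma (Q / x).
Definition kern (x : F) := (sigma (Q * x))^-1 + (sigma (Q / x))^-1.
Definition kern_num (x : F) := sigma Q * (x + x^-1).

Lemma sigmaN (x : F) : sigma (- x) = - sigma x.
Proof. by rewrite /sigma invrN; ring. Qed.

Lemma sigmaV (x : F) : sigma x^-1 = - sigma x.
Proof. by rewrite /sigma invrK; ring. Qed.

Lemma pole_denE x : x != 0 -> pole_den x = - x ^+ 2 + (Q ^+ 2 + Q ^- 2) + - x ^- 2.
Proof. by move=> x0; rewrite /pole_den /sigma; field; rewrite Q0 x0. Qed.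

Lemma pole_denV x : pole_den x^-1 = pole_den x. Proof. by rewrite /pole_den invrK mulrC. Qed.
Lemma kernV x : kern x^-1 = kern x. Proof. by rewrite /kern invrK addrC. Qed.
Lemma kern_numV x : kern_num x^-1 = kern_num x. Proof. by rewrite /kern_num invrK [x + _]addrC. Qed.
Lemma pole_denN x : pole_den (- x) = pole_den x.
Proof. by rewrite /pole_den invrN !mulrN !sigmaN mulrNN. Qed.
Lemma kern_numN x : kern_num (- x) = - kern_num x.
Proof. by rewrite /kern_num invrN -opprD mulrN. Qed.

Lemma pole_den_kern x : x != 0 -> pole_den x != 0 -> pole_den x * kern x = kern_num x.
Proof.
move=> x0; rewrite /pole_den mulf_eq0 negb_or => /andP[A B].
transitivity (sigma (Q / x) + sigma (Q * x)).
  by rewrite /kern; field; rewrite A B.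
by rewrite /kern_num /sigma; field; rewrite Q0 x0.
Qed.

Definition kern_mx n (us : seq F) : 'M[F]_n := \matrix_(i, j) kern (us`_i * us`_j).

Definition pole_prod n (us : seq F) x := \prod_(l < n) pole_den (x * us`_l).

(** An entry of the border row times [pole_prod]: the denominator of the
    entry itself turns [kern] into [kern_num]. *)
Definition cleared_row n (us : seq F) (j : 'I_n) x :=
  kern_num (x * us`_j) * \prod_(l < n | l != j) pole_den (x * us`_l).

(** The determinant bordered by kern(x y), by the row kern(x u_j) and by the
    column kern(u_j y), with all poles in x and y cleared. *)
Definition border_num n (us : seq F) x y :=
  kern_num (x * y) * (pole_prod n us x * pole_prod n us y) * \det (kern_mx n us)
  - pole_den (x * y) * \sum_(j < n) \sum_(l < n) cleared_row us j x * cleared_row us l y * \adj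
    (kern_mx n us) j l.

Lemma cleared_rowE n (us : seq F) (j : 'I_n) x : x * us`_j != 0 -> pole_den (x * us`_j) != 0 ->
  cleared_row us j x = pole_prod n us x * kern (x * us`_j).
Proof.
move=> xu0 nz; rewrite /pole_prod (bigD1 j) //= mulrAC pole_den_kern //.
Qed.

Lemma pole_den_cleared_row n (us : seq F) (j : 'I_n) x :
  pole_den (x * us`_j) * cleared_row us j x = kern_num (x * us`_j) * pole_prod n us x.
Proof. by rewrite /pole_prod (bigD1 j) //= /cleared_row mulrCA. Qed.

Lemma kern_mx_sym n us : (kern_mx n us)^T = kern_mx n us.
Proof. by apply/matrixP => i j; rewrite !mxE mulrC. Qed.

Lemma kern_mx_cons n (x : F) us : kern_mx n.+1 (x :: us) =
  block_mx (kern (x * x))%:M (\row_j kern (x * us`_j)) (\col_j kern (x * us`_j)) (kern_mx n us)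
  :> 'M_(1 + n).
Proof.
rewrite -[LHS](@submxK _ 1 n 1 n); congr block_mx; apply/matrixP => i j; rewrite !mxE /=.
- by rewrite !ord1 eqxx mulr1n.
- by rewrite !ord1.
- by rewrite !ord1 /= mulrC.
- by [].
Qed.

Lemma border_num_det n (us : seq F) x : x != 0 -> pole_den (x * x) != 0 ->
    (forall l : 'I_n, us`_l != 0) -> (forall l : 'I_n, pole_den (x * us`_l) != 0) ->
  border_num n us x x = pole_den (x * x) * pole_prod n us x ^+ 2 * \det (kern_mx n.+1 (x :: us)).
Proof.
move=> x0 kx us0 ku; rewrite kern_mx_cons det_border mulrBr; congr (_ - _).
  by rewrite -(pole_den_kern (mulf_neq0 x0 x0) kx); ring.
rewrite -[RHS]mulrA; congr (pole_den _ * _); rewrite mxE mulr_sumr exchange_big /=.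
apply: eq_bigr => l _; rewrite !mxE mulr_suml mulr_sumr; apply: eq_bigr => j _.
by rewrite (cleared_rowE (mulf_neq0 x0 (us0 j)) (ku j)) (cleared_rowE (mulf_neq0 x0 (us0 l)) (ku
  l)) !mxE; ring.
Qed.

Lemma border_num_sym n us x y : border_num n us x y = border_num n us y x.
Proof.
rewrite /border_num (mulrC x y); congr (_ * _ * _ - _ * _); first exact: mulrC.
rewrite exchange_big; apply: eq_bigr => l _; apply: eq_bigr => j _.
have -> : \adj (kern_mx n us) j l = \adj (kern_mx n us) l j.
  by rewrite -[in LHS]kern_mx_sym -trmx_adj mxE.
by rewrite [cleared_row _ _ x * _]mulrC.
Qed.

(** Up to its sign the border row is the row number j of the block. *)
Lemma border_num_vanish n (us : seq F) (j : 'I_n) c y :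
    c ^+ 2 = us`_j ^+ 2 -> y != 0 -> (forall l : 'I_n, us`_l != 0) ->
    (forall l : 'I_n, pole_den (us`_j * us`_l) != 0) ->
  border_num n us c y = 0.
Proof.
move=> c2 y0 us0 ku.
have [s [cE hs ks]] : exists s, [/\ c = s * us`_j,
    forall z, kern_num (s * z) = s * kern_num z & forall z, pole_den (s * z) = pole_den z].
  move/eqP: c2; rewrite eqf_sqr => /orP[/eqP->|/eqP->]; [exists 1|exists (-1)].
    by split=> [|z|z]; rewrite ?mul1r.
  by split=> [|z|z]; rewrite !mulN1r ?kern_numN ?pole_denN.
have Kc : pole_prod n us c = pole_prod n us us`_j.
  by apply: eq_bigr => l _; rewrite cE -mulrA ks.
have rc l : cleared_row us l c = s * (pole_prod n us us`_j * kern_mx n us j l).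
  rewrite mxE -(cleared_rowE (mulf_neq0 (us0 j) (us0 l)) (ku l)) /cleared_row cE -mulrA hs
    -mulrA; congr (_ * (_ * _)).
  by apply: eq_bigr => i _; rewrite -mulrA ks.
rewrite /border_num (_ : c * y = s * (us`_j * y)) ?hs ?ks; last by rewrite cE mulrA.
rewrite Kc exchange_big /=.
have -> : \sum_(l < n) \sum_(i < n) cleared_row us i c * cleared_row us l y * \adj (kern_mx n us)
  i l
  = s * pole_prod n us us`_j * \det (kern_mx n us) * cleared_row us j y.
  transitivity (\sum_(l < n) s * pole_prod n us us`_j * cleared_row us l y * (kern_mx n us *m
    \adj (kern_mx n us)) j l).
    apply: eq_bigr => l _; rewrite [X in _ = _ * X]mxE mulr_sumr; apply: eq_bigr => i _.
    by rewrite rc; ring.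
  rewrite mul_mx_adj (bigD1 j) //= big1 ?addr0; last first.
    by move=> l nlj; rewrite mxE eq_sym (negPf nlj) mulr0n mulr0.
  by rewrite mxE eqxx mulr1n; ring.
have := pole_den_cleared_row us j y; rewrite ![y * _]mulrC => e.
rewrite (_ : pole_den _ * _ = (s * pole_prod n us us`_j * \det (kern_mx n us)) * (pole_den (us`_j
  * y) * cleared_row us j y)); last by ring.
by rewrite e; ring.
Qed.

Lemma laurent_pole_den c : c != 0 -> laurent 2 (fun x => pole_den (x * c)).
Proof.
move=> c0; apply: (eq_laurent (f := fun x => (- c ^+ 2) * x ^+ 2 + (Q ^+ 2 + Q ^- 2) + (- c ^- 2)
  * x ^- 2)).
  by move=> x x0; rewrite pole_denE ?mulf_neq0 //; field; rewrite Q0 c0 x0.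
exact: laurentXX.
Qed.

Lemma laurent_kern_num c : c != 0 -> laurent 1 (fun x => kern_num (x * c)).
Proof.
move=> c0; apply: (eq_laurent (f := fun x => (sigma Q * c) * x + (sigma Q / c) * x^-1)).
  by move=> x x0; rewrite /kern_num; field; rewrite c0 x0.
exact: laurentX.
Qed.

Lemma laurent_pole_prod n us : (forall l : 'I_n, us`_l != 0) ->
  laurent n.*2 (fun x => pole_prod n us x).
Proof.
move=> us0; have := @laurent_prod F _ (index_enum 'I_n) predT 2 (fun l x => pole_den (x * us`_l)).
rewrite count_predT; have -> : size (index_enum 'I_n) = n.
  by rewrite -[RHS]card_ord cardE enumT.
by rewrite muln2; apply=> l _; apply: laurent_pole_den.
Qed.

Lemma laurent_cleared_row n us (j : 'I_n) : (forall l : 'I_n, us`_l != 0) ->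
  laurent (n.*2).-1 (cleared_row us j).
Proof.
move=> us0; have := @laurent_prod F _ (index_enum 'I_n) (predC1 j) 2 (fun l x => pole_den (x *
  us`_l)).
have -> : count (predC1 j) (index_enum 'I_n) = n.-1.
  rewrite -size_filter -[n in RHS]card_ord -(cardC1 j) cardE /enum_mem.
  by congr (size _); rewrite -enumT.
move=> /(_ (fun l _ => laurent_pole_den (us0 l))) /(laurentM (laurent_kern_num (us0 j))).
by case: n j us0 => [[]//|n] j us0; rewrite (_ : (1 + _)%N = n.+1.*2.-1) //; lia.
Qed.

Lemma laurent_border_num n us : (forall l : 'I_n, us`_l != 0) ->
  laurent (4 * n + 2) (fun x => border_num n us x x).
Proof.
move=> us0.
have h2 : laurent 2 (fun x => kern_num (x * x)).
  apply: (eq_laurent (f := fun x => sigma Q * x ^+ 2 + 0 + sigma Q * x ^- 2)).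
    by move=> x x0; rewrite /kern_num; field.
  exact: laurentXX.
have k4 : laurent 4 (fun x => pole_den (x * x)).
  apply: (eq_laurent (f := fun x => (1 * x ^+ 2 + 0 + 1 * x ^- 2) *
      ((-1) * x ^+ 2 + 0 + (-1) * x ^- 2) + (Q ^+ 2 + Q ^- 2 + 2%:R))).
    by move=> x x0; rewrite pole_denE ?mulf_neq0 //; field; rewrite Q0 x0.
  apply: laurentD; first exact: (laurentM (laurentXX _ _ _) (laurentXX _ _ _)).
  exact: laurent_widen (laurentC _).
pose A j l := \adj (kern_mx n us) j l.
apply: (eq_laurent (f := fun x => kern_num (x * x) * (pole_prod n us x * pole_prod n us x) * \det
  (kern_mx n us)
  + (- 1) * (pole_den (x * x) * \sum_(j < n) \sum_(l < n) cleared_row us j x * cleared_row us l x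
    * A j l))).
  by move=> x _; rewrite mulN1r.
have lK := laurent_pole_prod us0.
apply: laurentD.
  have := laurentM (laurentM h2 (laurentM lK lK)) (laurentC (\det (kern_mx n us))).
  by apply: laurent_widen; lia.
case: n us us0 @A lK => [|n] us us0 A lK.
  apply: (eq_laurent (f := fun=> 0)) => [x _|]; first by rewrite big_ord0 !mulr0.
  exact: laurent_widen (laurentC _).
have ls : laurent (n.+1.*2.-1 + n.+1.*2.-1 + 0)
    (fun x => \sum_(j < n.+1) \sum_(l < n.+1) cleared_row us j x * cleared_row us l x * A j l).
  apply: laurent_sum => j _; apply: laurent_sum => l _.
  by apply: laurentM (laurentC _); apply: laurentM; exact: laurent_cleared_row.
have := laurentM (laurentC (-1)) (laurentM k4 ls).
by apply: laurent_widen; lia.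
Qed.

Lemma bilaurent_border_num n us : (forall l : 'I_n, us`_l != 0) ->
  bilaurent (border_num n us).
Proof.
move=> us0; have lK := laurent_pole_prod us0.
have bx := bilaurent_l (laurentX (1 : F) 0); have by_ := bilaurent_r (laurentX (1 : F) 0).
have bxV := bilaurent_l (laurentX (0 : F) 1); have byV := bilaurent_r (laurentX (0 : F) 1).
have bC (c : F) := bilaurent_l (laurentC c : laurent 0 (fun=> c)).
have bxy := bilaurentM bx by_; have bxyV := bilaurentM bxV byV.
have bh : bilaurent (fun x y => kern_num (x * y)).
  have := bilaurentM (bC (sigma Q)) (bilaurentD bxy bxyV).
  by apply: eq_bilaurent => x y x0 y0; rewrite /kern_num; field; rewrite x0 y0.
have bk : bilaurent (fun x y => pole_den (x * y)).
  have := bilaurentD (bilaurentM (bC (-1)) (bilaurentM bxy bxy))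
   (bilaurentD (bC (Q ^+ 2 + Q ^- 2)) (bilaurentM (bC (-1)) (bilaurentM bxyV bxyV))).
  apply: eq_bilaurent => x y x0 y0; rewrite pole_denE ?mulf_neq0 //.
  by field; rewrite Q0 x0 y0.
have bs : bilaurent (fun x y => \sum_(j < n) \sum_(l < n)
    cleared_row us j x * cleared_row us l y * \adj (kern_mx n us) j l).
  apply: bilaurent_sum => j _; apply: bilaurent_sum => l _.
  apply: bilaurentM (bC _); apply: bilaurentM.
    exact: bilaurent_l (laurent_cleared_row j us0).
  exact: bilaurent_r (laurent_cleared_row l us0).
have := bilaurentD (bilaurentM (bilaurentM bh (bilaurentM (bilaurent_l lK) (bilaurent_r lK))) (bC
  (\det (kern_mx n us))))
  (bilaurentM (bC (-1)) (bilaurentM bk bs)).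
by apply: eq_bilaurent => x y x0 y0; rewrite mulN1r.
Qed.

End Kernel.

(** * Zeros and degree of the difference of the two sides *)

Section Main.
Variables (F : fieldType) (Q : F).
Hypothesis Q0 : Q != 0.
Local Notation pole_den := (pole_den Q).
Local Notation kern := (kern Q).
Local Notation kern_num := (kern_num Q).
Local Notation border_num := (border_num Q).
Local Notation kern_mx := (kern_mx Q).

(** The square of a Vandermonde product, with sigma(u/c) in place of u - c. *)
Fixpoint vdm_sqr (us : seq F) : F :=
  if us is u :: us' then \prod_(c <- us') sigma (u / c) ^+ 2 * vdm_sqr us' else 1.

Definition boundary_prod (p : F) us := \prod_(c <- us) pole_den (p * c).
Definition pole_prod_all us := \prod_(a <- us) \prod_(b <- us) pole_den (a * b).

Definition det_formula (p : F) (us : seq F) : Prop :=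
  Zup Q p p us * vdm_sqr us = boundary_prod p us * pole_prod_all us * \det (kern_mx (size us) us).

(** The difference of the two sides of [det_formula] for [X :: us], where the
    determinant is written as [border_num] so that it stays defined at the poles. *)
Definition det_defect (p : F) (us : seq F) (X : F) : F :=
  Zup Q p p (X :: us) * (\prod_(c <- us) sigma (X / c) ^+ 2 * vdm_sqr us)
  - pole_den (p * X) * (boundary_prod p us * pole_prod_all us) * border_num (size us) us X X.

Lemma sigma_eq0 (x : F) : x != 0 -> (sigma x == 0) = (x ^+ 2 == 1).
Proof.
move=> x0; rewrite /sigma subr_eq0; apply/eqP/eqP => [e|e].
  by rewrite expr2 {2}e mulfV.
by apply: (mulfI x0); rewrite mulfV // -expr2.
Qed.

Lemma sigma_sqr1 (e x : F) : e ^+ 2 = 1 -> sigma (e * x) ^+ 2 = sigma x ^+ 2.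
Proof.
move=> /eqP; rewrite sqrf_eq1 => /orP[] /eqP ->; first by rewrite mul1r.
by rewrite mulN1r sigmaN sqrrN.
Qed.

Lemma pole_prodE us x : pole_prod Q (size us) us x = \prod_(c <- us) pole_den (x * c).
Proof. by rewrite (big_nth 0) big_mkord. Qed.

Lemma vdm_sqr_split s1 v s2 :
  vdm_sqr (s1 ++ v :: s2) = \prod_(c <- s1 ++ s2) sigma (v / c) ^+ 2 * vdm_sqr (s1 ++ s2).
Proof.
elim: s1 => [//|c s1 IH] /=; rewrite IH !big_cat !big_cons big_cat /=.
have -> : sigma (c / v) ^+ 2 = sigma (v / c) ^+ 2.
  by rewrite -invf_div sigmaV sqrrN.
by ring.
Qed.

Lemma boundary_prod_split p s1 v s2 : boundary_prod p (s1 ++ v :: s2) = pole_den (p * v) *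
  boundary_prod p (s1 ++ s2).
Proof. by rewrite /boundary_prod !big_cat big_cons /= mulrCA. Qed.

(** Moving one parameter to the front, here and in the two lemmas before,
    isolates the factors that involve it. *)
Lemma pole_prod_all_split s1 v s2 :
  pole_prod_all (s1 ++ v :: s2) = pole_den (v * v) * \prod_(c <- s1 ++ s2) pole_den (v * c) ^+ 2
    * pole_prod_all (s1 ++ s2).
Proof.
have pm : perm_eq (s1 ++ v :: s2) (v :: (s1 ++ s2)).
  by rewrite -[v :: s2]cat1s perm_catCA.
rewrite /pole_prod_all (perm_big _ pm) big_cons (perm_big _ pm) big_cons /= -[LHS]mulrA
  -[RHS]mulrA; congr (_ * _).
transitivity (\prod_(c <- s1 ++ s2) pole_den (v * c) * \prod_(a <- s1 ++ s2) (pole_den (v * a) *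
  \prod_(b <- s1 ++ s2) pole_den (a * b))).
  by congr (_ * _); apply: eq_bigr => a _; rewrite (perm_big _ pm) big_cons [a * v]mulrC.
by rewrite [X in _ * X]big_split /= prodrXl; ring.
Qed.

Lemma pole_prod_all_cons v s :
  pole_prod_all (v :: s) = pole_den (v * v) * \prod_(c <- s) pole_den (v * c) ^+ 2 *
    pole_prod_all s.
Proof. exact: (pole_prod_all_split [::]). Qed.

Lemma prod_map_inv (f g : F -> F) us : (forall c, f c^-1 = g c) ->
  \prod_(c <- map GRing.inv us) f c = \prod_(c <- us) g c.
Proof. by move=> e; rewrite big_map; apply: eq_bigr => c _; apply: e. Qed.

Lemma sigma_div_inv (x c : F) : sigma (x^-1 / c^-1) ^+ 2 = sigma (x / c) ^+ 2.
Proof. by rewrite -invfM sigmaV sqrrN. Qed.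

Lemma vdm_sqr_inv us : vdm_sqr (map GRing.inv us) = vdm_sqr us.
Proof.
elim: us => //= u us ->; congr (_ * _).
by apply: prod_map_inv => c; rewrite sigma_div_inv.
Qed.

Lemma boundary_prod_inv p us : boundary_prod p^-1 (map GRing.inv us) = boundary_prod p us.
Proof. by apply: prod_map_inv => c; rewrite -invfM pole_denV. Qed.

Lemma pole_prod_all_inv us : pole_prod_all (map GRing.inv us) = pole_prod_all us.
Proof.
by apply: prod_map_inv => a; apply: prod_map_inv => b; rewrite -invfM pole_denV.
Qed.

Lemma nth_map_inv (us : seq F) i : (map GRing.inv us)`_i = (us`_i)^-1.
Proof. by elim: us i => [|u us IH] [|i] //=; rewrite invr0. Qed.

Lemma kern_mx_inv n us : kern_mx n (map GRing.inv us) = kern_mx n us.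
Proof. by apply/matrixP => i j; rewrite !mxE !nth_map_inv -invfM kernV. Qed.

Lemma border_num_inv n us x y : border_num n (map GRing.inv us) x^-1 y^-1 = border_num n us x y.
Proof.
have rhoV (j : 'I_n) z : cleared_row Q (map GRing.inv us) j z^-1 = cleared_row Q us j z.
  rewrite /cleared_row nth_map_inv -invfM kern_numV; congr (_ * _); apply: eq_bigr => l _.
  by rewrite nth_map_inv -invfM pole_denV.
have kV z : pole_prod Q n (map GRing.inv us) z^-1 = pole_prod Q n us z.
  by apply: eq_bigr => l _; rewrite nth_map_inv -invfM pole_denV.
rewrite /border_num kern_mx_inv -invfM kern_numV pole_denV !kV; congr (_ - _ * _).
by apply: eq_bigr => j _; apply: eq_bigr => l _; rewrite !rhoV.
Qed.

Lemma det_formula_inv p us : det_formula p us -> det_formula p^-1 (map GRing.inv us).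
Proof.
by rewrite /det_formula -Zup_mirror vdm_sqr_inv boundary_prod_inv pole_prod_all_inv size_map
  kern_mx_inv.
Qed.

(** Every ingredient depends on products or squared quotients of parameters
    through functions invariant under inversion; for [Zup] this is the mirror
    symmetry. *)
Lemma det_defect_inv p us x : det_defect p^-1 (map GRing.inv us) x^-1 = det_defect p us x.
Proof.
rewrite /det_defect -[x^-1 :: _]/(map GRing.inv (x :: us)) -Zup_mirror vdm_sqr_inv.
rewrite boundary_prod_inv pole_prod_all_inv size_map border_num_inv -invfM pole_denV;
  congr (_ * (_ * _) - _).
by apply: prod_map_inv => c; rewrite sigma_div_inv.
Qed.

(** The first row is removed on the left; on the right [pole_den (X * X)]
    vanishes and only the term of [border_num] with the full determinant of the
    block remains. *)
Lemma det_defect_freeze1 (p : F) (us : seq F) (X : F) : X != 0 -> all (predC1 0) us ->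
  det_formula p us -> sigma (Q * X ^+ 2) = 0 -> det_defect p us X = 0.
Proof.
move=> X0 us0 cl z.
have x2 : X ^+ 2 != 0 by rewrite expf_neq0.
have /eqP e2 : (Q * X ^+ 2) ^+ 2 == 1 by rewrite -sigma_eq0 ?z // mulf_neq0.
set e := Q * X ^+ 2 in e2.
have e0 : e != 0 by rewrite mulf_neq0.
have eV : e^-1 = e by apply: (mulfI e0); rewrite mulfV // -expr2 e2.
have XE : X ^+ 2 = e / Q by rewrite /e; field.
apply/eqP; rewrite /det_defect subr_eq0 Zup_freeze1 //; apply/eqP.
have -> : border_num (size us) us X X = kern_num (X * X) * (\prod_(c <- us) pole_den (X * c)) ^+ 2
    * \det (kern_mx (size us) us).
  rewrite /border_num pole_prodE -!expr2 (_ : pole_den (X ^+ 2) = 0) ?mul0r ?subr0 //.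
  by rewrite /pole_den z mul0r.
have h1 : sigma (Q * X ^- 2) = kern_num (X * X).
  rewrite /kern_num -expr2 XE; move: e2 => /eqP; rewrite sqrf_eq1 /sigma.
  by case/orP=> /eqP ->; field; rewrite ?Q0 ?oppr_eq0 ?oner_eq0.
have h2 : \prod_(c <- us) (sigma (Q / (X * c)) ^+ 2) * \prod_(c <- us) sigma (X / c) ^+ 2
   = (\prod_(c <- us) pole_den (X * c)) ^+ 2.
  rewrite -big_split -prodrXl /=; apply: eq_big_seq => c cus.
  have c0 : c != 0 := allP us0 _ cus.
  rewrite /pole_den exprMn mulrC; congr (_ * _).
  rewrite -(sigma_sqr1 (X / c) e2) -[LHS]sqrrN -sigmaV; congr (sigma _ ^+ 2).
  by rewrite invfM eV /e; field; rewrite X0 c0.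
have kp : pole_den (p * X) = sigma (p * Q * X) * sigma (Q / (X * p)).
  rewrite /pole_den (mulrC X p); congr (sigma _ * sigma _); ring.
rewrite h1 -h2 kp; set A1 := \prod_(c <- us) _; set A2 := \prod_(c <- us) _.
transitivity (sigma (p * Q * X) * sigma (Q / (X * p)) * kern_num (X * X) * A1 * A2
  * (Zup Q p p us * vdm_sqr us)); first by ring.
by rewrite cl; ring.
Qed.

Lemma Zup_move (p : F) (pre s1 : seq F) (v : F) (s2 : seq F) : Q ^+ 8 != 1 -> p != 0 ->
    all (predC1 0) (pre ++ s1 ++ v :: s2) ->
  Zup Q p p (pre ++ s1 ++ v :: s2) = Zup Q p p (pre ++ v :: s1 ++ s2).
Proof.
move=> Q8 p0; elim: s1 pre => [//|c s1 IH] pre nz.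
rewrite -[LHS]/(Zup Q p p (pre ++ c :: s1 ++ v :: s2)) -cat_rcons IH ?cat_rcons //.
move: nz; rewrite !all_cat /= => /andP[pre0 /andP[/andP[c0 s10] /andP[v0 s20]]].
by rewrite Zup_swap // all_cat s10.
Qed.

(** Two rows are removed on the left.  On the right every product containing
    [pole_den (X * v)] vanishes, which leaves one entry of the adjugate: the
    determinant for the remaining parameters. *)
Lemma det_defect_freeze2 (p : F) (s1 : seq F) (v : F) (s2 : seq F) (X : F) : Q ^+ 8 != 1 -> p !=
  0 -> X != 0 -> v != 0 ->
    all (predC1 0) (s1 ++ s2) ->
  det_formula p (s1 ++ s2) -> sigma (Q * (X * v)) = 0 -> det_defect p (s1 ++ v :: s2) X = 0.
Proof.
move=> Q8 p0 X0 v0 us0 cl z.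
have /eqP e2 : (Q * (X * v)) ^+ 2 == 1 by rewrite -sigma_eq0 ?z // !mulf_neq0.
set e := Q * (X * v) in e2.
have e0 : e != 0 by rewrite !mulf_neq0.
have eV : e^-1 = e by apply: (mulfI e0); rewrite mulfV // -expr2 e2.
set us := s1 ++ v :: s2; set us' := s1 ++ s2 in us0 cl *.
have swap : Zup Q p p (X :: us) = Zup Q p p (X :: v :: us').
  apply: (Zup_move (pre := [:: X]) (s1 := s1) (v := v) (s2 := s2) Q8 p0) => /=.
  by move: us0; rewrite /us' !all_cat /= X0 v0.
have uss0 : forall c, c \in us' -> c != 0 by exact/allP.
have nz : border_num (size us) us X X = - (pole_den (X * X) * (kern_num (X * v) * \prod_(c <-
  us') pole_den (X * c)) ^+ 2
    * \det (kern_mx (size us') us')).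
  have sz : size us = (size us').+1 by rewrite !size_cat /= addnS.
  have ltj : (size s1 < (size us').+1)%N by rewrite size_cat; lia.
  pose j := Ordinal ltj.
  have usj : us`_j = v by rewrite nth_cat ltnn subnn.
  have usl (l : 'I_(size us')) : us`_(lift j l) = us'`_l.
    rewrite /us /us' !nth_cat /= /bump; case: (ltnP l (size s1)) => le.
      by rewrite add0n le.
    by rewrite add1n ltnNge (leqW le) /= subSn.
  have kXv : pole_den (X * v) = 0 by rewrite /pole_den z mul0r.
  have P0 : pole_prod Q (size us').+1 us X = 0 by rewrite /pole_prod (bigD1 j) //= usj kXv mul0r.
  have rl (l : 'I_(size us').+1) : l != j -> cleared_row Q us l X = 0.
    move=> nlj; rewrite /cleared_row (bigD1 j) /=; last by rewrite eq_sym.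
    by rewrite usj kXv mul0r mulr0.
  have rj : cleared_row Q us j X = kern_num (X * v) * \prod_(c <- us') pole_den (X * c).
    rewrite /cleared_row usj; congr (_ * _); rewrite [RHS](big_nth 0) big_mkord.
    transitivity (\prod_(l < size us') pole_den (X * us`_(lift j l))).
      rewrite big_mkcond (bigD1_ord j) //= eqxx mul1r.
      by apply: eq_bigr => l _; rewrite eq_sym neq_lift.
    by apply: eq_bigr => l _; rewrite usl.
  (* Deleting row and column j removes the parameter v. *)
  have adjj : \adj (kern_mx (size us').+1 us) j j = \det (kern_mx (size us') us').
    rewrite mxE /cofactor -signr_odd addnn odd_double mul1r; congr (\det _).
    by apply/matrixP => a b; rewrite !mxE !usl.
  rewrite sz /border_num P0 !(mul0r, mulr0) sub0r; congr (- _).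
  rewrite -[RHS]mulrA; congr (pole_den _ * _).
  rewrite (bigD1 j) //= [X in _ + X]big1 ?addr0; last first.
    by move=> i ni; rewrite big1 // => l _; rewrite rl // !mul0r.
  rewrite (bigD1 j) //= [X in _ + X]big1 ?addr0; last first.
    by move=> i ni; rewrite (rl i ni) mulr0 mul0r.
  by rewrite adjj rj expr2.
have [Xe ve] : X = e / (Q * v) /\ v = e / (Q * X) by rewrite /e; split; field; rewrite Q0 ?X0 ?v0.
have h1 : kern_num (X * v) ^+ 2 = sigma (Q ^+ 2) ^+ 2.
  rewrite -(sigma_sqr1 _ e2) /kern_num Xe; move: e2 => /eqP; rewrite sqrf_eq1 /sigma.
  by case/orP=> /eqP ->; field; rewrite ?Q0 ?v0 ?oppr_eq0 ?oner_eq0.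
have h2 : pole_den (X * X) * pole_den (v * v) = - (sigma (Q * X ^- 2) * sigma (Q * v ^- 2) *
  sigma (X / v) ^+ 2).
  have a1 : sigma (Q * (X * X)) = sigma (e * (X / v)).
    by congr sigma; rewrite /e; field.
  have a2 : sigma (Q * (v * v)) = - sigma (e * (X / v)).
    by rewrite -sigmaV; congr sigma; rewrite invfM eV /e; field; rewrite X0 v0.
  by rewrite /pole_den a1 a2 -(sigma_sqr1 (X / v) e2) -!expr2; ring.
have h3 c : c != 0 -> (pole_den (X * c) * pole_den (v * c)) ^+ 2 =
   (sigma (Q / (X * c)) * sigma (Q / (v * c))) ^+ 2 * (sigma (X / c) ^+ 2 * sigma (v / c) ^+ 2).
  move=> c0.
  have a1 : sigma (X / c) ^+ 2 = sigma (Q * (v * c)) ^+ 2.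
    rewrite -[LHS]sqrrN -sigmaV -[LHS](sigma_sqr1 _ e2); congr (sigma _ ^+ 2).
    by rewrite /e; field; rewrite X0 c0.
  have a2 : sigma (v / c) ^+ 2 = sigma (Q * (X * c)) ^+ 2.
    rewrite -[LHS]sqrrN -sigmaV -[LHS](sigma_sqr1 _ e2); congr (sigma _ ^+ 2).
    by rewrite /e; field; rewrite v0 c0.
  by rewrite a1 a2 /pole_den; ring.
have h4 : \prod_(c <- us') (sigma (Q / (X * c)) * sigma (Q / (v * c))) ^+ 2
   * (\prod_(c <- us') sigma (X / c) ^+ 2 * \prod_(c <- us') sigma (v / c) ^+ 2)
   = (\prod_(c <- us') pole_den (X * c)) ^+ 2 * \prod_(c <- us') pole_den (v * c) ^+ 2.
  rewrite -[X in _ * X]big_split -[LHS]big_split /= -prodrXl -[RHS]big_split /=.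
  by apply: eq_big_seq => c cus; rewrite -[RHS]exprMn h3 // uss0.
rewrite /det_defect nz swap Zup_freeze2 // vdm_sqr_split boundary_prod_split pole_prod_all_split
  -/us'.
have -> : \prod_(c <- us) sigma (X / c) ^+ 2 = sigma (X / v) ^+ 2 * \prod_(c <- us') sigma (X /
  c) ^+ 2.
  by rewrite /us /us' !big_cat big_cons /= mulrCA.
have kp x : pole_den (p * x) = sigma (p * Q * x) * sigma (Q / (x * p)).
  by rewrite /pole_den (mulrC x p); congr (sigma _ * sigma _); ring.
set A1 := \prod_(c <- us') _ in h4 *; set A2 := \prod_(c <- us') sigma (X / c) ^+ 2 in h4 *.
set A3 := \prod_(c <- us') _ in h4 *; set A4 := \prod_(c <- us') _ in h4 *.
set A5 := \prod_(c <- us') _ in h4 *.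
have {}h2 : sigma (Q * X ^- 2) * sigma (Q * v ^- 2) * sigma (X / v) ^+ 2 = - (pole_den (X * X) *
  pole_den (v * v)).
  by rewrite h2 opprK.
apply/eqP; rewrite subr_eq0; apply/eqP.
transitivity (sigma (Q ^+ 2) ^+ 2 * (pole_den (p * X) * pole_den (p * v))
  * (sigma (Q * X ^- 2) * sigma (Q * v ^- 2) * sigma (X / v) ^+ 2)
  * (A1 * (A2 * A3)) * (Zup Q p p us' * vdm_sqr us')); first by rewrite !kp; ring.
by rewrite cl h4 h2 -h1; ring.
Qed.

Lemma det_defect_last (p : F) (us : seq F) (X : F) : Q ^+ 8 != 1 -> p != 0 -> X != 0 ->
    all (predC1 0) us ->
  sigma (Q * (X * p)) = 0 -> det_defect p us X = 0.
Proof.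
move=> Q8 p0 X0 us0 z.
have -> : det_defect p us X = Zup Q p p (rcons us X) * (\prod_(c <- us) sigma (X / c) ^+ 2 *
  vdm_sqr us).
  rewrite /det_defect (_ : pole_den (p * X) = 0) ?mul0r ?subr0;
    last by rewrite /pole_den (mulrC p X) z mul0r.
  congr (_ * _); rewrite -cats1 -[us in LHS]cats0.
  have := @Zup_move p [::] us X [::] Q8 p0; rewrite cats0 /= => -> //.
  by rewrite all_cat us0 /= X0.
by rewrite Zup_last0 ?mul0r.
Qed.

Lemma laurent_sigma (c : F) : c != 0 -> laurent 1 (fun x => sigma (x * c)).
Proof.
move=> c0; apply: (eq_laurent (f := fun x => c * x + (- c^-1) * x^-1)).
  by move=> x x0; rewrite /sigma; field; rewrite c0 x0.
exact: laurentX.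
Qed.

Lemma laurent_bulk (c : F) t b h g : c != 0 ->
  laurent 1 (fun x => bulk_wt Q (x * c) t b h g).
Proof.
move=> c0; have lC d : laurent 1 (fun=> d : F) by exact: laurent_widen (laurentC d).
have lp : laurent 1 (fun x => sigma (Q * (x * c))).
  apply: eq_laurent (laurent_sigma (mulf_neq0 c0 Q0)) => x _; congr sigma; ring.
have lm : laurent 1 (fun x => sigma (Q / (x * c))).
  apply: (eq_laurent (f := fun x => (- (c / Q)) * x + (Q / c) * x^-1)).
    by move=> x x0; rewrite /sigma; field; rewrite Q0 c0 x0.
  exact: laurentX.
by case: t b h g => [] [] [] []; first [exact: lC | exact: lp | exact: lm].
Qed.

Lemma laurent_left (p : F) t h : p != 0 -> laurent 2 (fun x => left_wt Q p x t h).
Proof.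
move=> p0; case: t h => [] [].
- apply: (eq_laurent (f := fun x => Q * x ^+ 2 + 0 + (- Q^-1) * x ^- 2)).
    by move=> x x0; rewrite /= /sigma; field; rewrite Q0 x0.
  exact: laurentXX.
- apply: (@laurent_widen _ 1) => //.
  apply: (eq_laurent (f := fun x => (p * Q) * x + (- (p * Q)^-1) * x^-1)).
    by move=> x x0; rewrite /= /sigma; field; rewrite Q0 p0 x0.
  exact: laurentX.
- apply: (@laurent_widen _ 1) => //.
  apply: (eq_laurent (f := fun x => (- p^-1) * x + p * x^-1)).
    by move=> x x0; rewrite /= /sigma; field; rewrite p0 x0.
  exact: laurentX.
- exact: laurent_widen (laurentC _).
Qed.

Lemma laurent_right (p : F) t h : p != 0 -> laurent 2 (fun x => right_wt Q p x t h).
Proof.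
move=> p0; case: t h => [] [].
- apply: (@laurent_widen _ 1) => //.
  apply: (eq_laurent (f := fun x => (- (p / Q)) * x + (Q / p) * x^-1)).
    by move=> x x0; rewrite /right_wt /= /sigma; field; rewrite Q0 p0 x0.
  exact: laurentX.
- apply: (eq_laurent (f := fun x => (- Q^-1) * x ^+ 2 + 0 + Q * x ^- 2)).
    by move=> x x0; rewrite /right_wt /= /sigma exprVn; field; rewrite Q0 x0.
  exact: laurentXX.
- exact: laurent_widen (laurentC _).
- apply: (@laurent_widen _ 1) => //.
  apply: (eq_laurent (f := fun x => p^-1 * x + (- p) * x^-1)).
    by move=> x x0; rewrite /right_wt /= /sigma invrK; field; rewrite p0 x0.
  exact: laurentX.
Qed.

Lemma laurent_row_sum (d : nat) (cols : seq F) h ts (k : F -> seq bool -> bool -> F) :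
    all (predC1 0) cols -> (forall bs g, laurent d (fun x => k x bs g)) ->
  laurent (size cols + d) (fun x => row_sum Q x cols h ts (k x)).
Proof.
elim: cols h ts k => [|c cols IH] h ts k //= /andP[c0 cols0] kL.
apply: laurent_sum => b _; apply: laurent_sum => g _.
rewrite -addn1 addnC addnA addnC; apply: laurentM; first exact: laurent_bulk.
by rewrite addnC; apply: (IH g (behead ts) (fun x bs => k x (b :: bs))).
Qed.

(** Degree 2 from each end of the first row and 1 from each of its bulk
    vertices. *)
Lemma laurent_Zup (p w : F) (us : seq F) : p != 0 -> w != 0 -> all (predC1 0) us ->
  laurent ((size us).*2 + 5) (fun X => Zup Q p w (X :: us)).
Proof.
move=> p0 w0 us0; apply: laurent_sum => h _.
rewrite (_ : _ + 5 = 2 + (size (us ++ w :: rev us) + 2))%N; last first.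
  by rewrite size_cat /= size_rev; lia.
apply: laurentM; first exact: laurent_left.
apply: (@laurent_row_sum 2 (us ++ w :: rev us) h (nseq (size us).*2.+2 true)
  (fun X bs g => right_wt Q p X (last true (nseq (size us).*2.+3 true)) g
     * partition_fun Q p w us bs)).
  by rewrite all_cat /= w0 all_rev us0.
move=> bs g; apply: (@laurentM _ 2 0 _ _ _ (laurentC _)).
exact: laurent_right.
Qed.

Lemma laurent_det_defect (p : F) (us : seq F) : p != 0 -> all (predC1 0) us ->
  laurent (4 * size us + 5) (det_defect p us).
Proof.
move=> p0 us0.
have us0' (l : 'I_(size us)) : us`_l != 0 by apply: (allP us0); rewrite mem_nth.
pose f x := \prod_(c <- us) (sigma (x / c) ^+ 2).
have lf : laurent (size us * 2) f.
  have := @laurent_prod F F us (predC1 0) 2 (fun c x => sigma (x / c) ^+ 2).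
  have -> : count (predC1 0) us = size us by apply/eqP; rewrite -all_count.
  move=> H.
  apply: (eq_laurent (f := fun x => \prod_(c <- us | c != 0) (sigma (x / c) ^+ 2))).
    by move=> x x0; rewrite /f [RHS]big_seq_cond [LHS]big_seq_cond; apply: eq_bigl => c;
      rewrite andbT; case: (boolP (c \in us)) => // /(allP us0) /= ->.
  apply: H => c c0; apply: (@laurentM _ 1 1); apply: laurent_sigma; exact: invr_neq0.
have l1 := laurentM (laurent_Zup p0 p0 us0) (laurentM lf (laurentC (vdm_sqr us))).
have l2 := laurentM (laurentM (laurent_pole_den Q0 p0) (laurentC (boundary_prod p us *
  pole_prod_all us))) (laurent_border_num Q0 us0').
apply: (eq_laurent (f := fun X => Zup Q p p (X :: us) * (f X * vdm_sqr us)
  + (-1) * (pole_den (X * p) * (boundary_prod p us * pole_prod_all us) * border_num (size us) us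
    X X))).
  by move=> x x0; rewrite /det_defect mulN1r [p * x]mulrC.
apply: laurentD; first by apply: laurent_widen l1; lia.
by apply: (laurent_widen _ (laurentM (laurentC (-1)) l2)); lia.
Qed.

(** The squares sigma(X/c)^2 and [border_num us X X] are split between two
    variables, in order to apply [double_root]. *)
Lemma bilaurent_det_defect (p : F) (us : seq F) : p != 0 -> all (predC1 0) us ->
  bilaurent (fun x y => Zup Q p p (x :: us) * (\prod_(c <- us) (sigma (x / c) * sigma (y / c)) *
    vdm_sqr us)
  - pole_den (p * x) * (boundary_prod p us * pole_prod_all us) * border_num (size us) us x y).
Proof.
move=> p0 us0.
have us0' (l : 'I_(size us)) : us`_l != 0 by apply: (allP us0); rewrite mem_nth.
have bC (c : F) := bilaurent_l (laurentC c : laurent 0 (fun=> c)).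
have bp : bilaurent (fun x y => \prod_(c <- us) (sigma (x / c) * sigma (y / c))).
  elim: us us0 {us0'} => [_|c us IH /= /andP[c0 /IH b]].
    by apply: eq_bilaurent (bC 1) => x y _ _; rewrite big_nil.
  have ls := laurent_sigma (invr_neq0 c0).
  have := bilaurentM (bilaurentM (bilaurent_l ls) (bilaurent_r ls)) b.
  by apply: eq_bilaurent => x y _ _; rewrite big_cons.
have b1 := bilaurentM (bilaurent_l (laurent_Zup p0 p0 us0)) (bilaurentM bp (bC (vdm_sqr us))).
have b2 := bilaurentM (bilaurentM (bilaurent_l (laurent_pole_den Q0 p0)) (bC (boundary_prod p us
  * pole_prod_all us))) (bilaurent_border_num Q0 us0').
have := bilaurentD b1 (bilaurentM (bC (-1)) b2).
by apply: eq_bilaurent => x y x0 y0; rewrite mulN1r [p * x]mulrC.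
Qed.
End Main.

(** * Interpolation in the first parameter *)

Lemma uniq_cat_opp (F : fieldType) (s : seq F) :
    [pchar F] =i pred0 -> all (predC1 0) s -> uniq (map (fun x => x ^+ 2) s) ->
  uniq (s ++ map -%R s).
Proof.
move=> charF s0 u; have us := map_uniq u.
rewrite cat_uniq us (map_inj_uniq (@oppr_inj F)) us andbT /=.
apply/hasPn => _ /mapP[y ys ->]; apply/negP => Nys.
have y0 : y != 0 := allP s0 _ ys.
have eN : index (- y) s = index y s.
  apply/eqP; rewrite -(nth_uniq 0 _ _ u) ?size_map ?index_mem //.
  by rewrite !(nth_map 0) ?index_mem // !nth_index // sqrrN.
have : - y = y by rewrite -[LHS](nth_index 0 Nys) eN nth_index.
move/eqP; rewrite eq_sym -subr_eq0 opprK -mulr2n -mulr_natr mulf_eq0 (negPf y0) /=.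
by rewrite (pcharf0P F).1.
Qed.

Section Induction.
Variables (F : fieldType) (q im p : F).
Local Notation Q := (q ^+ 2).
Hypothesis charF : [pchar F] =i pred0.
Hypotheses (q0 : q != 0) (p0 : p != 0) (im2 : im ^+ 2 = -1) (Q8 : Q ^+ 8 != 1).

(** The squares of the interpolation points; each point occurs with its
    opposite.  The points themselves are [us] (double) and [simple_roots]. *)
Definition node_squares (us : seq F) : seq F :=
  [seq x ^+ 2 | x <- us] ++ [seq (Q * x) ^- 2 | x <- us]
  ++ [seq (Q / x) ^+ 2 | x <- us]
  ++ [:: Q^-1; - Q^-1; Q; - Q; (Q * p) ^- 2; (Q / p) ^+ 2].

Lemma node_squares_subseq s1 s2 : subseq s1 s2 -> uniq (node_squares s2) -> uniq (node_squares s1).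
Proof.
move=> s12; apply: subseq_uniq; rewrite /node_squares.
by do !apply: cat_subseq => //; apply: map_subseq.
Qed.

Let Q0 : Q != 0. Proof. exact: expf_neq0. Qed.

Lemma node_squares_pole_den us a b : all (predC1 0) us -> uniq (node_squares us) ->
  a \in us -> b \in us -> pole_den Q (a * b) != 0.
Proof.
move=> us0 u aus bus.
have [a0 b0] : a != 0 /\ b != 0 by split; apply: (allP us0).
move: u; rewrite /node_squares cat_uniq => /and3P[_ /hasPn H _].
rewrite /pole_den mulf_neq0 // sigma_eq0 ?mulf_neq0 ?invr_neq0 ?mulf_neq0 //.
  have : (Q * b) ^- 2 \in [seq (Q * x) ^- 2 | x <- us] by apply: map_f.
  move=> m; have /H : (Q * b) ^- 2 \in [seq (Q * x) ^- 2 | x <- us]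
   ++ [seq (Q / x) ^+ 2 | x <- us] ++ [:: Q^-1; - Q^-1; Q; - Q; (Q * p) ^- 2; (Q / p) ^+ 2].
    by rewrite mem_cat m.
  apply: contra => /eqP e; apply/mapP; exists a => //.
  by rewrite -[LHS]mulr1 -e; field; rewrite q0 b0.
have : (Q / b) ^+ 2 \in [seq (Q / x) ^+ 2 | x <- us] by apply: (map_f (fun x => (Q / x) ^+ 2)).
move=> m; have /H : (Q / b) ^+ 2 \in [seq (Q * x) ^- 2 | x <- us]
   ++ [seq (Q / x) ^+ 2 | x <- us] ++ [:: Q^-1; - Q^-1; Q; - Q; (Q * p) ^- 2; (Q / p) ^+ 2].
  by rewrite !mem_cat m orbT.
apply: contra => /eqP e; apply/mapP; exists a => //.
by rewrite -[RHS]mulr1 -e; field; rewrite a0 b0.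
Qed.

Definition simple_roots (us : seq F) : seq F :=
  [seq (Q * x)^-1 | x <- us] ++ [seq Q / x | x <- us]
  ++ [:: q^-1; im / q; q; im * q; (Q * p)^-1; Q / p].

Lemma simple_roots_sqr us :
  [seq x ^+ 2 | x <- us ++ simple_roots us] = node_squares us.
Proof.
rewrite /node_squares /simple_roots !map_cat -!map_comp; congr (_ ++ (_ ++ (_ ++ _))).
- by apply: eq_map => x /=; rewrite exprVn.
- by rewrite /= !exprVn ![(im * _) ^+ 2]exprMn im2 exprVn !mulN1r.
Qed.

Lemma simple_roots_neq0 (us : seq F) :
  all (predC1 0) us -> all (predC1 0) (simple_roots us).
Proof.
move=> us0; have im0 : im != 0.
  by rewrite -sqrf_eq0 im2 oppr_eq0 oner_eq0.
rewrite /simple_roots !all_cat !all_map /= !(mulf_neq0, invr_neq0) // !andbT.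
by rewrite !(sub_all _ us0) // => x x0; rewrite /= ?invr_neq0 ?mulf_neq0 ?invr_neq0.
Qed.

Lemma sigma_sqr_eq1 (x : F) : x ^+ 2 = 1 -> sigma x = 0.
Proof.
move=> x2; apply/eqP; rewrite sigma_eq0 ?x2 //.
by rewrite -sqrf_eq0 x2 oner_eq0.
Qed.

Lemma det_defect_simple_root (us : seq F) (r : F) : all (predC1 0) us ->
    (forall s1 v s2, us = s1 ++ v :: s2 -> det_formula Q p (s1 ++ s2)) -> det_formula Q p us ->
    r \in simple_roots us ++ map -%R (simple_roots us) ->
  det_defect Q p us r = 0.
Proof.
move=> us0 clm cl.
have inv0 (vs : seq F) : all (predC1 0) vs -> all (predC1 0) (map GRing.inv vs).
  by rewrite all_map; apply: sub_all => x /=; rewrite invr_eq0.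
have pV0 : p^-1 != 0 by rewrite invr_eq0.
move=> rr; have {rr} : exists2 s, s \in simple_roots us & r ^+ 2 = s ^+ 2.
  move: rr; rewrite mem_cat => /orP[rr|/mapP[s ss ->]]; first by exists r.
  by exists s; rewrite ?sqrrN.
move=> [s ss e].
have s0 : s != 0 by apply: (allP (simple_roots_neq0 us0)).
have r0 : r != 0 by rewrite -sqrf_eq0 e sqrf_eq0.
have rV0 : r^-1 != 0 by rewrite invr_eq0.
have eV : r^-1 ^+ 2 = s^-1 ^+ 2 by rewrite !exprVn e.
move: ss; rewrite !mem_cat => /or3P[/mapP[x xus sE]|/mapP[x xus sE]|].
- have x0 : x != 0 := allP us0 _ xus.
  case/splitPr: us / xus us0 clm {cl} => s1 s2 us0 clm.
  apply: det_defect_freeze2 => //.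
  + by move: us0; rewrite !all_cat /= x0.
  + exact: clm.
  + by apply: sigma_sqr_eq1; rewrite !exprMn e sE; field; rewrite q0 x0.
- have x0 : x != 0 := allP us0 _ xus.
  case/splitPr: us / xus us0 clm {cl} => s1 s2 us0 clm.
  rewrite -det_defect_inv map_cat /=; apply: det_defect_freeze2; rewrite ?invr_neq0 //.
  + by rewrite -map_cat; apply: inv0; move: us0; rewrite !all_cat /= x0.
  + by rewrite -map_cat; apply: det_formula_inv; apply: clm.
  + by apply: sigma_sqr_eq1; rewrite !exprMn eV sE; field; rewrite q0 x0.
have inverse_case : sigma (Q * r^-1 ^+ 2) = 0 -> det_defect Q p us r = 0.
  by move=> z; rewrite -det_defect_inv; apply: det_defect_freeze1 => //;
    [apply: inv0|apply: det_formula_inv].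
have im4 : im ^+ 4 = 1 by rewrite (exprM im 2 2) im2 sqrrN expr1n.
have im0 : im != 0 by rewrite -sqrf_eq0 im2 oppr_eq0 oner_eq0.
rewrite !inE => /or4P[/eqP sE|/eqP sE|/eqP sE|/or3P[/eqP sE|/eqP sE|/eqP sE]].
- apply: det_defect_freeze1 => //; apply: sigma_sqr_eq1; rewrite e sE.
  by field.
- apply: det_defect_freeze1 => //; apply: sigma_sqr_eq1; rewrite e sE.
  by rewrite -[RHS]im4; field.
- apply: inverse_case; apply: sigma_sqr_eq1; rewrite eV sE.
  by field.
- apply: inverse_case; apply: sigma_sqr_eq1; rewrite eV sE.
  by rewrite -[RHS]invr1 -im4; field; rewrite q0 im0.
- apply: det_defect_last => //; apply: sigma_sqr_eq1; rewrite !exprMn e sE.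
  by field; rewrite q0 p0.
- rewrite -det_defect_inv; apply: det_defect_last; rewrite ?inv0 ?invr_neq0 //.
  by apply: sigma_sqr_eq1; rewrite !exprMn eV sE; field; rewrite q0 p0.
Qed.

(** The roots counted with multiplicity exceed the degree. *)
Lemma det_defect_eq0 (us : seq F) (X : F) : all (predC1 0) us -> uniq (node_squares us) ->
    (forall s1 v s2, us = s1 ++ v :: s2 -> det_formula Q p (s1 ++ s2)) -> det_formula Q p us ->
  X != 0 -> det_defect Q p us X = 0.
Proof.
move=> us0 uN clm cl X0.
have [S szS SE] := laurent_det_defect Q0 p0 us0.
suff S0 : S = 0.
  apply: (mulfI (expf_neq0 (4 * size us + 5) X0)).
  by rewrite -SE // S0 horner0 mulr0.
pose rt us := [seq (c, 2%N) | c <- us ++ map -%R us]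
  ++ [seq (c, 1%N) | c <- simple_roots us ++ map -%R (simple_roots us)] : seq (F * nat).
apply: (@poly_eq0_roots _ S (rt us)).
- (* Squaring separates the roots up to sign, and opposite roots differ. *)
 have all0 : all (predC1 0) (us ++ simple_roots us) by rewrite all_cat us0 simple_roots_neq0.
  have := uniq_cat_opp charF all0; rewrite simple_roots_sqr => /(_ uN).
  rewrite map_cat (perm_uniq (permEl (perm_catACA _ _ _ _))).
  have fstE k (s : seq F) : map fst [seq (c, k : nat) | c <- s] = s.
    by elim: s => //= a s ->.
  by rewrite /rt (map_cat fst) !fstE.
- move=> f; rewrite mem_cat => /orP[] /mapP[c cs ->] /=; last first.
    rewrite expr1 -[_ %| _]/(dvdp _ _) dvdp_XsubCl; apply/rootP.
    have c0 : c != 0.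
      move: cs; rewrite mem_cat => /orP[|/mapP[d dR ->]]; last rewrite oppr_eq0.
        exact: (allP (simple_roots_neq0 us0)).
      exact: (allP (simple_roots_neq0 us0)).
    by rewrite SE // det_defect_simple_root // mulr0.
  have [d dus c2] : exists2 d, d \in us & c ^+ 2 = d ^+ 2.
    move: cs; rewrite mem_cat => /orP[cus|/mapP[d dus ->]]; first by exists c.
    by exists d; rewrite ?sqrrN.
  have d0 : d != 0 := allP us0 _ dus.
  have c0 : c != 0 by rewrite -sqrf_eq0 c2 sqrf_eq0.
  have ltd : (index d us < size us)%N by rewrite index_mem.
  pose j := Ordinal ltd.
  have usj : us`_j = d by rewrite nth_index.
  have usl (l : 'I_(size us)) : us`_l != 0 by apply: (allP us0); rewrite mem_nth.
  have ku (l : 'I_(size us)) : pole_den Q (us`_j * us`_l) != 0.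
    by apply: (node_squares_pole_den us0 uN); rewrite ?usj // mem_nth.
  have num0 y : y != 0 -> border_num Q (size us) us c y = 0.
    by move=> y0; apply: (border_num_vanish Q0 _ y0 usl ku); rewrite usj.
  have sg0 : \prod_(e <- us) sigma (c / e) = 0.
    rewrite (big_rem d) //= (_ : sigma (c / d) = 0) ?mul0r //.
    apply: sigma_sqr_eq1; rewrite exprMn c2 -exprMn mulfV ?expr1n //.
  apply: (double_root charF c0 (bilaurent_det_defect Q0 p0 us0) (d := 4 * size us + 5)).
  + by move=> y y0; rewrite num0 // big_split /= sg0 !(mul0r, mulr0) subr0.
  + by move=> x x0; rewrite border_num_sym num0 // big_split /= sg0 !(mul0r, mulr0) subr0.
  + by move=> x x0; rewrite SE.
have sumnE (k : nat) (s : seq F) : sumn (map snd [seq (c, k) | c <- s]) = (k * size s)%N.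
  by elim: s => /= [|a s ->]; rewrite ?muln0 // mulnS.
apply: leq_trans szS _; rewrite /rt (map_cat snd) sumn_cat !sumnE !size_cat !size_map !size_cat
  !size_map /=.
by lia.
Qed.

(** The induction: every hypothesis of the interpolation is an instance of
    the formula with fewer parameters. *)
Theorem det_formula_sqrtN1 (us : seq F) : all (predC1 0) us -> uniq (node_squares us) ->
  det_formula Q p us.
Proof.
elim: {us}(size us) {-2}us (leqnn (size us)) => [|n IH] [|u us] // sz us0 uN.
  by rewrite /det_formula /Zup /= /boundary_prod /pole_prod_all !big_nil det_mx00 !mulr1.
  by rewrite /det_formula /Zup /= /boundary_prod /pole_prod_all !big_nil det_mx00 !mulr1.
move: us0 => /= /andP[u0 us0]; rewrite ltnS in sz.
have sub (vs : seq F) : subseq vs us -> det_formula Q p vs.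
  move=> sv; apply: IH; first exact: leq_trans (size_subseq sv) sz.
    by apply/allP => x /(mem_subseq sv); exact: (allP us0).
  by apply: node_squares_subseq uN; apply: subseq_trans sv (subseq_cons _ _).
have uN' : uniq (node_squares us) by apply: node_squares_subseq uN; exact: subseq_cons.
have : det_defect Q p us u = 0.
  apply: det_defect_eq0 => //; last exact: sub.
  by move=> s1 v s2 e; apply: sub; rewrite e cat_subseq // subseq_cons.
have uus0 : all (predC1 0) (u :: us) by rewrite /= u0.
have usl (l : 'I_(size us)) : us`_l != 0 by apply: (allP us0); rewrite mem_nth.
move/eqP; rewrite subr_eq0 border_num_det //; last first.
- by move=> l; apply: (node_squares_pole_den uus0 uN); rewrite ?mem_head // inE mem_nth ?orbT.
- by apply: (node_squares_pole_den uus0 uN); rewrite mem_head.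
move=> /eqP e; rewrite /det_formula /= e pole_prodE pole_prod_all_cons /boundary_prod big_cons
  prodrXl; ring.
Qed.
End Induction.

(** * Summation edge by edge over a triangle *)

Section KeySums.
Variables (R : comNzRingType) (key : eqType).

Definition update (f : key -> bool) k b : key -> bool :=
  fun x => if x == k then b else f x.

Definition agree_off (s : seq key) (f g : key -> bool) :=
  forall k, k \notin s -> g k = f k.

(** The sum over the states of the edges listed in [s], the other edges
    keeping the state given by [f]. *)
Fixpoint ksum (s : seq key) (G : (key -> bool) -> R) (f : key -> bool) : R :=
  if s is k :: s' then \sum_(b : bool) ksum s' G (update f k b) else G f.

Lemma agree_update s f k b g : agree_off s (update f k b) g -> agree_off (k :: s) f g.
Proof.
by move=> ag x; rewrite inE negb_or => /andP[nk ns]; rewrite ag // /update (negPf nk).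
Qed.

Lemma agree_at s f k b g : k \notin s -> agree_off s (update f k b) g -> g k = b.
Proof. by move=> ns ag; rewrite ag // /update eqxx. Qed.

Lemma eq_ksum s G1 G2 f : (forall g, agree_off s f g -> G1 g = G2 g) ->
  ksum s G1 f = ksum s G2 f.
Proof.
elim: s f => [|k s IH] f H /=; first exact: H.
by apply: eq_bigr => b _; apply: IH => g ag; apply: H; apply: agree_update ag.
Qed.

Lemma ksumZ s c G f : ksum s (fun g => c * G g) f = c * ksum s G f.
Proof.
elim: s f => //= k s IH f; rewrite mulr_sumr.
by apply: eq_bigr => b _; apply: IH.
Qed.

(** A weight that depends only on edges whose state is already chosen can be
    taken out of the sum. *)
Lemma ksum_factor s (W : (key -> bool) -> R) G f :
    (forall g, agree_off s f g -> W g = W f) ->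
  ksum s (fun g => W g * G g) f = W f * ksum s G f.
Proof. by move=> H; rewrite -ksumZ; apply: eq_ksum => g /H ->. Qed.

Lemma ksum_cat s1 s2 G f : ksum (s1 ++ s2) G f = ksum s1 (ksum s2 G) f.
Proof. by elim: s1 f => //= k s1 IH f; apply: eq_bigr => b _. Qed.

Lemma ksum_all_true s (phi : seq bool -> R) f : uniq s ->
  ksum s (fun g => (all g s)%:R * phi (map g s)) f = phi (nseq (size s) true).
Proof.
elim: s phi f => [|k s IH] phi f /=; first by rewrite mul1r.
move=> /andP[nk us]; rewrite big_bool /=.
rewrite [X in _ + X](eq_ksum (G2 := fun _ => 0 * 0)); last first.
  by move=> g ag; rewrite (agree_at nk ag) /= !mul0r.
rewrite ksumZ mul0r addr0 -(IH (fun s => phi (true :: s)) (update f k true) us).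
by apply: eq_ksum => g ag; rewrite (agree_at nk ag).
Qed.
End KeySums.

Section Rows.
Variables (F : fieldType) (Q p : F) (U : nat -> F) (n : nat).
Local Notation key := (bool * nat * nat)%type.
Local Notation v i j := ((true, i, j) : key).
Local Notation h i j := ((false, i, j) : key).

(** The line through column j is the one that starts or ends there. *)
Definition col i := U (minn i (2 * n + 2 - i)).

Definition bulk_at i (f : key -> bool) j :=
  bulk_wt Q (U i * col j) (f (v i j)) (f (v i.+1 j)) (f (h i j.-1)) (f (h i j)).

(** The order of the edges in the lists is the order of summation in
    [row_sum]: in each column the edge below, then the edge to the right. *)
Definition col_keys i j0 m : seq key :=
  flatten [seq [:: v i.+1 j; h i j] | j <- iota j0 m].

Definition row_keys i m := h i i :: col_keys i i.+1 m.*2.+1.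

Fixpoint tri_keys i m : seq key :=
  if m is m'.+1 then row_keys i m' ++ tri_keys i.+1 m' else [::].

Definition row_weight i m (f : key -> bool) : F :=
  left_wt Q p (U i) (f (v i i)) (f (h i i))
  * (\prod_(j <- iota i.+1 m.*2.+1) bulk_at i f j)
  * right_wt Q p (U i) (f (v i (i + m.*2.+2)%N)) (f (h i (i + m.*2.+1)%N)).

(** The weight of rows i to i + m - 1; the last factor keeps the states whose
    bottom edge points up. *)
Fixpoint tri_weight i m (f : key -> bool) : F :=
  if m is m'.+1 then row_weight i m' f * tri_weight i.+1 m' f else (f (v i i))%:R.

Lemma mem_col_keys i j0 m (d : bool) a b : ((d, a, b) \in col_keys i j0 m)
  = (a == if d then i.+1 else i) && (j0 <= b < j0 + m)%N.
Proof.
apply/flattenP/idP => [[_ /mapP[j + ->]]|/andP[/eqP -> bm]].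
  rewrite mem_iota !inE => jm /orP[] /eqP[-> -> ->]; by rewrite eqxx.
exists [:: v i.+1 b; h i b]; first by apply/mapP; exists b; rewrite ?mem_iota.
by case: d; rewrite !inE eqxx ?orbT.
Qed.

Lemma tri_keysS i m : tri_keys i m.+1 = h i i :: col_keys i i.+1 m.*2.+1 ++ tri_keys i.+1 m.
Proof. by []. Qed.

Lemma tri_keys_row i m (d : bool) a b : (d, a, b) \in tri_keys i m ->
  (if d then i < a else i <= a)%N.
Proof.
elim: m i => [//|m IH] i; rewrite tri_keysS in_cons mem_cat mem_col_keys.
case/or3P => [/eqP[-> -> _]//|/andP[/eqP -> _]|/IH]; first by case: (d).
by case: (d); lia.
Qed.

(** The edges of [rest] belong to later rows, so the weights of the present
    row are constant in the inner sums. *)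
Lemma ksum_row i j0 m rest K k f : (0 < j0)%N ->
    (forall d a b, (d, a, b) \in rest -> (if d then i.+1 < a else i < a)%N) ->
    (forall g, agree_off (col_keys i j0 m) f g ->
       ksum rest K g = k [seq g (v i.+1 j) | j <- iota j0 m] (g (h i (j0 + m).-1))) ->
  ksum (col_keys i j0 m ++ rest)
    (fun g => (\prod_(j <- iota j0 m) bulk_at i g j) * K g) f
  = row_sum Q (U i) [seq col j | j <- iota j0 m] (f (h i j0.-1))
      [seq f (v i j) | j <- iota j0 m] k.
Proof.
elim: m j0 k f => [|m IH] j0 k f j00 Hrest Hk /=.
  rewrite -[j0.-1](congr1 predn (addn0 j0)) -Hk //.
  by apply: eq_ksum => g _; rewrite big_nil mul1r.
apply: eq_bigr => b _; apply: eq_bigr => g _.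
set f1 := update _ _ g.
have n1 : h i j0 \notin col_keys i j0.+1 m ++ rest.
  rewrite mem_cat mem_col_keys ltnn andbF /=.
  by apply/negP => /Hrest; rewrite ltnn.
have n2 : v i.+1 j0 \notin col_keys i j0.+1 m ++ rest.
  rewrite mem_cat mem_col_keys ltnn andbF /=.
  by apply/negP => /Hrest; rewrite ltnn.
have n3 : v i j0 \notin col_keys i j0.+1 m ++ rest.
  rewrite mem_cat mem_col_keys ltnn andbF /=.
  by apply/negP => /Hrest; lia.
have n4 : h i j0.-1 \notin col_keys i j0.+1 m ++ rest.
  rewrite mem_cat mem_col_keys ltnNge (leq_trans (leq_pred _)) // andbF /=.
  by apply/negP => /Hrest; lia.
have f1h : f1 (h i j0) = g by rewrite /f1 /update eqxx.
have f1v : f1 (v i.+1 j0) = b by rewrite /f1 /update /= eqxx.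
have f1o (d : bool) a c : (d, a, c) != h i j0 -> (d, a, c) != v i.+1 j0 -> f1 (d, a, c) = f (d,
  a, c).
  by move=> e1 e2; rewrite /f1 /update (negPf e1) (negPf e2).
transitivity (ksum (col_keys i j0.+1 m ++ rest)
   (fun g => bulk_at i g j0 * ((\prod_(j <- iota j0.+1 m) bulk_at i g j) * K g)) f1).
  by apply: eq_ksum => g' _; rewrite big_cons mulrA.
rewrite ksum_factor; last by move=> g' ag; rewrite /bulk_at !ag.
congr (_ * _).
  rewrite /bulk_at f1h f1v !f1o //; try by rewrite !xpair_eqE ?eqxx /=; lia.
rewrite (IH j0.+1 (fun bs => k (b :: bs))) //.
- rewrite f1h; congr row_sum; apply/eq_in_map => j; rewrite mem_iota => jm.
  by rewrite f1o // !xpair_eqE /=; lia.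
- move=> g' ag; rewrite Hk /=.
    congr (k (_ :: _) (g' (h i _))); last by lia.
    by rewrite ag ?f1v //; move: n2; rewrite mem_cat negb_or => /andP[].
  move=> x; rewrite !inE !negb_or => /and3P[x1 x2 x3]; rewrite ag //.
  by rewrite /f1 /update (negPf x1) (negPf x2).
Qed.

Lemma col_list i m : (i + m.+1)%N = n.+1 ->
  [seq col j | j <- iota i.+1 m.*2.+1]
  = map U (iota i.+1 m) ++ U n.+1 :: rev (map U (iota i.+1 m)).
Proof.
move=> im; have -> : m.*2.+1 = (m + (1 + m))%N by lia.
rewrite !iotaD !map_cat /=; congr (_ ++ _ :: _).
- apply/eq_in_map => j; rewrite mem_iota => jm; rewrite /col; congr U; lia.
- by rewrite /col; congr U; lia.
apply: (@eq_from_nth _ (U 0)) => [|k]; rewrite ?size_rev !size_map !size_iota // => km.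
rewrite nth_rev ?size_map ?size_iota // !(nth_map 0%N) ?size_iota //; last by lia.
by rewrite !nth_iota //; last (by lia); rewrite /col; congr U; lia.
Qed.

Lemma ksum_tri i m f : (0 < i)%N -> (i + m)%N = n.+1 ->
  ksum (tri_keys i m) (tri_weight i m) f
  = partition_fun Q p (U n.+1) (map U (iota i m)) [seq f (v i j) | j <- iota i m.*2.+1].
Proof.
elim: m i f => [//|m IH] i f i0 im.
set rest := tri_keys i.+1 m.
rewrite -[LHS]/(\sum_(b : bool) ksum (col_keys i i.+1 m.*2.+1 ++ rest)
  (tri_weight i m.+1) (update f (h i i) b)).
have Hrest d a b : (d, a, b) \in rest -> (if d then i.+1 < a else i < a)%N.
  exact: tri_keys_row.
set T := [seq f (v i j) | j <- iota i.+1 m.*2.+1].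
have -> : [seq f (v i j) | j <- iota i m.+1.*2.+1] = f (v i i) :: T ++ [:: f (v i (i + m.*2.+2)%N)].
  rewrite (_ : m.+1.*2.+1 = m.*2.+1.+1 + 1)%N; last by lia.
  by rewrite iotaD map_cat.
rewrite [RHS]/= last_cat [last _ [:: _]]/= -(col_list im).
apply: eq_bigr => b _; set f1 := update f _ b.
have f1h : f1 (h i i) = b by rewrite /f1 /update eqxx.
have f1v a c : f1 (v a c) = f (v a c) by [].
pose K g := right_wt Q p (U i) (g (v i (i + m.*2.+2)%N)) (g (h i (i + m.*2.+1)%N)) * tri_weight
  i.+1 m g.
transitivity (ksum (col_keys i i.+1 m.*2.+1 ++ rest) (fun g =>
   left_wt Q p (U i) (g (v i i)) (g (h i i))
    * ((\prod_(j <- iota i.+1 m.*2.+1) bulk_at i g j) * K g)) f1).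
  by apply: eq_ksum => g _; rewrite /= /row_weight /K !mulrA.
rewrite ksum_factor; last first.
  by move=> g ag; rewrite !ag // mem_cat mem_col_keys ?ltnn ?andbF /=;
    apply/negP => /Hrest; lia.
rewrite f1h f1v; congr (_ * _).
rewrite (@ksum_row i i.+1 m.*2.+1 rest K (fun bs g => right_wt Q p (U i) (f (v i (i + m.*2.+2)%N)) g
   * partition_fun Q p (U n.+1) (map U (iota i.+1 m)) bs)) // => [|g ag].
  rewrite f1h -[X in _ = row_sum _ _ _ _ X _]/(T ++ [:: f (v i (i + m.*2.+2)%N)]).
  by rewrite row_sum_excess // /T !size_map !size_iota.
have agf : agree_off (h i i :: col_keys i i.+1 m.*2.+1) f g by apply: agree_update ag.
have Rg g' : agree_off rest g g' -> right_wt Q p (U i) (g' (v i (i + m.*2.+2)%N)) (g' (h i (i +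
  m.*2.+1)%N))
    = right_wt Q p (U i) (g (v i (i + m.*2.+2)%N)) (g (h i (i + m.*2.+1)%N)).
  by move=> ag'; rewrite !ag' //; apply/negP => /Hrest; lia.
rewrite ksum_factor // IH //; last by lia.
congr (right_wt _ _ _ _ _ * _).
by rewrite agf // inE mem_col_keys ltn_eqF.
Qed.
End Rows.

(** * Orientations as sets of positive arcs *)

Section SubsetSum.
Variables (R : comNzRingType) (key : eqType) (T : finType) (arc : key -> T).

Definition arc_set (s : seq key) (f : key -> bool) : {set T} :=
  [set:: map arc (filter f s)].

(** Deciding on membership of the arcs one at a time. *)
Lemma sum_subset_ksum (s : seq key) (G : {set T} -> R) f0 : uniq (map arc s) ->
  \sum_(B : {set T} | B \subset [set:: map arc s]) G B
  = ksum s (fun f => G (arc_set s f)) f0.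
Proof.
elim: s G f0 => [|k s IH] G f0 /=.
  move=> _; rewrite (eq_bigl (pred1 set0)) ?big_pred1_eq //.
  by move=> B; rewrite /= set_nil subset0.
move=> /andP[nk us]; have us' := map_uniq us.
have ks : k \notin s by apply: contra nk; apply: map_f.
have nk' : arc k \notin [set:: map arc s] by rewrite inE.
have off (B : {set T}) : B \subset [set:: map arc s] -> arc k \notin B.
  by move=> sB; apply: contra nk' => /(subsetP sB).
rewrite (bigID (fun B : {set T} => arc k \in B)) /= big_bool /=; congr (_ + _).
  rewrite (reindex_onto (fun B => arc k |: B) (fun B => B :\ arc k)) /=; last first.
    by move=> B /andP[_ kB]; rewrite setD1K.
  transitivity (\sum_(B : {set T} | B \subset [set:: map arc s]) G (arc k |: B)).
    apply: eq_bigl => B; rewrite set_cons setU11 andbT.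
    apply/andP/idP => [[sB /eqP <-]|sB].
      by rewrite subDset.
    by split; [rewrite setUS | rewrite setU1K // off].
  rewrite (IH _ (update f0 k true)) //; apply: eq_ksum => g ag.
  by congr G; rewrite /arc_set /= (agree_at ks ag) /= set_cons.
transitivity (\sum_(B : {set T} | B \subset [set:: map arc s]) G B).
  apply: eq_bigl => B; rewrite set_cons; apply/andP/idP => [[sB kB]|sB].
    by rewrite -(setU1K nk') subsetD1 sB kB.
  by split; [apply: subset_trans sB (subsetUr _ _)| exact: off].
rewrite (IH _ (update f0 k false)) //; apply: eq_ksum => g ag.
by congr G; rewrite /arc_set /= (agree_at ks ag).
Qed.
End SubsetSum.

Section Graph.
Variable n : nat.
Local Notation key := (bool * nat * nat)%type.
Local Notation v i j := ((true, i, j) : key).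
Local Notation h i j := ((false, i, j) : key).
Local Notation node := (node n).
Local Notation pt := (pt n).

(** The edge [(true, i, j)] is the vertical one between rows i - 1 and i in
    column j, directed upwards; [(false, i, j)] is the horizontal one to the
    right of (i, j), directed to the right. *)
Definition arc (k : key) : node * node :=
  let: (d, i, j) := k in
  if d then (pt i j, pt i.-1 j) else (pt i j, pt i j.+1).

Definition in_range (k : key) : bool :=
  let: (d, i, j) := k in
  if d then ((1 <= i <= n.+1) && (i <= j <= 2 * n + 2 - i))%N
  else ((1 <= i <= n) && (i <= j < 2 * n + 2 - i))%N.

Definition top_keys : seq key := [seq v 1%N j | j <- iota 1 n.*2.+1].
Definition all_keys : seq key := top_keys ++ tri_keys 1 n.

Lemma mem_tri_keys i m d a b : ((d, a, b) \in tri_keys i m) =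
  if d then (i < a <= i + m)%N && (a <= b <= a + (i + m - a).*2)%N
  else (i <= a < i + m)%N && (a <= b < a + (i + m - a).*2)%N.
Proof.
elim: m i => [|m IH] i.
  by rewrite in_nil; case: d; lia.
rewrite tri_keysS in_cons mem_cat mem_col_keys IH.
have -> : ((d, a, b) == h i i) = ~~ d && (a == i) && (b == i).
  by rewrite !xpair_eqE eqbF_neg.
by clear IH; case: d => /=; lia.
Qed.

Lemma mem_all_keys k : (k \in all_keys) = in_range k.
Proof.
case: k => [[d a] b]; rewrite mem_cat mem_tri_keys /in_range.
have -> : ((d, a, b) \in top_keys) = [&& d, a == 1%N & (1 <= b <= n.*2.+1)%N].
  apply/mapP/and3P => [[j + [-> -> ->]]|[-> /eqP -> bn]].
    by rewrite mem_iota; split; lia.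
  by exists b; rewrite // mem_iota; lia.
by case: d => /=; lia.
Qed.

Lemma pt1 i j : (i <= n.+1)%N -> (pt i j).1 = i :> nat.
Proof. by move=> le; rewrite /= inordK. Qed.

Lemma pt2 i j : (j <= 2 * n + 1)%N -> (pt i j).2 = j :> nat.
Proof. by move=> le; rewrite /= inordK //; lia. Qed.

Lemma pt_eta (x : node) : x = pt x.1 x.2.
Proof. by case: x => i j; rewrite /pt /= !inord_val. Qed.

Lemma pt_inj i j i' j' : (i <= n.+1)%N -> (i' <= n.+1)%N ->
  (j <= 2 * n + 1)%N -> (j' <= 2 * n + 1)%N -> pt i j = pt i' j' -> i = i' /\ j = j'.
Proof.
move=> hi hi' hj hj' e; split.
  by rewrite -(pt1 j hi) e pt1.
by rewrite -(pt2 i hj) e pt2.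
Qed.

Lemma arc_inj : {in in_range &, injective arc}.
Proof.
move=> [[d i] j] [[d' i'] j']; rewrite !unfold_in /=.
move=> r r' e.
have e1 : pt i j = pt i' j' by move: (congr1 fst e); rewrite /=; case: (d); case: (d').
have [||||ei ej] := pt_inj _ _ _ _ e1; try by (case: (d) r; case: (d') r'; lia).
subst i' j'; case: d d' r r' e {e1} => [] [] // r r' e.
- have [||||]:= pt_inj _ _ _ _ (congr1 snd e : pt i.-1 j = pt i j.+1); lia.
- have [||||]:= pt_inj _ _ _ _ (congr1 snd e : pt i j.+1 = pt i.-1 j); lia.
Qed.

Definition pos_arcs : {set node * node} := [set:: map arc all_keys].

Lemma is_vertex_pt i j : (i <= n.+1)%N -> (j <= 2 * n + 1)%N ->
  is_vertex (pt i j) = [|| (i == 0)%N && (1 <= j <= 2 * n + 1)%N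
    | (1 <= i <= n + 1)%N && (i <= j <= 2 * n + 2 - i)%N].
Proof. by move=> hi hj; rewrite /is_vertex pt1 // pt2. Qed.

Lemma mem_pos_arcs x y : ((x, y) \in pos_arcs) = vedge y x || hedge x y.
Proof.
rewrite inE; apply/mapP/idP => [[[[d i] j]]|].
  rewrite mem_all_keys; case: d => r e; apply/orP; [left|right].
    have [-> ->] : x = pt i j /\ y = pt i.-1 j by split;
      [move: (congr1 fst e)|move: (congr1 snd e)].
    rewrite /in_range in r; rewrite /vedge !is_vertex_pt ?pt1 ?eqxx; lia.
  have [-> ->] : x = pt i j /\ y = pt i j.+1 by split; [move: (congr1 fst e)|move: (congr1 snd e)].
  by rewrite /in_range in r; rewrite /hedge !is_vertex_pt ?pt1 ?pt2 ?eqxx; lia.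
have lt1 (z : node) := ltn_ord z.1; have lt2 (z : node) := ltn_ord z.2.
case/orP.
  rewrite /vedge /is_vertex => /and4P[vy vx /eqP e1 /eqP e2].
  exists (v (x.1 : nat) (x.2 : nat)) => /=.
    rewrite mem_all_keys /=; move: vx vy (lt1 x) (lt2 x);
      rewrite e2 e1. move: (nat_of_ord y.1) (nat_of_ord x.2) => a b; lia.
  have ey : y = pt x.1.-1 x.2 by rewrite e1 /= -e2 -pt_eta.
  by rewrite -ey -pt_eta.
rewrite /hedge /is_vertex => /and5P[vx vy /eqP e1 x1 /eqP e2].
exists (h (x.1 : nat) (x.2 : nat)) => /=.
  rewrite mem_all_keys /=; move: vx vy x1 (lt1 x) (lt2 x); rewrite -e1 e2.
  move: (nat_of_ord x.1) (nat_of_ord x.2) => a b; lia.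
have ey : y = pt x.1 x.2.+1 by rewrite -e2 e1 -pt_eta.
by rewrite -ey -pt_eta.
Qed.

Lemma adjE x y : adj x y = ((x, y) \in pos_arcs) || ((y, x) \in pos_arcs).
Proof.
by rewrite !mem_pos_arcs /adj; do !case: (vedge _ _); do !case: (hedge _ _).
Qed.

Lemma pos_arcs_asym x y : (x, y) \in pos_arcs -> (y, x) \notin pos_arcs.
Proof.
rewrite !mem_pos_arcs /vedge /hedge negb_or => H; apply/andP; split; apply/negP => H'.
  case/and4P: H' => _ _ /eqP e1 _; case/orP: H => [/and4P[_ _ /eqP e _]|/and5P[_ _ /eqP e _ _]].
    by move: e1; rewrite e; lia.
  by move: e1; rewrite e; lia.
case/and5P: H' => _ _ /eqP e1 _ /eqP e2;
  case/orP: H => [/and4P[_ _ /eqP e _]|/and5P[_ _ _ _ /eqP e]].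
  by move: e; rewrite e1; lia.
by move: e; rewrite e2; lia.
Qed.

Definition rev_arc (a : node * node) := (a.2, a.1).

(** The orientation whose upward and rightward arcs are those of [B]. *)
Definition orient (B : {set node * node}) : {set node * node} :=
  B :|: [set a | rev_arc a \in pos_arcs :\: B].

Lemma mem_orient_pos (B : {set node * node}) x y : (x, y) \in pos_arcs -> ((x, y) \in orient B) =
  ((x, y) \in B).
Proof.
move=> /pos_arcs_asym /negPf nE.
by rewrite in_setU inE in_setD nE andbF orbF.
Qed.

Lemma mem_orient_neg (B : {set node * node}) x y : B \subset pos_arcs -> (x, y) \in pos_arcs ->
  ((y, x) \in orient B) = ((x, y) \notin B).
Proof.
move=> sB xy; have nyx : (y, x) \notin B by apply: contra (pos_arcs_asym xy); apply: (subsetP sB).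
by rewrite in_setU (negPf nyx) inE in_setD xy andbT.
Qed.

Lemma orient_orientation (B : {set node * node}) : B \subset pos_arcs -> is_orientation (orient B).
Proof.
move=> sB; apply/forallP => x; apply/forallP => y; rewrite adjE.
have [xy|nxy] := boolP ((x, y) \in pos_arcs).
  by rewrite /= mem_orient_pos // mem_orient_neg //; case: (_ \in B).
have [yx|nyx] /= := boolP ((y, x) \in pos_arcs).
  by rewrite (mem_orient_neg sB yx) (mem_orient_pos _ yx); case: (_ \in B).
rewrite in_setU negb_or inE in_setD (negPf nyx) andbF andbT.
by apply: contra nxy; apply: (subsetP sB).
Qed.

Lemma orientK (B : {set node * node}) : B \subset pos_arcs -> orient B :&: pos_arcs = B.
Proof.
move=> sB; apply/setP => -[x y]; rewrite in_setI.
have [xy|nxy] := boolP ((x, y) \in pos_arcs); first by rewrite andbT mem_orient_pos.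
by rewrite andbF; apply/esym/negbTE; apply: contra nxy; apply: (subsetP sB).
Qed.

Lemma orient_of (A : {set node * node}) : is_orientation A -> orient (A :&: pos_arcs) = A.
Proof.
move=> /forallP oA; apply/setP => -[x y].
have /forallP/(_ y) := oA x; have /forallP/(_ x) := oA y; rewrite !adjE.
have [xy|nxy] := boolP ((x, y) \in pos_arcs).
  by rewrite mem_orient_pos // in_setI xy andbT.
have [yx|nyx] /= := boolP ((y, x) \in pos_arcs).
  rewrite (mem_orient_neg _ yx) ?subsetIr // in_setI yx andbT => _.
  by case: (_ \in A); case: (_ \in A).
move=> _ /negPf ->; rewrite in_setU in_setI (negPf nxy) andbF /=.
by rewrite inE in_setD (negPf nyx) andbF.
Qed.

(** An orientation is determined by its arcs that point up or right, and these
    form an arbitrary set. *)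
Lemma sum_orientations (R : nmodType) (C : pred {set node * node}) (f : {set node * node} -> R) :
  \sum_(A | is_orientation A && C A) f A
  = \sum_(B : {set node * node} | B \subset pos_arcs) (if C (orient B) then f (orient B) else 0).
Proof.
rewrite big_mkcondr /= (reindex_onto orient (fun A => A :&: pos_arcs)) /=; last exact: orient_of.
apply: eq_bigl => B; apply/andP/idP => [[_ /eqP <-]|sB]; first exact: subsetIr.
by rewrite orient_orientation // orientK.
Qed.
End Graph.

(** * From configurations to row sums *)

Section Weights.
Variables (F : fieldType) (n : nat) (p q w : F) (u : 'I_n -> F).
Hypotheses (s2 : sigma (q ^+ 2) != 0) (s4 : sigma (q ^+ 4) != 0).
Local Notation key := (bool * nat * nat)%type.
Local Notation v i j := ((true, i, j) : key).
Local Notation h i j := ((false, i, j) : key).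
Local Notation node := (node n).
Local Notation pt := (pt n).
Local Notation U := (param u w).
Local Notation Q := (q ^+ 2).

Lemma arc_in k : in_range n k -> arc n k \in pos_arcs n.
Proof. by move=> r; rewrite inE map_f // mem_all_keys. Qed.

Lemma arc_set_sub f : arc_set (arc n) (all_keys n) f \subset pos_arcs n.
Proof.
apply/subsetP => a; rewrite inE => /mapP[k]; rewrite mem_filter => /andP[_ kin] ->.
by apply: arc_in; rewrite -mem_all_keys.
Qed.

Lemma orient_arc f k : in_range n k ->
  (arc n k \in orient (arc_set (arc n) (all_keys n) f)) = f k.
Proof.
move=> r; have := arc_in r; case e: (arc n k) => [x y] xy.
rewrite mem_orient_pos // -e inE; apply/mapP/idP => [[k']|fk].
  rewrite mem_filter mem_all_keys => /andP[fk' r'] /arc_inj e'.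
  by rewrite e'.
by exists k => //; rewrite mem_filter fk mem_all_keys.
Qed.

Lemma orient_rev_arc f k x y : in_range n k -> arc n k = (y, x) ->
  ((x, y) \in orient (arc_set (arc n) (all_keys n) f)) = ~~ f k.
Proof.
move=> r e; rewrite mem_orient_neg ?arc_set_sub //; last by rewrite -e arc_in.
by rewrite -(orient_arc f r) e mem_orient_pos // -e arc_in.
Qed.

Definition neighbours i j := [:: pt i.-1 j; pt i.+1 j; pt i j.-1; pt i j.+1].

Lemma neighbours_uniq i j : (1 <= i <= n)%N -> (1 <= j <= 2 * n)%N ->
  uniq (neighbours i j).
Proof.
move=> ri rj.
have neq a b c d : (a <= n.+1)%N -> (c <= n.+1)%N -> (b <= 2 * n + 1)%N -> (d <= 2 * n + 1)%N ->
   (a != c) || (b != d) -> pt a b != pt c d.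
  move=> ha hc hb hd ne; apply/eqP => /pt_inj[||||ea eb] //.
  by move: ne; rewrite ea eb !eqxx.
by rewrite /= !inE !negb_or !neq //; lia.
Qed.

Lemma pos_arcsP a b : (a, b) \in pos_arcs n -> exists2 k, in_range n k & arc n k = (a, b).
Proof. by rewrite in_set => /mapP[k]; rewrite mem_all_keys; exists k. Qed.

Lemma adj_neighbours i j y : (1 <= i <= n)%N -> (i < j < 2 * n + 2 - i)%N ->
  adj (pt i j) y = (y \in neighbours i j).
Proof.
move=> ri rj; have [hi hj] : (i <= n.+1 /\ j <= 2 * n + 1)%N by lia.
rewrite !in_cons in_nil orbF adjE; apply/orP/or4P => [[]|].
- move=> /pos_arcsP[[[[] a] b] r e].
    have [ha hb] : (a <= n.+1 /\ b <= 2 * n + 1)%N by clear -r; move: r; rewrite /in_range; lia.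
    have e1 : pt a b = pt i j := congr1 fst e.
    have [ea eb] := pt_inj ha hi hb hj e1.
    by apply: Or41; rewrite -ea -eb; apply/eqP; rewrite -[y]/((pt i j, y).2) -e.
  have [ha hb] : (a <= n.+1 /\ b <= 2 * n + 1)%N by clear -r; move: r; rewrite /in_range; lia.
  have e1 : pt a b = pt i j := congr1 fst e.
  have [ea eb] := pt_inj ha hi hb hj e1.
  by apply: Or44; rewrite -ea -eb; apply/eqP; rewrite -[y]/((pt i j, y).2) -e.
- move=> /pos_arcsP[[[[] a] b] r e].
    have [ha hb] : (0 < a <= n.+1 /\ b <= 2 * n + 1)%N by clear -r; move: r; rewrite /in_range; lia.
    have ha' : (a.-1 <= n.+1)%N by clear -ha; lia.
    have e1 : pt a.-1 b = pt i j := congr1 snd e.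
    have [ea eb] := pt_inj ha' hi hb hj e1.
    apply: Or42; rewrite -ea -eb prednK; last by case/andP: ha.
    by apply/eqP; rewrite -[y]/((y, pt i j).1) -e.
  have [ha hb] : (a <= n.+1 /\ b.+1 <= 2 * n + 1)%N by clear -r; move: r; rewrite /in_range; lia.
  have e1 : pt a b.+1 = pt i j := congr1 snd e.
  have [ea eb] := pt_inj ha hi hb hj e1.
  by apply: Or43; rewrite -ea -eb; apply/eqP; rewrite -[y]/((y, pt i j).1) -e.
case=> /eqP ->.
- by left; apply: (@arc_in (v i j)); rewrite /in_range; lia.
- by right; apply: (@arc_in (v i.+1 j)); rewrite /in_range; lia.
- right; rewrite -[X in (_, pt i X)](ltn_predK (m := 0)); last by clear -rj; lia.
  by apply: (@arc_in (h i j.-1)); rewrite /in_range; lia.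
- by left; apply: (@arc_in (h i j)); rewrite /in_range; lia.
Qed.

(** [bulk_weight] is zero unless two of the four edges are outgoing, and
    then the other two are incoming. *)
Lemma bulk_ice (A : {set node * node}) i j (z : F) : is_orientation A ->
    (1 <= i <= n)%N -> (i < j < 2 * n + 2 - i)%N ->
    let out i' j' := (pt i j, pt i' j') \in A in
    bulk_weight q z (out i.-1 j) (out i.+1 j) (out i j.-1) (out i j.+1) != 0 ->
  (#|[set y | (y, pt i j) \in A]| == 2%N) && (#|[set y | (pt i j, y) \in A]| == 2%N).
Proof.
move=> oA ri rj out; set x := pt i j; set s := neighbours i j.
have us : uniq s by apply: neighbours_uniq => //; lia.
have adjs y : adj x y = (y \in s) by apply: adj_neighbours.
have adjC y : adj x y = adj y x by rewrite !adjE orbC.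
have outE y : y \notin s -> ((x, y) \in A = false) /\ ((y, x) \in A = false).
  rewrite -adjs => nadj; split; apply/negbTE.
    by move: (forallP oA x) => /forallP/(_ y); rewrite (negPf nadj).
  by move: (forallP oA y) => /forallP/(_ x); rewrite -adjC (negPf nadj).
have card (P : pred node) : (forall y, P y -> y \in s) -> #|[set y | P y]| = count P s.
  move=> Ps; rewrite -size_filter -(card_uniqP _) ?filter_uniq //.
  apply: eq_card => y; rewrite inE mem_filter.
  by case Py: (P y) => //=; rewrite Ps.
have sO y : (x, y) \in A -> y \in s.
  by move=> xy; apply: contraT => /outE[]; rewrite xy.
have sI y : (y, x) \in A -> y \in s.
  by move=> xy; apply: contraT => /outE[_]; rewrite xy.
rewrite (card _ sO) (card (fun y => (y, x) \in A) sI).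
have -> : count (fun y => (y, x) \in A) s = count (fun y => ~~ ((x, y) \in A)) s.
  apply: eq_in_count => y; rewrite -adjs => ady.
  move: (forallP oA x) => /forallP/(_ y); rewrite ady.
  by case: (_ \in A); case: (_ \in A).
rewrite /s /neighbours /= -/(out i.-1 j) -/(out i.+1 j) -/(out i j.-1) -/(out i j.+1).
by case: (out i.-1 j) (out i.+1 j) (out i j.-1) (out i j.+1) => [] [] [] []; rewrite /= ?eqxx.
Qed.

Lemma bulk_weightE z t b h g :
  bulk_weight q z t (~~ b) (~~ h) g = bulk_wt Q z t b h g / sigma (q ^+ 4).
Proof.
by case: t b h g => [] [] [] []; rewrite /= ?mul0r // -?exprM ?divff.
Qed.

Lemma left_weightE z t h : left_weight p q z t h = left_wt Q p z t h / sigma Q.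
Proof. by case: t h => [] []; rewrite /= ?mul0r. Qed.

Lemma right_weightE z t g : right_weight p q z t (~~ g) = right_wt Q p z t g / sigma Q.
Proof. by case: t g => [] []; rewrite /right_wt /= ?mul0r ?invrK. Qed.

Definition orientation_of (f : key -> bool) := orient (arc_set (arc n) (all_keys n) f).

Lemma tri_weightE i m f :
  tri_weight Q p U n i m f =
  (\prod_(k <- iota i m) row_weight Q p U n k (i + m - k.+1) f) * (f (v (i + m)%N (i + m)%N))%:R.
Proof.
elim: m i => [|m IH] i /=; first by rewrite big_nil mul1r addn0.
by rewrite IH big_cons mulrA addnS addSn subSS addKn.
Qed.

(** Row k of n has 2(n - k) + 1 bulk vertices, and these odd numbers add up
    to n^2. *)
Lemma prod_row_norm (x y : F) i m :
  \prod_(k <- iota i m) (x ^+ 2 * y ^+ (i + m - k.+1).*2.+1) = x ^+ (2 * m) * y ^+ (m ^ 2).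
Proof.
elim: m i => [|m IH] i /=; first by rewrite big_nil mul1r.
rewrite big_cons addnS -addSn IH addSn subSS addKn mulrACA -!exprD.
by congr (_ ^+ _ * _ ^+ _); lia.
Qed.

Lemma prod_iota_div (x : nat -> F) c a m :
  \prod_(j <- iota a m) (x j / c) = (\prod_(j <- iota a m) x j) * c^-1 ^+ m.
Proof.
by rewrite big_split /= big_const_seq count_predT size_iota iter_mulr_1.
Qed.

Lemma row_of_config f i : (1 <= i <= n)%N ->
  let out i j i' j' := (pt i j, pt i' j') \in orientation_of f in
  (\prod_(i.+1 <= j < 2 * n + 2 - i)
     bulk_weight q (U i * U (minn j (2 * n + 2 - j)))
       (out i j i.-1 j) (out i j i.+1 j) (out i j i j.-1) (out i j i j.+1))
  * (left_weight p q (U i) (out i i i.-1 i) (out i i i i.+1)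
  * right_weight p q (U i) (out i (2 * n + 2 - i)%N i.-1 (2 * n + 2 - i)%N)
      (out i (2 * n + 2 - i)%N i (2 * n + 2 - i)%N.-1))
  = row_weight Q p U n i (1 + n - i.+1) f
    * ((sigma Q)^-1 ^+ 2 * (sigma (q ^+ 4))^-1 ^+ (1 + n - i.+1).*2.+1).
Proof.
move=> ri out.
have upE j : (i <= j <= 2 * n + 2 - i)%N -> out i j i.-1 j = f (v i j).
  by move=> rj; apply: (@orient_arc f (v i j)); rewrite /in_range; lia.
have downE j : (i < j < 2 * n + 2 - i)%N -> out i j i.+1 j = ~~ f (v i.+1 j).
  by move=> rj; apply: (@orient_rev_arc f (v i.+1 j)) => //; rewrite /in_range; lia.
have rightE j : (i <= j < 2 * n + 2 - i)%N -> out i j i j.+1 = f (h i j).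
  by move=> rj; apply: (@orient_arc f (h i j)); rewrite /in_range; lia.
have leftE j : (i < j <= 2 * n + 2 - i)%N -> out i j i j.-1 = ~~ f (h i j.-1).
  move=> rj; apply: (@orient_rev_arc f (h i j.-1)); first by rewrite /in_range; lia.
  by rewrite /arc prednK //; lia.
set m := (1 + n - i.+1)%N.
have em : index_iota i.+1 (2 * n + 2 - i) = iota i.+1 m.*2.+1.
  by rewrite /index_iota; congr iota; rewrite /m; lia.
have el : (2 * n + 2 - i = i + m.*2.+2)%N by rewrite /m; lia.
rewrite upE ?rightE ?leftE ?upE; try by lia.
rewrite left_weightE right_weightE em.
transitivity ((\prod_(j <- iota i.+1 m.*2.+1) (bulk_at Q U n i f j / sigma (q ^+ 4))) *
  (left_wt Q p (U i) (f (v i i)) (f (h i i)) / sigma Q *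
  (right_wt Q p (U i) (f (v i (2 * n + 2 - i)%N)) (f (h i (2 * n + 2 - i).-1)) / sigma Q))).
  congr (_ * _); apply: eq_big_seq => j; rewrite mem_iota => rj.
  by rewrite upE ?downE ?leftE ?rightE ?bulk_weightE //; lia.
have e1 : (i + m.*2.+2)%N.-1 = (i + m.*2.+1)%N by rewrite addnS.
rewrite prod_iota_div /row_weight el e1; ring.
Qed.

Lemma config_weightE f :
  config_weight p q u w (orientation_of f) * (f (v n.+1 n.+1))%:R
  = tri_weight Q p U n 1 n f / (sigma Q ^+ (2 * n) * sigma (q ^+ 4) ^+ (n ^ 2)).
Proof.
rewrite tri_weightE add1n [RHS]mulrAC; congr (_ * _).
rewrite invfM -!exprVn -(prod_row_norm _ _ 1 n) -big_split /= /config_weight.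
have -> : index_iota 1 n.+1 = iota 1 n by rewrite /index_iota subSS subn0.
rewrite -mulrA -!big_split /=; apply: eq_big_seq => i; rewrite mem_iota => ri.
by apply: row_of_config; lia.
Qed.

Lemma uniq_tri_keys i m : uniq (tri_keys i m).
Proof.
have uc a j k : uniq (col_keys a j k).
  elim: k j => [//|k IH] j.
  rewrite -[col_keys _ _ _]/(v a.+1 j :: h a j :: col_keys a j.+1 k) !cons_uniq IH.
  by rewrite in_cons !mem_col_keys !ltnn !andbF.
elim: m i => [//|m IH] i; rewrite tri_keysS cons_uniq cat_uniq uc IH andbT.
rewrite mem_cat mem_col_keys mem_tri_keys ltnn /= andbF /=.
apply/hasPn => -[[d a] b]; rewrite mem_col_keys mem_tri_keys; clear; case: d => /=; lia.
Qed.

Lemma uniq_top_keys : uniq (top_keys n).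
Proof. by rewrite map_inj_uniq ?iota_uniq // => a b []. Qed.

Lemma top_tri_disjoint k : k \in top_keys n -> k \notin tri_keys 1 n.
Proof.
move=> /mapP[j _ ->]; rewrite mem_tri_keys; lia.
Qed.

Lemma uniq_arcs : uniq (map (arc n) (all_keys n)).
Proof.
rewrite map_inj_in_uniq; last first.
  by move=> k k'; rewrite !mem_all_keys; apply: arc_inj.
rewrite cat_uniq uniq_top_keys uniq_tri_keys andbT /=.
by apply/hasPn => k kt; apply: contraL kt => /top_tri_disjoint.
Qed.

Definition tops_up (A : {set node * node}) : bool :=
  [forall x, forall y, vedge x y && (x.1 == 0%N :> nat) ==> ((y, x) \in A)].

Lemma tops_upE f : tops_up (orientation_of f) = all f (top_keys n).
Proof.
apply/forallP/allP => [H k kt|H x].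
  have [j rj kE] : exists2 j, (1 <= j <= 2 * n + 1)%N & k = v 1%N j.
    by case/mapP: kt => j; rewrite mem_iota => rj ->; exists j => //; lia.
  rewrite -(orient_arc f (k := k)); last by rewrite kE /in_range; lia.
  move: (H (pt 0 j)) => /forallP/(_ (pt 1 j)); rewrite kE => /implyP; apply.
  by rewrite /vedge !is_vertex_pt ?pt1 ?eqxx; lia.
apply/forallP => y; apply/implyP => /andP[vxy x0].
have : (y, x) \in pos_arcs n by rewrite mem_pos_arcs vxy.
case/pos_arcsP => -[[d a] b] r e.
rewrite -e orient_arc //; apply: H.
have := congr1 (fun c : node * node => c.2.1 : nat) e; rewrite (eqP x0).
move: r; rewrite /in_range; case: d {e} => r.
  rewrite -[LHS]/(((pt a.-1 b).1 : nat)) pt1; last by lia.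
  by move=> a1; apply/mapP; exists b; [rewrite mem_iota; lia|congr (_, _, _); lia].
by rewrite -[LHS]/(((pt a b.+1).1 : nat)) pt1; lia.
Qed.

(** Orientations that violate the condition at a bulk vertex have weight 0,
    so that condition may be dropped. *)
Lemma sum_configurations :
  Z_up_QAST p q u w = \sum_(A | is_orientation A &&
     (tops_up A && ((pt n.+1 n.+1, pt n n.+1) \in A))) config_weight p q u w A.
Proof.
rewrite /Z_up_QAST big_mkcond [RHS]big_mkcond; apply: eq_bigr => A _.
rewrite /is_configuration -/(tops_up A).
have [oA|//] := boolP (is_orientation A); rewrite /= -andbA.
have [_|] := boolP [forall x : node, is_bulk x ==> ((#|[set y | (y, x) \in A]| == 2%N)
  && (#|[set y | (x, y) \in A]| == 2%N))] => //=; rewrite negb_forall => /existsP[x].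
rewrite negb_imply => /andP[bx nice]; case: ifP => // _; apply/esym/eqP.
rewrite /config_weight !mulf_eq0; apply/orP; left; apply/orP; left.
move: bx; rewrite /is_bulk => /andP[ri rj].
rewrite prodf_seq_eq0; apply/hasP; exists (x.1 : nat); first by rewrite mem_index_iota; lia.
rewrite /= prodf_seq_eq0; apply/hasP; exists (x.2 : nat); first by rewrite mem_index_iota.
rewrite /=; apply: contraNT nice => nz; rewrite [x]pt_eta.
exact: (bulk_ice oA ri rj nz).
Qed.

(** The edges are summed row by row from the top, where all of them point up. *)
Lemma Z_up_QASTE :
  Z_up_QAST p q u w = Zup Q p w [seq u i | i <- enum 'I_n]
    / (sigma Q ^+ (2 * n) * sigma (q ^+ 4) ^+ (n ^ 2)).
Proof.
have Uw : U n.+1 = w by rewrite /param insubF //= ltnn.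
have Uu : map U (iota 1 n) = [seq u i | i <- enum 'I_n].
  rewrite (iotaDl 1 0) -val_enum_ord -!map_comp; apply: eq_map => i /=.
  by rewrite /param /= add0n valK.
set N := _ * _ ^+ (n ^ 2).
rewrite sum_configurations sum_orientations.
rewrite /pos_arcs (sum_subset_ksum _ (fun=> true) uniq_arcs) ksum_cat.
transitivity (ksum (top_keys n) (fun g => (all g (top_keys n))%:R *
   (N^-1 * partition_fun Q p w (map U (iota 1 n)) (map g (top_keys n)))) (fun=> true)).
  apply: eq_ksum => g _.
  transitivity (ksum (tri_keys 1 n) (fun f => (all f (top_keys n))%:R * (N^-1 * tri_weight Q p U
    n 1 n f)) g).
    apply: eq_ksum => f _; rewrite -/(orientation_of f) tops_upE.
    rewrite -[(pt n.+1 n.+1, _)]/(arc n (v n.+1 n.+1)) orient_arc; last by rewrite /in_range; lia.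
    have := config_weightE f; rewrite -/N mulrC [RHS]mulrC => <-.
    by case: (all _ _); case: (f _); rewrite /= ?mul1r ?mul0r.
  rewrite (ksum_factor (W := fun f => (all f (top_keys n))%:R)); last first.
    move=> f ag; congr (_ %:R); congr nat_of_bool; apply: eq_in_all => k /top_tri_disjoint kt.
    exact: ag.
  rewrite ksumZ ksum_tri //; congr (_ * (_ * _)).
  by rewrite Uw /top_keys -map_comp.
rewrite (ksum_all_true (fun s => N^-1 * partition_fun Q p w (map U (iota 1 n)) s)) ?uniq_top_keys
  //.
have -> : size (top_keys n) = n.*2.+1 by rewrite size_map size_iota.
by rewrite mulrC Uu /Zup size_map size_enum_ord.
Qed.
End Weights.

(** * Change of field and specialization of indeterminates *)

Section Transfer.
Variables (F L : fieldType) (phi : {rmorphism F -> L}).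
Variable Q : F.

Lemma rmorph_sigma x : phi (sigma x) = sigma (phi x).
Proof. by rewrite /sigma rmorphB fmorphV. Qed.

Lemma rmorph_bulk x t b h g :
  phi (bulk_wt Q x t b h g) = bulk_wt (phi Q) (phi x) t b h g.
Proof.
by case: t b h g => [] [] [] [] /=;
  rewrite ?rmorph0 ?rmorph_sigma ?rmorphM ?fmorphV ?rmorphXn.
Qed.

Lemma rmorph_left P x t h : phi (left_wt Q P x t h) = left_wt (phi Q) (phi P) (phi x) t h.
Proof.
by case: t h => [] [] /=;
  rewrite ?rmorph0 ?rmorph_sigma ?rmorphM ?fmorphV ?rmorphXn ?rmorphM.
Qed.

Lemma rmorph_row u cols h ts k :
  phi (row_sum Q u cols h ts k)
  = row_sum (phi Q) (phi u) (map phi cols) h ts (fun bs g => phi (k bs g)).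
Proof.
elim: cols h ts k => [//|c cols IH] h ts k /=.
rewrite rmorph_sum; apply: eq_bigr => b _; rewrite rmorph_sum; apply: eq_bigr => g _.
by rewrite rmorphM IH rmorph_bulk rmorphM.
Qed.

Lemma rmorph_partition p w us ts : phi (partition_fun Q p w us ts)
  = partition_fun (phi Q) (phi p) (phi w) (map phi us) ts.
Proof.
elim: us ts => [|u us IH] ts /=; first by rewrite rmorph_nat.
rewrite rmorph_sum; apply: eq_bigr => h _; rewrite rmorphM rmorph_left rmorph_row.
rewrite map_cat /= map_rev; congr (_ * _); apply: eq_row_sum => bs g _.
by rewrite rmorphM IH /right_wt rmorph_left !fmorphV.
Qed.

Lemma rmorph_pole_den x : phi (pole_den Q x) = pole_den (phi Q) (phi x).
Proof. by rewrite /pole_den rmorphM !rmorph_sigma !rmorphM fmorphV. Qed.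

Lemma rmorph_nth (us : seq F) i : (map phi us)`_i = phi us`_i.
Proof. by elim: us i => [|u us IH] [|i] //=; rewrite rmorph0. Qed.

Lemma rmorph_vdm_sqr us : phi (vdm_sqr us) = vdm_sqr (map phi us).
Proof.
elim: us => [|u us IH] /=; first exact: rmorph1.
rewrite rmorphM IH rmorph_prod big_map; congr (_ * _); apply: eq_bigr => c _.
by rewrite rmorphXn rmorph_sigma rmorphM fmorphV.
Qed.

(** Both sides are built from the parameters by field operations, and
    morphisms of fields are injective. *)
Lemma det_formula_rmorph p us : det_formula (phi Q) (phi p) (map phi us) -> det_formula Q p us.
Proof.
rewrite /det_formula => H; apply: (fmorph_inj phi); rewrite !rmorphM rmorph_vdm_sqr.
have -> : phi (Zup Q p p us) = Zup (phi Q) (phi p) (phi p) (map phi us).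
  rewrite /Zup size_map.
  by rewrite rmorph_partition.
rewrite {}H; congr (_ * _ * _).
- by rewrite /boundary_prod rmorph_prod big_map; apply: eq_bigr => c _;
  rewrite rmorph_pole_den rmorphM.
- rewrite /pole_prod_all rmorph_prod big_map; apply: eq_bigr => a _.
  by rewrite rmorph_prod big_map; apply: eq_bigr => b _; rewrite rmorph_pole_den rmorphM.
rewrite size_map -det_map_mx; congr (\det _); apply/matrixP => i j; rewrite !mxE !rmorph_nth.
by rewrite /kern rmorphD !fmorphV !rmorph_sigma !rmorphM fmorphV rmorphM.
Qed.

Lemma rmorph_node_squares q p us : map phi (node_squares q p us) = node_squares (phi q) (phi p)
  (map phi us).
Proof.
have e2 x : phi (x ^- 2) = phi x ^- 2 by rewrite fmorphV rmorphXn.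
rewrite /node_squares !map_cat -!map_comp /=; congr (_ ++ (_ ++ (_ ++ _))).
- by apply: eq_map => x /=; rewrite rmorphXn.
- by apply: eq_map => x /=; rewrite e2 rmorphM rmorphXn.
- by apply: eq_map => x /=; rewrite rmorphXn rmorphM rmorphXn fmorphV.
by rewrite !(rmorphN, e2, rmorphM, fmorphV, rmorphXn).
Qed.
End Transfer.

(** If -1 has no square root then X^2 + 1 is irreducible, and the formula
    is transferred from the field that it generates. *)
Theorem det_formula_generic (F : fieldType) (charF : [pchar F] =i pred0) (q p : F) (us : seq F) :
    q != 0 -> p != 0 -> (q ^+ 2) ^+ 8 != 1 -> all (predC1 0) us ->
    uniq (node_squares q p us) ->
  det_formula (q ^+ 2) p us.
Proof.
move=> q0 p0 Q8 us0 uN; apply/eqP; apply: contraT => nclaim.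
have noroot (x : F) : ~~ root ('X^2 + 1) x.
  apply: contra nclaim => /rootP; rewrite hornerD hornerXn hornerC => /eqP.
  by rewrite addr_eq0 => /eqP x2; apply/eqP/(det_formula_sqrtN1 charF q0 p0 x2 Q8 us0 uN).
have szX : size ('X^2 + 1 : {poly F}) = 3 by rewrite size_polyDl ?size_polyXn // size_poly1.
have irr : irreducible_poly ('X^2 + 1 : {poly F}).
  by apply: cubic_irreducible noroot; rewrite szX.
have [L _ [z rz _]] := irredp_FAdjoin irr.
pose phi : {rmorphism F -> L} := in_alg L.
have z2 : z ^+ 2 = -1.
  move/rootP: rz; rewrite rmorphD /= map_polyXn rmorph1 hornerD hornerXn hornerC => /eqP.
  by rewrite addr_eq0 => /eqP.
have charL : [pchar L] =i pred0 by move=> x; rewrite (fmorph_pchar phi) charF.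
case/negP: nclaim; apply/eqP/(det_formula_rmorph (phi := phi)).
rewrite rmorphXn; apply: (det_formula_sqrtN1 (im := z)) => //.
- by rewrite fmorph_eq0.
- by rewrite fmorph_eq0.
- by rewrite -!rmorphXn fmorph_eq1.
- apply/allP => _ /mapP[x xus ->]; rewrite -[predC1 0 _]/(phi x != 0) fmorph_eq0.
  exact: (allP us0).
by rewrite -rmorph_node_squares map_inj_uniq //; apply: fmorph_inj.
Qed.

Section Specialize.
Variables (K : fieldType) (m : nat) (a : 'I_m -> K).
Local Notation F := (ratfun K m).
Local Notation frac := (@FracField.tofrac {mpoly K[m]}).

(** Evaluation of rational functions at the point [a] is partial, hence a
    relation. *)
Definition specializes (x : F) (y : K) : Prop :=
  exists P R : {mpoly K[m]}, [/\ R.@[a] != 0, x = frac P / frac R & y = P.@[a] / R.@[a]].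

(** A rational function has at most one value at a point; so elements with
    different values are different. *)
Lemma specializes_fun x y y' : specializes x y -> specializes x y' -> y = y'.
Proof.
move=> [P [R [nR -> ->]]] [P' [R' [nR' e ->]]].
have R0 : frac R != 0 by rewrite tofrac_eq0; apply: contraNneq nR => ->; rewrite meval0.
have R0' : frac R' != 0 by rewrite tofrac_eq0; apply: contraNneq nR' => ->; rewrite meval0.
have /eqP : frac (P * R') = frac (P' * R).
  by move/eqP: e; rewrite eqr_div // -!tofracM => /eqP.
rewrite tofrac_eq => /eqP/(congr1 (meval a)); rewrite !mevalM => e'.
by apply/eqP; rewrite eqr_div // e'.
Qed.

Lemma specializesM x y x' y' : specializes x y -> specializes x' y' -> specializes (x * x') (y *
  y').
Proof.
move=> [P [R [nR -> ->]]] [P' [R' [nR' -> ->]]]; exists (P * P'), (R * R').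
by rewrite !mevalM mulf_neq0 // !tofracM !mulf_div.
Qed.

Lemma specializesV x y : y != 0 -> specializes x y -> specializes x^-1 y^-1.
Proof.
move=> y0 [P [R [nR -> yE]]]; exists R, P; rewrite yE !invf_div; split=> //.
by apply: contraNneq y0 => P0; rewrite yE P0 mul0r.
Qed.

Lemma specializesN x y : specializes x y -> specializes (- x) (- y).
Proof.
move=> [P [R [nR -> ->]]]; exists (- P), R.
by rewrite mevalN tofracN !mulNr.
Qed.

Lemma specializesX x y k : specializes x y -> specializes (x ^+ k) (y ^+ k).
Proof.
move=> xy; elim: k => [|k IH]; last by rewrite !exprS; exact: specializesM.
by exists 1, 1; rewrite meval1 tofrac1 !divr1 oner_eq0.
Qed.

Lemma specializes_var i : specializes (ratX K i) (a i).
Proof. by exists 'X_i, 1; rewrite meval1 tofrac1 !divr1 oner_eq0 mevalXU. Qed.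

Lemma specializes_neq0 x y : specializes x y -> y != 0 -> x != 0.
Proof.
move=> xy y0; apply: contraNneq y0 => x0; apply/eqP; apply: (specializes_fun xy); rewrite x0.
by exists 0, 1; rewrite meval1 meval0 tofrac0 !mul0r oner_eq0.
Qed.

Fixpoint specializes_all (xs : seq F) (ys : seq K) : Prop :=
  match xs, ys with
  | x :: xs', y :: ys' => specializes x y /\ specializes_all xs' ys'
  | [::], [::] => True
  | _, _ => False
  end.

Lemma specializes_cat xs ys xs' ys' : specializes_all xs ys -> specializes_all xs' ys' ->
  specializes_all (xs ++ xs') (ys ++ ys').
Proof. by elim: xs ys => [|x xs IH] [|y ys] //= [xy /IH H] /H. Qed.

Lemma specializes_map (f : F -> F) (g : K -> K) xs ys : all (predC1 0) ys ->
  (forall x y, y != 0 -> specializes x y -> specializes (f x) (g y)) -> specializes_all xs ys ->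
  specializes_all (map f xs) (map g ys).
Proof.
move=> + H; elim: xs ys => [|x xs IH] [|y ys] //= /andP[y0 ys0] [xy s].
by split; [apply: H | apply: IH].
Qed.

Lemma specializes_mem xs ys x : specializes_all xs ys -> x \in xs -> exists2 y, y \in ys &
  specializes x y.
Proof.
elim: xs ys => [|x' xs IH] [|y ys] //= [xy s]; rewrite inE => /orP[/eqP ->|/IH].
  by exists y; rewrite ?mem_head.
by move=> /(_ _ s)[y' yy' ?]; exists y'; rewrite // inE yy' orbT.
Qed.

Lemma specializes_uniq xs ys : specializes_all xs ys -> uniq ys -> uniq xs.
Proof.
elim: xs ys => [|x xs IH] [|y ys] //= [xy s] /andP[ny /(IH _ s) ->]; rewrite andbT.
apply: contra ny => /(specializes_mem s)[y' y'ys xy'].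
by rewrite (specializes_fun xy xy').
Qed.

Lemma specializes_node_squares q p us vq vp vs : vq != 0 -> vp != 0 -> all (predC1 0) vs ->
    specializes q vq -> specializes p vp -> specializes_all us vs ->
  specializes_all (node_squares q p us) (node_squares vq vp vs).
Proof.
move=> q0 p0 vs0 sq sp ss.
have Q0 : vq ^+ 2 != 0 by rewrite expf_neq0.
have sQ := specializesX 2 sq.
apply: specializes_cat; first by apply: specializes_map ss => // x y _; exact: specializesX.
apply: specializes_cat.
  apply: specializes_map ss => // x y y0 xy; apply: specializesV;
    first by rewrite expf_neq0 // mulf_neq0.
  exact/specializesX/specializesM.
apply: specializes_cat.
  by apply: specializes_map ss => // x y y0 xy; apply/specializesX/specializesM => //;
    apply: specializesV.
do !split => //.
- exact: specializesV.
- exact/specializesN/specializesV.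
- exact: specializesN.
- by apply: specializesV; [rewrite expf_neq0 // mulf_neq0 | exact/specializesX/specializesM].
- by apply/specializesX/specializesM => //; apply: specializesV.
Qed.
End Specialize.

(** * Genericity of the indeterminates and the formula *)

Section Generic.
Variables (K : fieldType) (n : nat).
Hypothesis charK : [pchar K] =i pred0.

Let nat0 (k : nat) : (k%:R == 0 :> K) = (k == 0%N) := (pcharf0P K).1 charK k.

Lemma two_neq0 : 2%:R != 0 :> K. Proof. by rewrite nat0. Qed.

Definition signed_pow2 (c : bool * int) : K := (-1) ^+ c.1 * 2%:R ^ c.2.

(** In characteristic 0 the numbers 2^k and -2^k do not coincide for
    different integers k, nor with each other. *)
Lemma signed_pow2_inj : injective signed_pow2.
Proof.
have key (s : bool) (k : nat) : (-1) ^+ s * 2%:R ^+ k = 1 :> K -> s = false /\ k = 0%N.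
  case: s; rewrite ?mulN1r ?mul1r => /eqP.
    by rewrite eqr_oppLR -subr_eq0 opprK -natrX natr1 nat0.
  rewrite -subr_eq0 -natrX; case: k => [//|k].
  have le : (0 < 2 ^ k.+1)%N by rewrite expn_gt0.
  rewrite -[X in _ - X]/(1%:R) -natrB // nat0 subn_eq0 expnS => le1.
  by move: (expn_gt0 2 k) le1; case: (2 ^ k)%N => //= a _; lia.
have wl (s s' : bool) (z z' : int) : (z' <= z)%R -> signed_pow2 (s, z) = signed_pow2 (s', z') ->
  (s, z) = (s', z').
  rewrite -Num.Theory.subr_ge0 /signed_pow2 /= => le e.
  have [k zE] : exists k : nat, z = z' + k.
    by exists `|z - z'|%N; rewrite gez0_abs // addrCA subrr addr0.
  have [] := key (s (+) s') k.
    have nz : (-1) ^+ s' * 2%:R ^ z' != 0 :> K by rewrite mulf_neq0 ?signr_eq0 ?expfz_neq0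
      ?two_neq0.
    apply: (mulfI nz); rewrite mulr1 -[RHS]e zE expfzDr ?two_neq0 // signr_addb -exprnP.
    rewrite [RHS]mulrC mulrACA mulrA -!signr_addb addbC addbK; ring.
  move=> /eqP; rewrite addbC => + k0; rewrite zE k0 addr0.
  by case: (s) (s') => [] [].
move=> [s z] [s' z'] e; have /orP[le|le] := Order.TotalTheory.le_total z' z; first exact: wl.
by apply/esym/wl.
Qed.

(** Signs and exponents of [node_squares] when q = 2, u_i = 2^(5(i+1)) and
    p = 2^(5(n+1)).  The exponents are distinct because the blocks have residues
    0, 6, 4, 8 and 2 modulo 10, and p takes the index after those of the u_i. *)
Definition node_codes : seq (bool * int) :=
  [seq (false, 10 * (val i).+1%:Z) | i <- enum 'I_n]
  ++ [seq (false, - 4 - 10 * (val i).+1%:Z) | i <- enum 'I_n]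
  ++ [seq (false, 4 - 10 * (val i).+1%:Z) | i <- enum 'I_n]
  ++ [:: (false, -2); (true, -2); (false, 2); (true, 2);
         (false, - 4 - 10 * n.+1%:Z); (false, 4 - 10 * n.+1%:Z)].

Lemma node_codes_uniq : uniq node_codes.
Proof.
have ui (c d : int) : d != 0 -> uniq [seq (false, c + d * (val i).+1%:Z) | i <- enum 'I_n].
  move=> d0; rewrite map_inj_uniq ?enum_uniq // => i j [] /addrI /(mulfI d0) e.
  by apply: val_inj => /=; lia.
rewrite /node_codes !cat_uniq; do !(apply/andP; split).
- by under eq_map do rewrite -[10 * _]add0r; apply: ui.
- apply/hasPn => c; rewrite !mem_cat => /or3P[/mapP[i _ ->]|/mapP[i _ ->]|];
    try by apply/negP => /mapP[j _ []]; have := ltn_ord j; have := ltn_ord i; lia.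
  by rewrite !inE => /or4P[/eqP->|/eqP->|/eqP->|/or3P[/eqP->|/eqP->|/eqP->]];
    apply/negP => /mapP[j _ []] //; have := ltn_ord j; lia.
- under eq_map do rewrite -mulNr; exact: ui.
- apply/hasPn => c; rewrite !mem_cat => /orP[/mapP[i _ ->]|];
    try by apply/negP => /mapP[j _ []]; have := ltn_ord j; have := ltn_ord i; lia.
  by rewrite !inE => /or4P[/eqP->|/eqP->|/eqP->|/or3P[/eqP->|/eqP->|/eqP->]];
    apply/negP => /mapP[j _ []] //; have := ltn_ord j; lia.
- under eq_map do rewrite -mulNr; exact: ui.
- apply/hasPn => c.
  by rewrite !inE => /or4P[/eqP->|/eqP->|/eqP->|/or3P[/eqP->|/eqP->|/eqP->]];
    apply/negP => /mapP[j _ []] //; have := ltn_ord j; lia.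
all: by rewrite ?inE ?xpair_eqE //=; lia.
Qed.

Definition node_point (i : 'I_(2 + n)) : K :=
  match split i with
  | inl j => if j == 0 then 2%:R ^+ (5 * n.+1) else 2%:R
  | inr j => 2%:R ^+ (5 * j.+1)
  end.

Lemma point_node_squares_uniq :
  uniq (node_squares (2%:R : K) (2%:R ^+ (5 * n.+1)) [seq 2%:R ^+ (5 * (val i).+1) | i <- enum
    'I_n]).
Proof.
suff -> : node_squares (2%:R : K) (2%:R ^+ (5 * n.+1)) [seq 2%:R ^+ (5 * (val i).+1) | i <- enum
  'I_n]
   = map signed_pow2 node_codes.
  by rewrite map_inj_uniq ?node_codes_uniq //; exact: signed_pow2_inj.
have t0 := two_neq0.
have e1 k : (2%:R ^+ 2 * 2%:R ^+ (5 * k)) ^- 2 = 2%:R ^ (- 4 - 10 * k%:Z) :> K.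
  by rewrite -exprD -exprM exprnN; congr (_ ^ _); lia.
have e2 k : (2%:R ^+ 2 / 2%:R ^+ (5 * k)) ^+ 2 = 2%:R ^ (4 - 10 * k%:Z) :> K.
  have -> : 4 - 10 * k%:Z = 4%N%:Z + - (10 * k)%N%:Z by lia.
  rewrite expfzDr // -exprnN -exprnP exprMn -exprM exprVn -exprM.
  by congr (_ * _^-1); congr (_ ^+ _); lia.
rewrite /node_squares /node_codes !map_cat -!map_comp; congr (_ ++ (_ ++ (_ ++ _))).
- apply: eq_map => i /=; rewrite /signed_pow2 /= mul1r -exprM exprnP; congr (_ ^ _); lia.
- by apply: eq_map => i /=; rewrite /signed_pow2 /= mul1r e1.
- by apply: eq_map => i /=; rewrite /signed_pow2 /= mul1r e2.
have e3 : 2%:R ^ (-2)%R = (2%:R ^+ 2)^-1 :> K by rewrite exprnN.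
have e4 : 2%:R ^ 2%R = 2%:R ^+ 2 :> K by rewrite exprnP.
by rewrite /= /signed_pow2 /= e1 e2 e3 e4 !mul1r !mulN1r.
Qed.

(** The nodes have distinct values at [node_point]. *)
Lemma generic_node_squares_uniq :
  let F := ratfun K (2 + n) in
  let p : F := ratX K (lshift n (ord0 : 'I_2)) in
  let q : F := ratX K (lshift n (ord_max : 'I_2)) in
  let us := [seq ratX K (rshift 2 i) | i <- enum 'I_n] in
  [/\ q != 0, p != 0, (q ^+ 2) ^+ 8 != 1, all (predC1 0) us & uniq (node_squares q p us)].
Proof.
move=> F p q us; have t0 := two_neq0.
have sp : specializes node_point p (2%:R ^+ (5 * n.+1)).
  have := specializes_var node_point (lshift n (ord0 : 'I_2)).
  by rewrite {2}/node_point (unsplitK (inl _ : 'I_2 + 'I_n)).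
have sq : specializes node_point q 2%:R.
  have := specializes_var node_point (lshift n (ord_max : 'I_2)).
  by rewrite {2}/node_point (unsplitK (inl _ : 'I_2 + 'I_n)).
have su i : specializes node_point (ratX K (rshift 2 i)) (2%:R ^+ (5 * (val i).+1)).
  have := specializes_var node_point (rshift 2 i).
  by rewrite {2}/node_point (unsplitK (inr _ : 'I_2 + 'I_n)).
split.
- exact: specializes_neq0 sq t0.
- by apply: specializes_neq0 sp _; rewrite expf_neq0.
- apply/eqP => Q8; have := specializesX 8 (specializesX 2 sq); rewrite Q8.
  move=> /specializes_fun/(_ (specializesX 0 sq)) /eqP.
  by rewrite -!natrX -subr_eq0 -[X in _ - X]/(1%:R) -natrB // nat0.
- by apply/allP => _ /mapP[i _ ->]; apply: specializes_neq0 (su i) _; rewrite expf_neq0.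
apply: specializes_uniq point_node_squares_uniq; apply: specializes_node_squares sq sp _ => //.
- by rewrite expf_neq0.
- by apply/allP => _ /mapP[i _ ->]; rewrite /= expf_neq0.
by rewrite /us; elim: (enum 'I_n).
Qed.
End Generic.

Section Products.
Variables (F : fieldType).

Lemma vdm_sqrE (us : seq F) :
  vdm_sqr us = \prod_(i < size us) \prod_(j < size us | (i < j)%N) sigma (us`_i / us`_j) ^+ 2.
Proof.
elim: us => [|u us IH] /=; first by rewrite big_ord0.
rewrite big_ord_recl; congr (_ * _).
  rewrite [RHS]big_mkcond big_ord_recl /= mul1r (big_nth 0) big_mkord.
  by apply: eq_bigr => j _.
rewrite IH; apply: eq_bigr => i _; rewrite [RHS]big_mkcond big_ord_recl /= mul1r.
by rewrite [LHS]big_mkcond; apply: eq_bigr => j _; rewrite /bump /= !add1n ltnS.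
Qed.

Lemma vdm_sqr_neq0 (us : seq F) : all (predC1 0) us -> uniq [seq x ^+ 2 | x <- us] ->
  vdm_sqr us != 0.
Proof.
elim: us => [|u us IH] /=; first by rewrite oner_eq0.
move=> /andP[u0 us0] /andP[nu uu]; rewrite mulf_neq0 ?IH //.
rewrite prodf_seq_neq0; apply/allP => c cus /=.
have c0 : c != 0 := allP us0 _ cus.
rewrite expf_neq0 // sigma_eq0 ?mulf_neq0 ?invr_neq0 //.
apply: contra nu => /eqP e; apply/mapP; exists c => //.
by rewrite -[RHS]mul1r -e; field.
Qed.
End Products.

Lemma ratfun_char0 (K : fieldType) m : [pchar K] =i pred0 -> [pchar (ratfun K m)] =i pred0.
Proof.
move=> charK; apply/(pcharf0P _) => k.
rewrite -(rmorph_nat (@FracField.tofrac {mpoly K[m]})) tofrac_eq0.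
by rewrite -(rmorph_nat (@mpolyC m K)) mpolyC_eq0 (pcharf0P K).1.
Qed.

Theorem Z_up_QAST_formula (F : fieldType) (n : nat) (q p : F) (u : 'I_n -> F)
    (us := [seq u i | i <- enum 'I_n]) : [pchar F] =i pred0 ->
    q != 0 -> p != 0 -> (q ^+ 2) ^+ 8 != 1 -> all (predC1 0) us ->
    uniq (node_squares q p us) ->
  Z_up_QAST p q u p =
    ((\prod_(i < n) (sigma (q ^+ 2 * p * u i)
                     * sigma (q ^+ 2 * p^-1 * (u i)^-1)))
     * (\prod_(i < n) \prod_(j < n)
          (sigma (q ^+ 2 * u i * u j)
           * sigma (q ^+ 2 * (u i)^-1 * (u j)^-1))))
    / (sigma (q ^+ 2) ^+ (2 * n) * sigma (q ^+ 4) ^+ (n ^ 2)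
       * \prod_(i < n) \prod_(j < n | (i < j)%N) sigma (u i * (u j)^-1) ^+ 2)
    * \det (\matrix_(i < n, j < n)
              ((sigma (q ^+ 2 * u i * u j))^-1
               + (sigma (q ^+ 2 * (u i)^-1 * (u j)^-1))^-1)).
Proof.
move=> charF q0 p0 Q8 us0 uN.
have szus : size us = n by rewrite size_map size_enum_ord.
have nth_us (i : 'I_n) : us`_i = u i.
  by rewrite (nth_map i) ?size_enum_ord // nth_ord_enum.
have s2 : sigma (q ^+ 2) != 0.
  rewrite sigma_eq0 ?expf_neq0 //; apply: contra Q8 => /eqP e.
  by rewrite (exprM _ 2 4) e expr1n.
have s4 : sigma (q ^+ 4) != 0.
  rewrite sigma_eq0 ?expf_neq0 //; apply: contra Q8 => /eqP e.
  by rewrite -exprM (exprM q 8 2) (exprM q 4 2) e expr1n.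
have V0 : vdm_sqr us != 0.
  by apply: vdm_sqr_neq0 => //; move: uN; rewrite /node_squares cat_uniq => /and3P[].
have := det_formula_generic charF q0 p0 Q8 us0 uN.
rewrite /det_formula szus (Z_up_QASTE p p u s2 s4) -/us.
have VE : vdm_sqr us = \prod_(i < n) \prod_(j < n | (i < j)%N) sigma (u i * (u j)^-1) ^+ 2.
  rewrite vdm_sqrE szus; apply: eq_bigr => i _; apply: eq_bigr => j _.
  by rewrite !nth_us.
have pole_denM x y : pole_den (q ^+ 2) (x * y) = sigma (q ^+ 2 * x * y) * sigma (q ^+ 2 * x^-1 *
  y^-1).
  by rewrite /pole_den invfM !mulrA.
have -> : boundary_prod (q ^+ 2) p us = \prod_(i < n) (sigma (q ^+ 2 * p * u i)
                     * sigma (q ^+ 2 * p^-1 * (u i)^-1)).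
  by rewrite /boundary_prod big_map big_enum; apply: eq_bigr => i _; rewrite pole_denM.
have -> : pole_prod_all (q ^+ 2) us = \prod_(i < n) \prod_(j < n)
          (sigma (q ^+ 2 * u i * u j) * sigma (q ^+ 2 * (u i)^-1 * (u j)^-1)).
  rewrite /pole_prod_all big_map big_enum; apply: eq_bigr => i _.
  by rewrite big_map big_enum; apply: eq_bigr => j _; rewrite pole_denM.
have -> : kern_mx (q ^+ 2) n us = \matrix_(i < n, j < n)
    ((sigma (q ^+ 2 * u i * u j))^-1 + (sigma (q ^+ 2 * (u i)^-1 * (u j)^-1))^-1).
  by apply/matrixP => i j; rewrite !mxE !nth_us /kern invfM !mulrA.
rewrite -VE => e.
have N0 : sigma (q ^+ 2) ^+ (2 * n) * sigma (q ^+ 4) ^+ (n ^ 2) != 0.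
  by rewrite mulf_neq0 ?expf_neq0.
move: (sigma (q ^+ 2) ^+ (2 * n) * _) N0 => N N0.
apply: (mulIf V0); rewrite mulrAC e.
by field; rewrite N0 V0.
Qed.

Theorem corollary6p2 (K : fieldType) (charK : [pchar K] =i pred0)
    (n : nat) (n_gt0 : (0 < n)%N) :
  let F := ratfun K (2 + n) in
  let p : F := ratX K (lshift n (ord0 : 'I_2)) in
  let q : F := ratX K (lshift n (ord_max : 'I_2)) in
  let u : 'I_n -> F := fun i => ratX K (rshift 2 i) in
  Z_up_QAST p q u p =
    ((\prod_(i < n) (sigma (q ^+ 2 * p * u i)
                     * sigma (q ^+ 2 * p^-1 * (u i)^-1)))
     * (\prod_(i < n) \prod_(j < n)
          (sigma (q ^+ 2 * u i * u j)
           * sigma (q ^+ 2 * (u i)^-1 * (u j)^-1))))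
    / (sigma (q ^+ 2) ^+ (2 * n) * sigma (q ^+ 4) ^+ (n ^ 2)
       * \prod_(i < n) \prod_(j < n | (i < j)%N) sigma (u i * (u j)^-1) ^+ 2)
    * \det (\matrix_(i < n, j < n)
              ((sigma (q ^+ 2 * u i * u j))^-1
               + (sigma (q ^+ 2 * (u i)^-1 * (u j)^-1))^-1)).
Proof.
move=> F p q u.
have [q0 p0 Q8 us0 uN] := generic_node_squares_uniq n charK.
exact: (Z_up_QAST_formula (ratfun_char0 (2 + n) charK) q0 p0 Q8 us0 uN).
Qed.
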